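(* Let $\mathbb{F}$ be a field and let $\Gamma$ be a finite uniform ranked poset (with unique minimal element $*$) for which the $\mathbb{F}$-algebra $R_\Gamma$ is Koszul. Let $Y$ be the total space (geometric realization) of the order complex of $\Gamma\setminus\{*\}$. Then $H^n(Y)\cong H_{R_\Gamma}(n,0)$ for all $n$, where $H^n(Y)$ is cohomology with coefficients in $\mathbb{F}$.
   Context: Fix a field $\mathbb{F}$. A poset $\Gamma$ with unique minimal element $*$ and strict order $<$ is ranked if for all $b\in\Gamma$ any two maximal chains in $[*,b]$ have the same length; this length is the rank $rk_\Gamma(b)$ (so $rk_\Gamma( * )=0$). For $x\in\Gamma$, $\Gamma_x=[*,x]$ and $S_x(k)=\{y\in\Gamma_x : rk_\Gamma(y)=rk_\Gamma(x)-k\}$. Uniform: for $a,b\in S_x(1)$ write $a\sim_x b$ if there is $c\in S_a(1)\cap S_b(1)$, and extend $\sim_x$ to an equivalence relation on $S_x(1)$; $\Gamma$ is uniform if for every $x\ne *$ the relation $\sim_x$ has a unique equivalence class. The algebra $R_\Gamma$: generators $r_x$ for $*\neq x\in\Gamma$, and relations $r_xr_y=0$ whenever $y\notin S_x(1)$, and $r_x\sum_{y\in S_x(1)}r_y=0$ for all $x$ (terms with $y=*$ are omitted). It is graded with each $r_x$ of degree 1; $R_{\Gamma,m}$ is the degree $m$ part. A graded connected $\mathbb{F}$-algebra $R$ is Koszul if the bigraded Yoneda algebra $\mathrm{Ext}_R^{*,*}(\mathbb{F},\mathbb{F})$ is generated as an $\mathbb{F}$-algebra by $\mathrm{Ext}_R^{1,1}(\mathbb{F},\mathbb{F})$.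 Internal cohomology: let $d_\Gamma=\sum_{*\ne x\in\Gamma}r_x$, and also write $d_\Gamma$ for left multiplication by this element, so $d_\Gamma^2=0$. For $n\ge k\ge0$ put $R_\Gamma(n,k)=\sum_{rk_\Gamma(y)=n+1}r_yR_{\Gamma,n-k}$ (and $R_\Gamma(n,k)=0$ for $n<k$). Then $d_\Gamma$ maps $R_\Gamma(n,k)$ to $R_\Gamma(n+1,k)$, giving for each $k$ a cochain complex $(R_\Gamma(\cdot,k),d_\Gamma)$, and $H_{R_\Gamma}(n,k)$ denotes its cohomology in degree $n$. The order complex $\Delta(P)$ of a finite poset $P$ is the simplicial complex whose $n$-simplices are the chains $b_0<b_1<\dots<b_n$ in $P$. *)

(* Defs.v *)
From HB Require Import structures.
From mathcomp Require Import all_boot all_order all_algebra.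
From mathcomp Require Import all_classical all_reals.
From mathcomp Require Import topology normedtype.
(* The notations of monalg clash with those of the analysis library. *)
From mathcomp Require Import -(notations) monalg.

Set Implicit Arguments.
Unset Strict Implicit.
Unset Printing Implicit Defensive.

Import Order.TTheory GRing.Theory Num.Theory.
Import numFieldNormedType.Exports.

Local Open Scope classical_set_scope.
Local Open Scope ring_scope.

Section Subspace.
Variables (F : fieldType) (V : lmodType F) (Z : submodClosed V).

Record subspace_of := Subspace { subspace_val : V; _ : subspace_val \in Z }.

HB.instance Definition _ := [isSub for subspace_val].
HB.instance Definition _ := [Choice of subspace_of by <:].
HB.instance Definition _ := [SubChoice_isSubLmodule of subspace_of by <:].

End Subspace.

Section QuotientSpace.
Variables (F : fieldType) (V : lmodType F) (B : submodClosed V).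

(* [submodClosed] predicates are not canonically closed under opposites. *)
Definition submodule_pred : {pred V} := B.

Lemma submodule_pred_zmod : zmod_closed submodule_pred.
Proof.
split=> [|u v Bu Bv]; first exact: (rpred0 B).
by rewrite -scaleN1r; apply: (rpredD Bu); exact: rpredZ.
Qed.

HB.instance Definition _ :=
  GRing.isZmodClosed.Build V submodule_pred submodule_pred_zmod.

Definition quotient_space : Type := {ideal_quot submodule_pred}.

HB.instance Definition _ := GRing.Zmodule.on quotient_space.

Definition quotient_proj (v : V) : quotient_space :=
  \pi_({ideal_quot submodule_pred})%qT v.

Lemma quotient_projP u v :
  reflect (quotient_proj u = quotient_proj v) (u - v \in B).
Proof.
have -> : (u - v \in B) = (u - v \in submodule_pred) by [].
by rewrite Quotient.idealrBE; exact: eqP.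
Qed.

Definition quotient_repr (v : quotient_space) : V := repr v.

Lemma quotient_reprK : cancel quotient_repr quotient_proj.
Proof. exact: reprK. Qed.

Lemma quotient_projD : {morph quotient_proj : u v / u + v}.
Proof. exact: raddfD. Qed.

Definition quotient_scale (c : F) (v : quotient_space) : quotient_space :=
  quotient_proj (c *: quotient_repr v).

Lemma quotient_scaleE c v :
  quotient_scale c (quotient_proj v) = quotient_proj (c *: v).
Proof.
apply/quotient_projP; rewrite -scalerBr; apply: rpredZ.
by apply/quotient_projP; rewrite quotient_reprK.
Qed.

Lemma quotient_scaleA c1 c2 v :
  quotient_scale c1 (quotient_scale c2 v) = quotient_scale (c1 * c2) v.
Proof. by rewrite -[v]quotient_reprK !quotient_scaleE scalerA. Qed.

Lemma quotient_scale1 : left_id 1 quotient_scale.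
Proof. by move=> v; rewrite -[v]quotient_reprK quotient_scaleE scale1r. Qed.

Lemma quotient_scaleDr : right_distributive quotient_scale +%R.
Proof.
move=> c u v; rewrite -[u]quotient_reprK -[v]quotient_reprK !quotient_scaleE -!quotient_projD.
by rewrite quotient_scaleE scalerDr.
Qed.

Lemma quotient_scaleDl v :
  {morph quotient_scale^~ v : c1 c2 / c1 + c2}.
Proof.
by move=> c1 c2; rewrite -[v]quotient_reprK !quotient_scaleE scalerDl quotient_projD.
Qed.

HB.instance Definition _ := GRing.Zmodule_isLmodule.Build F quotient_space
  quotient_scaleA quotient_scale1 quotient_scaleDr quotient_scaleDl.

Lemma quotient_proj_linear : linear quotient_proj.
Proof.
move=> c u v; rewrite quotient_projD.
by rewrite -[c *: quotient_proj u]/(quotient_scale c _) quotient_scaleE.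
Qed.

HB.instance Definition _ := GRing.isLinear.Build F V quotient_space *:%R
  quotient_proj quotient_proj_linear.

End QuotientSpace.

Section Cohomology.
Variables (F : fieldType) (C : nat -> lmodType F).
Variable (delta : forall n, {linear C n -> C n.+1}).

Definition cocycles n : {pred C n} := fun u => delta n u == 0.

Definition coboundary n : C n -> Prop :=
  match n with
  | 0 => fun u => u = 0
  | m.+1 => fun u => exists v, delta m v = u
  end.

Lemma cocycles_submod n : submod_closed (@cocycles n).
Proof.
split=> [|c u v]; rewrite /cocycles !unfold_in ?linear0// linearP.
by move=> /eqP-> /eqP->; rewrite scaler0 addr0.
Qed.

HB.instance Definition _ n :=
  GRing.isSubmodClosed.Build F (C n) (@cocycles n) (@cocycles_submod n).

(* The delta below do satisfy delta \o delta = 0, but this is not needed to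
   form the quotient of the cocycles by those that are coboundaries. *)
Definition cobounding_cocycles n : {pred subspace_of (@cocycles n)} :=
  fun z => `[< coboundary (subspace_val z) >].

Lemma cobounding_cocycles_submod n : submod_closed (@cobounding_cocycles n).
Proof.
have key (z : subspace_of (@cocycles n)) : subspace_val z = val z by [].
split=> [|c u v]; rewrite /cobounding_cocycles !unfold_in.
  by apply/asboolP; rewrite key raddf0; case: (n) => [//|m]; exists 0; rewrite linear0.
move=> /asboolP hu /asboolP hv; apply/asboolP; move: hu hv.
rewrite !key linearP; case: n {key} u v => [u v /= -> ->|m u v].
  by rewrite scaler0 addr0.
by case=> [u' /= <-] [v' <-]; exists (c *: u' + v'); rewrite linearP.
Qed.

HB.instance Definition _ n :=
  GRing.isSubmodClosed.Build F (subspace_of (@cocycles n))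
    (@cobounding_cocycles n) (@cobounding_cocycles_submod n).

Definition cohomology n : lmodType F :=
  quotient_space (@cobounding_cocycles n).

End Cohomology.

Section QuotientAlgebra.
Variables (F : fieldType) (A : algType F) (G : set A).

Inductive in_ideal : A -> Prop :=
| in_ideal_gen g of G g : in_ideal g
| in_ideal0 : in_ideal 0
| in_idealD a b of in_ideal a & in_ideal b : in_ideal (a + b)
| in_idealMl a b of in_ideal b : in_ideal (a * b)
| in_idealMr a b of in_ideal a : in_ideal (a * b).

Definition ideal : {pred A} := fun a => `[< in_ideal a >].

Lemma ideal_submod : submod_closed ideal.
Proof.
split=> [|c a b]; rewrite /ideal !unfold_in; first exact/asboolP/in_ideal0.
move=> /asboolP Ia /asboolP Ib; apply/asboolP/in_idealD => //.
by rewrite -mulr_algl; exact: in_idealMl.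
Qed.

HB.instance Definition _ := GRing.isSubmodClosed.Build F A ideal ideal_submod.


Lemma ideal_mull a b : b \in ideal -> a * b \in ideal.
Proof. by rewrite !unfold_in => /asboolP ?; exact/asboolP/in_idealMl. Qed.

Lemma ideal_mulr a b : a \in ideal -> a * b \in ideal.
Proof. by rewrite !unfold_in => /asboolP ?; exact/asboolP/in_idealMr. Qed.

(* MathComp algebras are nonzero rings, hence the properness argument. *)
Definition quotient_alg (_ : ~ in_ideal 1) : Type := quotient_space ideal.

Variable (ideal_proper : ~ in_ideal 1).
Local Notation Q := (quotient_alg ideal_proper).

HB.instance Definition _ := GRing.Lmodule.copy Q (quotient_space ideal).

Definition quotient_map : A -> Q := @quotient_proj F A ideal.

HB.instance Definition _ := GRing.Linear.copy quotient_map
  (@quotient_proj F A ideal).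

Definition quotient_lift : Q -> A := @quotient_repr F A ideal.

Lemma quotient_mapP a b :
  reflect (quotient_map a = quotient_map b) (a - b \in ideal).
Proof. exact: quotient_projP. Qed.

Lemma quotient_map_surj : cancel quotient_lift quotient_map.
Proof. exact: quotient_reprK. Qed.

Definition quotient_mul (p q : Q) : Q := 
  quotient_map (quotient_lift p * quotient_lift q).

Lemma quotient_mulE a b :
  quotient_mul (quotient_map a) (quotient_map b) = quotient_map (a * b).
Proof.
set a' := quotient_lift (quotient_map a);
  set b' := quotient_lift (quotient_map b).
have Ia : a' - a \in ideal by apply/quotient_mapP; rewrite quotient_map_surj.
have Ib : b' - b \in ideal by apply/quotient_mapP; rewrite quotient_map_surj.
apply/quotient_mapP; rewrite -/a' -/b'.
have -> : a' * b' - a * b = (a' - a) * b' + a * (b' - b).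
  by rewrite mulrBl mulrBr addrA subrK.
by apply: rpredD; [exact: ideal_mulr | exact: ideal_mull].
Qed.

Let one : Q := quotient_map 1.

Lemma quotient_mulA : associative quotient_mul.
Proof.
move=> x y z; rewrite -[x]quotient_map_surj -[y]quotient_map_surj.
by rewrite -[z]quotient_map_surj !quotient_mulE mulrA.
Qed.

Lemma quotient_mul1 : left_id one quotient_mul.
Proof. by move=> x; rewrite -[x]quotient_map_surj quotient_mulE mul1r. Qed.

Lemma quotient_mulr1 : right_id one quotient_mul.
Proof. by move=> x; rewrite -[x]quotient_map_surj quotient_mulE mulr1. Qed.

Lemma quotient_mulDl : left_distributive quotient_mul +%R.
Proof.
move=> x y z; rewrite -[x]quotient_map_surj -[y]quotient_map_surj.
rewrite -[z]quotient_map_surj -raddfD !quotient_mulE -raddfD.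
by rewrite mulrDl.
Qed.

Lemma quotient_mulDr : right_distributive quotient_mul +%R.
Proof.
move=> x y z; rewrite -[x]quotient_map_surj -[y]quotient_map_surj.
rewrite -[z]quotient_map_surj -raddfD !quotient_mulE -raddfD.
by rewrite mulrDr.
Qed.

Lemma quotient_one_neq0 : one != 0.
Proof.
apply/negP => /eqP one0; apply: ideal_proper; apply/asboolP.
have /quotient_mapP : quotient_map 1 = quotient_map 0 by rewrite raddf0.
by rewrite subr0.
Qed.

HB.instance Definition _ := GRing.Zmodule_isNzRing.Build Q
  quotient_mulA quotient_mul1 quotient_mulr1 quotient_mulDl quotient_mulDr
  quotient_one_neq0.

Lemma quotient_mapM : {morph quotient_map : a b / a * b}.
Proof. by move=> a b; rewrite -quotient_mulE. Qed.

Lemma quotient_mapZ c a : quotient_map (c *: a) = c *: quotient_map a.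
Proof. exact: linearZ. Qed.

Lemma quotient_scalerAl (c : F) (x y : Q) : c *: (x * y) = (c *: x) * y.
Proof.
rewrite -[x]quotient_map_surj -[y]quotient_map_surj.
by rewrite -quotient_mapM -!quotient_mapZ -quotient_mapM scalerAl.
Qed.

HB.instance Definition _ :=
  GRing.Lmodule_isLalgebra.Build F Q quotient_scalerAl.

Lemma quotient_scalerAr (c : F) (x y : Q) : c *: (x * y) = x * (c *: y).
Proof.
rewrite -[x]quotient_map_surj -[y]quotient_map_surj.
by rewrite -quotient_mapM -!quotient_mapZ -quotient_mapM scalerAr.
Qed.

HB.instance Definition _ :=
  GRing.Lalgebra_isAlgebra.Build F Q quotient_scalerAr.

HB.instance Definition _ :=
  GRing.isMonoidMorphism.Build A Q quotient_map (erefl, quotient_mapM).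

End QuotientAlgebra.

Definition is_chain (d : Order.disp_t) (P : finPOrderType d) (C : {set P}) :=
  [forall x in C, forall y in C, (x >=< y)%O].

Section Poset.
Variables (d : Order.disp_t) (Gam : finBPOrderType d).
Implicit Types (x y a b : Gam) (C : {set Gam}).

Definition maximal_chain b C :=
  maxset (fun D : {set Gam} =>
    (D \subset [set x | (x <= b)%O]%SET) && is_chain D) C.

Definition ranked :=
  forall b C D, maximal_chain b C -> maximal_chain b D -> #|C| = #|D|.

(* The length of a chain is one less than its number of elements. *)
Definition rk b : nat := (\max_(C | maximal_chain b C) #|C|.-1)%N.

Definition S_ x k : {set Gam} :=
  [set y | (y <= x)%O && (rk y + k == rk x)%N]%SET.

Definition adjacent x : rel Gam :=
  [rel a b | [&& a \in S_ x 1, b \in S_ x 1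
    & [exists c, (c \in S_ a 1) && (c \in S_ b 1)]]].

Definition uniform :=
  forall x, x != \bot%O ->
    #|equivalence_partition (connect (adjacent x)) (S_ x 1)| = 1%N.

End Poset.

Definition free_alg (F : fieldType) (T : choiceType) : Type :=
  malg (fmonom T) F.

HB.instance Definition _ (F : fieldType) (T : choiceType) :=
  GRing.Lalgebra.copy (free_alg F T) (malg (fmonom T) F).

Section FreeAlgebra.
Variables (F : fieldType) (T : choiceType).

Lemma free_alg_scalerAr (c : F) (p q : malg (fmonom T) F) :
  c *: (p * q) = p * (c *: q).
Proof.
apply/malgP => w; rewrite mcoeffZ.
rewrite [RHS](mcoeffMlw w (finmap.fsubset_refl _) (msuppZ_le c q)).
rewrite mcoeffMl mulr_sumr; apply: eq_bigr => u _.
rewrite mulr_sumr; apply: eq_bigr => v _.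
by rewrite mcoeffZ mulrnAr mulrCA.
Qed.

HB.instance Definition _ :=
  GRing.Lalgebra_isAlgebra.Build F (free_alg F T) free_alg_scalerAr.

Definition letter (t : T) : free_alg F T := mkmalgU (fmu t) 1.

Definition homogeneous (m : nat) (p : free_alg F T) : Prop :=
  forall w : fmonom T, mcoeff w p != 0 -> fdeg w = m.

End FreeAlgebra.

Section PosetAlgebra.
Variables (F : fieldType) (d : Order.disp_t) (Gam : finBPOrderType d).

(* Index set of the generators r_x of R_Gamma. *)
Definition nonbot := {x : Gam | x != \bot%O}.

Local Notation X := (@letter F nonbot).

Definition poset_relations : set (free_alg F nonbot) :=
  [set p | (exists x y : nonbot,
              val y \notin S_ (val x) 1 /\ p = X x * X y)
        \/ (exists x : nonbot,
              p = X x * \sum_(y : nonbot | val y \in S_ (val x) 1) X y)].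

Lemma poset_relations_proper : ~ in_ideal poset_relations 1.
Proof.
pose e (p : free_alg F nonbot) : F := mcoeff monalg.one p.
have eM p q : e (p * q) = e p * e q by exact: (rmorphM (mcoeff monalg.one)).
have eD p q : e (p + q) = e p + e q by exact: (raddfD (mcoeff monalg.one)).
have eX x : e (X x) = 0.
  by rewrite /e mcoeffU fm1_eq1.
suff e0 p : in_ideal poset_relations p -> e p = 0.
  by move/e0; rewrite /e rmorph1 => /eqP; rewrite oner_eq0.
elim=> {p} [p|||p q _|p q _].
- by case=> [[x [y [_ ->]]]|[x ->]]; rewrite eM eX mul0r.
- by rewrite /e raddf0.
- by move=> p q _ p0 _ q0; rewrite eD p0 q0 addr0.
- by move=> q0; rewrite eM q0 mulr0.
- by move=> p0; rewrite eM p0 mul0r.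
Qed.

Definition poset_alg : algType F := quotient_alg poset_relations_proper.

Definition poset_proj : free_alg F nonbot -> poset_alg :=
  quotient_map poset_relations_proper.

HB.instance Definition _ := GRing.LRMorphism.copy poset_proj
  (quotient_map poset_relations_proper).

Definition gen (x : nonbot) : poset_alg := poset_proj (X x).

Definition poset_alg_deg (m : nat) : set poset_alg :=
  [set poset_proj p | p in homogeneous m].

Definition poset_d : poset_alg := \sum_(x : nonbot) gen x.

Lemma gen_gen0 x y : val y \notin S_ (val x) 1 -> gen x * gen y = 0.
Proof.
move=> xy; rewrite -quotient_mapM -(raddf0 (quotient_map _)).
apply/quotient_mapP; rewrite subr0; apply/asboolP/in_ideal_gen.
by left; exists x, y.
Qed.

Lemma poset_alg_deg_submod m : submod_closed (mem (poset_alg_deg m)).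
Proof.
split=> [|c u v].
  by rewrite inE; exists 0; [|exact: raddf0] => w; rewrite mcoeff0 eqxx.
rewrite !inE => -[p hp <-] [q hq <-]; exists (c *: p + q); last exact: linearP.
move=> w; rewrite mcoeffD mcoeffZ => cpq; apply/eqP; apply: contraNT cpq => wm.
have -> : mcoeff w p = 0 by apply/eqP; apply: contraNT wm => /hp ->.
have -> : mcoeff w q = 0 by apply/eqP; apply: contraNT wm => /hq ->.
by rewrite mulr0 addr0.
Qed.

Lemma gen_deg x m u : poset_alg_deg m u -> poset_alg_deg m.+1 (gen x * u).
Proof.
move=> [p hp <-]; exists (X x * p); last by rewrite /poset_proj quotient_mapM.
move=> w; apply: contraNeq => wm; apply/eqP.
rewrite (mcoeffMlw _ (finmap.fsubset_refl _) (finmap.fsubset_refl _)).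
rewrite big_seq big1// => u'; rewrite -mcoeff_neq0 mcoeffU => ux.
rewrite big_seq big1// => v; rewrite -mcoeff_neq0 => /hp vm.
have [uvw|] := eqVneq (monalg.mul u' v) w; last by rewrite mulr0n.
case/eqP: wm; rewrite -uvw fdegM vm.
move: ux; have [<- _|_] := eqVneq (fmu x) u'; first by rewrite fdegU.
by rewrite mulr0n eqxx.
Qed.

(* This is R_Gamma(n, k); its elements have algebra degree n - k + 1. *)
Definition internal_mod n k : {pred poset_alg} := fun u =>
  `[< if (k <= n)%N then
        exists2 a : nonbot -> poset_alg,
          forall y, poset_alg_deg (n - k) (a y)
        & u = \sum_(y | rk (val y) == n.+1) gen y * a y
      else u = 0 >].

Lemma internal_mod_submod n k : submod_closed (internal_mod n k).
Proof.
rewrite /internal_mod; split=> [|c u v]; rewrite !unfold_in.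
- apply/asboolP; case: ifP => // _; exists (fun=> 0).
    have [+ _] := poset_alg_deg_submod (n - k).
    by rewrite inE.
  by rewrite big1// => y _; rewrite mulr0.
- case: ifP => _; last first.
    by move=> /asboolP-> /asboolP->; apply/asboolP; rewrite scaler0 addr0.
  move=> /asboolP[a ha ->] /asboolP[b hb ->]; apply/asboolP.
  exists (fun y => c *: a y + b y).
    move=> y; have [_ /(_ c (a y) (b y))] := poset_alg_deg_submod (n - k).
    by rewrite !inE; apply.
  rewrite scaler_sumr -big_split; apply: eq_bigr => y _ /=.
  by rewrite mulrDr scalerAr.
Qed.

HB.instance Definition _ n k := GRing.isSubmodClosed.Build F poset_alg
  (internal_mod n k) (internal_mod_submod n k).

Lemma d_internal_mod n k u :
  u \in internal_mod n k -> poset_d * u \in internal_mod n.+1 k.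
Proof.
rewrite !unfold_in => /asboolP hu; apply/asboolP.
case: ifP hu => [kn [a ha uE]|_ ->]; last first.
  rewrite mulr0; case: ifP => // _; exists (fun=> 0).
    have [+ _] := poset_alg_deg_submod (n.+1 - k); by rewrite inE.
  by rewrite big1// => y _; rewrite mulr0.
rewrite (leqW kn); exists (fun=> u).
  move=> _; rewrite subSn// uE.
  have [+ add] := poset_alg_deg_submod (n - k).+1; rewrite inE => deg0.
  apply: big_ind => // [v w dv dw|y _]; last exact: gen_deg.
  by move: (add 1 v w); rewrite scale1r !inE; apply.
rewrite mulr_suml [RHS]big_mkcond; apply: eq_bigr => x _.
case: ifPn => // xn; rewrite uE mulr_sumr; apply: big1 => y yn.
rewrite mulrA gen_gen0 ?mul0r// inE negb_and; apply/orP; right.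
by rewrite (eqP yn) addn1 eq_sym.
Qed.

Definition internal_d_fun n k (u : subspace_of (internal_mod n k)) :
    subspace_of (internal_mod n.+1 k) :=
  Subspace (d_internal_mod (valP u)).

Lemma internal_d_linear n k : linear (@internal_d_fun n k).
Proof.
have dE w : val (@internal_d_fun n k w) = poset_d * val w by [].
by move=> c u v; apply/val_inj; rewrite linearP !dE linearP mulrDr scalerAr.
Qed.

HB.instance Definition _ n k :=
  GRing.isLinear.Build F _ _ *:%R (@internal_d_fun n k) (@internal_d_linear n k).

Definition internal_cohomology n k : lmodType F :=
  @cohomology F (fun n => subspace_of (internal_mod n k))
    (fun n => @internal_d_fun n k) n.

End PosetAlgebra.

Section Koszul.
(* A connected graded algebra A = F + A_1 + A_2 + ..., where AG m is A_m. *)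
Variables (F : fieldType) (A : algType F) (AG : nat -> set A).

Record is_graded (M : lmodType A) (MG : nat -> set M) : Prop := {
  graded0 : forall m, MG m 0;
  gradedB : forall m x y, MG m x -> MG m y -> MG m (x - y);
  gradedZ : forall k m a x, AG k a -> MG m x -> MG (k + m)%N (a *: x);
  graded_sum : forall x, exists N (c : nat -> M),
    (forall m, MG m (c m)) /\ x = \sum_(m < N) c m;
  graded_direct : forall N (c : nat -> M), (forall m, MG m (c m)) ->
    \sum_(m < N) c m = 0 -> forall m, (m < N)%N -> c m = 0 }.

Definition projective (P : lmodType A) : Prop :=
  forall (M N : lmodType A) (g : {linear M -> N}) (f : {linear P -> N}),
    (forall y, exists x, g x = y) ->
    exists h : {linear P -> M}, forall x, g (h x) = f x.

(* Homogeneous A-linear maps of degree -j from M to the trivial module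
   F = A / (A_1 + A_2 + ...); F itself is concentrated in degree 0. *)
Record trivial_hom (M : lmodType A) (MG : nat -> set M) (j : nat)
    (f : M -> F) : Prop := {
  trivial_homB : forall x y, f (x - y) = f x - f y;
  trivial_homZ : forall (c : F) x, f (c%:A *: x) = c * f x;
  trivial_hom_aug : forall m a x, AG m.+1 a -> f (a *: x) = 0;
  trivial_hom_deg : forall m x, MG m x -> m != j -> f x = 0 }.

Record graded_projective_resolution := {
  res : nat -> lmodType A;
  resG : forall i, nat -> set (res i);
  res_d : forall i, {linear res i.+1 -> res i};
  res_aug : res 0 -> F;
  res_graded : forall i, is_graded (@resG i);
  res_projective : forall i, projective (res i);
  res_d_deg : forall i m x, @resG i.+1 m x -> @resG i m (res_d i x);
  res_aug_hom : trivial_hom (@resG 0) 0 res_aug;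
  res_aug_surj : forall c, exists x, res_aug x = c;
  res_exact0 : forall x, res_aug x = 0 <-> exists y, res_d 0 y = x;
  res_exact : forall i x, res_d i x = 0 <-> exists y, res_d i.+1 y = x }.

Arguments res_d : clear implicits.
Arguments res_aug : clear implicits.

Section Yoneda.
Variable P : graded_projective_resolution.
Local Notation P_ := (res P).
Local Notation PG i := (@resG P i).

(* Ext^{i,j}(F,F) is ext_cocycle i j modulo ext_coboundary i j. *)
Definition ext_cocycle i j (f : P_ i -> F) : Prop :=
  trivial_hom (PG i) j f /\ forall y, f (res_d P i y) = 0.

Definition ext_coboundary i j : (P_ i -> F) -> Prop :=
  match i with
  | 0 => fun f => forall x, f x = 0
  | i'.+1 => fun f => exists2 g : P_ i' -> F,
      trivial_hom (PG i') j g & forall x, f x = g (res_d P i' x)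
  end.

(* h represents the Yoneda product g.f: f is lifted to a chain map
   phi : P_{. + i} -> P_. of internal degree -j, then composed with g. *)
Definition yoneda_product i j k (f : P_ i -> F) (g : P_ k -> F)
    (h : P_ (k + i)%N -> F) : Prop :=
  exists phi : forall m, {linear P_ (m + i)%N -> P_ m},
    [/\ forall m n x, PG (m + i)%N n x ->
          if (j <= n)%N then PG m (n - j)%N (phi m x) else phi m x = 0,
        forall x, res_aug P (phi 0%N x) = f x,
        forall m x, res_d P m (phi m.+1 x) = phi m (res_d P (m + i)%N x)
      & forall x, h x = g (phi k x)].

(* Cocycles whose classes lie in the F-subalgebra of Ext generated by
   Ext^{1,1}. *)
Inductive ext11_generated : forall i, nat -> (P_ i -> F) -> Prop :=
| ext11_one : @ext11_generated 0 0 (res_aug P)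
| ext11_gen f of @ext_cocycle 1 1 f : @ext11_generated 1 1 f
| ext11_coboundary i j f of @ext_coboundary i j f : @ext11_generated i j f
| ext11_lin i j (c : F) f g of
    @ext11_generated i j f & @ext11_generated i j g :
    @ext11_generated i j (fun x => c * f x + g x)
| ext11_mul i j k l f g h of
    @ext11_generated i j f & @ext11_generated k l g
    & @yoneda_product i j k f g h :
    @ext11_generated (k + i)%N (l + j)%N h.

End Yoneda.

(* Ext does not depend on the resolution, up to isomorphism of algebras, so
   quantifying over all resolutions amounts to choosing one; nonnegatively
   graded resolutions exist (e.g. the bar resolution). *)
Definition koszul : Prop :=
  forall (P : graded_projective_resolution) i j (f : res P i -> F),
    ext_cocycle j f -> ext11_generated j f.

End Koszul.

Section Realization.
Variables (R : realType).

(* Geometric realization of the finite simplicial complex with set of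
   simplices K: barycentric coordinates, with the topology induced by R^V. *)
Definition realization (V : finType) (K : {set {set V}}) : set {ptws V -> R} :=
  [set w | [/\ forall v, 0 <= w v, \sum_v w v = 1
             & [set v | w v != 0]%SET \in K]].

Definition std_simplex n := realization [set: {set 'I_n.+1}]%SET.

Arguments std_simplex : clear implicits.

(* The affine map of realizations induced by a map of vertices. *)
Definition push (V W : finType) (f : V -> W) (w : {ptws V -> R}) :
    {ptws W -> R} :=
  fun u => \sum_(v | f v == u) w v.

Lemma ptws_continuous (X : topologicalType) (W : Type)
    (g : X -> {ptws W -> R}) :
  (forall u, continuous (fun x => g x u)) -> continuous g.
Proof.
move=> cg w; apply/cvg_sup => u.
apply: (@continuous_comp_initial _ X R (fun f : {ptws W -> R} => f u) g _ w).
exact: cg.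
Qed.

Lemma push_continuous V W f : continuous (@push V W f).
Proof.
apply: ptws_continuous => u w.
apply: (@cvg_big R V +%R 0 _ _ _ (nbhs w)
  (index_enum V) (fun v (w' : {ptws V -> R}) => w' v)) => [|v _].
  exact: add_continuous.
exact: (@proj_continuous V (fun=> R) v).
Qed.

Lemma push_std n m (f : 'I_n.+1 -> 'I_m.+1) (w : {ptws 'I_n.+1 -> R}) :
  std_simplex n w -> std_simplex m (push f w).
Proof.
move=> [w0 w1 _]; split=> [u||]; last by rewrite inE.
  by apply: sumr_ge0 => v _; exact: w0.
by rewrite -w1 [RHS](partition_big f predT).
Qed.

Definition face n (i : 'I_n.+2) (w : std_simplex n) : std_simplex n.+1 :=
  SigSub (mem_set (push_std (lift i) (set_valP w))).

Lemma face_continuous n i : continuous (@face n i).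
Proof.
apply: continuous_comp_initial => w.
apply: (@continuous_comp _ _ _ (set_val : std_simplex n -> _) (push (lift i))).
  exact: initial_continuous.
exact: push_continuous.
Qed.

HB.instance Definition _ n i :=
  isContinuous.Build _ _ (@face n i) (@face_continuous n i).

End Realization.

Arguments std_simplex : clear implicits.
Arguments face : clear implicits.

Section Singular.
Variables (R : realType) (F : fieldType) (X : topologicalType).

Definition singular_simplex n : Type := continuousType (std_simplex R n) X.

(* Hom(Z[singular_simplex n], F) *)
Definition singular_cochain n : lmodType F := singular_simplex n -> F^o.

Definition singular_d n (u : singular_cochain n) : singular_cochain n.+1 :=
  fun s => \sum_(i < n.+2) (-1) ^+ i * u (s \o face R n i : continuousType _ _).

Lemma singular_d_linear n : linear (@singular_d n).
Proof.
move=> c u v; apply/funext => s; rewrite /singular_d.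
rewrite !fctE scaler_sumr -big_split; apply: eq_bigr => i _ /=.
by rewrite mulrDr scalerAr.
Qed.

HB.instance Definition _ n :=
  GRing.isLinear.Build F _ _ *:%R (@singular_d n) (@singular_d_linear n).

Definition singular_cohomology n : lmodType F :=
  @cohomology F singular_cochain (fun n => @singular_d n) n.

End Singular.

Definition order_complex (d : Order.disp_t) (P : finPOrderType d)
    (B : {set P}) : {set {set P}} :=
  [set C : {set P} | [&& C != finset.set0, C \subset B & is_chain C]]%SET.

(* Main.v *)
(* Every v supported on the generators of S_x(k+1) and killed by the sum of the
   generators of S_x(k) is a right multiple of the sum of the generators of
   S_x(k+1): uniformity computes the annihilator in degree 1, and Koszulness,
   through the linear minimal resolution, says that it is generated there.

   Cochains on the tuples of pairwise comparable elements are mapped to R_Gamma by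
   sending f to the sum of r_(y_n) .. r_(y_1) f(y_n, .., y_1) over the y_i of rank
   i, which turns the coboundary into left multiplication by d_Gamma.  By
   induction on the rank of x, the exactness above shows that the tuples below x
   have reduced cohomology in the top degree only, and hence that this map is an
   isomorphism in cohomology.

   Finally, call a singular simplex of Y good when the carriers of its points are
   compatible with the heavy vertices of all its points, i.e. the vertices of large
   barycentric coordinate.  Iterated subdivision reduces singular cohomology to
   good simplices, and a straight-line homotopy carries a good simplex to the
   affine simplex on the heavy vertices of its vertices, that is, to a tuple. *)

Require Import Defs.
From HB Require Import structures.
From mathcomp Require Import all_boot all_order all_algebra.
From mathcomp Require Import all_classical all_reals.
From mathcomp Require Import topology normedtype.
From mathcomp Require sequences derive.
From mathcomp Require Import ring lra zify.
From mathcomp Require Import -(notations) monalg.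

Set Implicit Arguments.
Unset Strict Implicit.
Unset Printing Implicit Defensive.

Import Order.TTheory GRing.Theory Num.Theory.
Import numFieldNormedType.Exports.
Local Open Scope classical_set_scope.
Local Open Scope ring_scope.

(** * The algebra of a poset *)

(** That an annihilator is generated in degree 1 is too weak for an induction over the layers. The
    property carried along is that a right ideal M has a linear resolution: M tensored with the
    minimal resolution is exact off one strand. It passes from a A to the annihilator of a by
    dimension shifting along 0 -> ann(a) -> A -> a A -> 0, and from the annihilator of one layer sum
    to the next layer because the projection onto the summands r_y A is right linear on the
    augmentation ideal. The induction starts with r_x A, a direct summand of the augmentation ideal,
    and alternates between these two steps. On the topological side the choice of a heavy vertex is
    not continuous. What makes it usable is that a coordinate which is at least [1/#|Gam|] at one
    point stays positive nearby, so that on a small simplex every heavy vertex lies in the support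
    of every point. Heavy vertices come unordered and with repetitions, which is why cochains live
    on all tuples of comparable elements and not on increasing chains. *)

Section FreeLift.
Variables (F : fieldType) (T : choiceType) (B : nzRingType).
Variables (iota : {rmorphism F -> B}) (b : T -> B).
Definition word_prod (w : fmonom T) : B := \prod_(t <- (w : seq T)) b t.

Lemma word_prod_mmorphism : mmorphism word_prod.
Proof.
split=> [u v|]; first by rewrite /word_prod fmM big_cat.
by rewrite /word_prod fm1 big_nil.
Qed.

HB.instance Definition _ :=
  isMultiplicative.Build (fmonom T) B word_prod word_prod_mmorphism.

(** The rings mapped to below are polynomial and matrix rings over R_Gamma or F. The scalars of F
    reach them through a ring morphism, and its image must commute with everything for the
    evaluation of words to be multiplicative. *)
Definition central_scalars := forall c x, GRing.comm (iota c) x.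

Definition free_lift (_ : central_scalars) (p : free_alg F T) : B :=
  mmap iota word_prod p.

Variable iotaC : central_scalars.

Lemma free_lift_zmod : zmod_morphism (free_lift iotaC).
Proof. exact: mmap_is_additive. Qed.

HB.instance Definition _ :=
  GRing.isZmodMorphism.Build (free_alg F T) B (free_lift iotaC) free_lift_zmod.

Lemma free_lift_monoid : monoid_morphism (free_lift iotaC).
Proof.
have [? ?] := @commr_mmap_is_multiplicative _ _ _ iota word_prod
  (fun p u v => iotaC (mcoeff u p) (word_prod v)).
by split.
Qed.

HB.instance Definition _ :=
  GRing.isMonoidMorphism.Build (free_alg F T) B (free_lift iotaC) free_lift_monoid.

Lemma free_lift_letter t : free_lift iotaC (letter F t) = b t.
Proof.
rewrite /free_lift /letter mmapU (_ : _ 1 = 1); last exact: (rmorph1 iota).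
by rewrite mul1r /= /word_prod fmU big_seq1.
Qed.

Lemma free_liftZ c p : free_lift iotaC (c *: p) = iota c * free_lift iotaC p.
Proof. exact: mmapZ. Qed.

End FreeLift.

Lemma monomialE (F : fieldType) (T : choiceType) (w : fmonom T) (c : F) :
  mkmalgU w c = c *: mkmalgU w 1 :> malg (fmonom T) F.
Proof. by apply/malgP => v; rewrite mcoeffZ !mcoeffU mulr_natr. Qed.

Lemma monomial_cons (F : fieldType) (T : choiceType) (t : T) (w : seq T) :
  mkmalgU (FMonom (t :: w)) 1 = letter F t * mkmalgU (FMonom w) 1.
Proof.
rewrite /letter malgM_def fgmulUU mulr1; congr mkmalgU.
by apply/eqP; rewrite fmP fmM fmU.
Qed.

Lemma free_alg_ind (F : fieldType) (T : choiceType) (P : free_alg F T -> Prop) :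
  P 1 -> (forall t p, P p -> P (letter F t * p)) ->
  (forall c p q, P p -> P q -> P (c *: p + q)) -> P 0 -> forall p, P p.
Proof.
move=> P1 PX PL P0 p.
rewrite (monalgE p); apply: big_ind => // [u v Pu Pv|w _].
  by rewrite -[u]scale1r; apply: PL.
rewrite monomialE -[_ *: _]addr0.
apply: (PL (mcoeff w p) (mkmalgU w 1) 0) => //; case: w => w; elim: w => [|t w IHw].
  by rewrite -[FMonom _]fmoneE.
by rewrite monomial_cons; exact: PX.
Qed.

Section PosetSection.
Variables (F : fieldType) (d : Order.disp_t) (Gam : finBPOrderType d).

Definition poset_section (u : poset_alg F Gam) : free_alg F (nonbot Gam) :=
  quotient_lift u.

Lemma poset_sectionK : cancel poset_section (@poset_proj F d Gam).
Proof. exact: quotient_map_surj. Qed.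

Lemma poset_projP c (p q : free_alg F (nonbot Gam)) :
  poset_proj (c *: p + q) = c *: poset_proj p + poset_proj q.
Proof. exact: (@quotient_proj_linear F _ (ideal (@poset_relations F d Gam)) c p q). Qed.

Lemma poset_proj0 : poset_proj 0 = 0 :> poset_alg F Gam.
Proof. exact: (raddf0 (@quotient_proj F _ (ideal (@poset_relations F d Gam)))). Qed.

Lemma poset_proj1 : poset_proj 1 = 1 :> poset_alg F Gam.
Proof. by []. Qed.

Lemma poset_projM (p q : free_alg F (nonbot Gam)) :
  poset_proj (p * q) = poset_proj p * poset_proj q.
Proof. exact: quotient_mapM. Qed.

Lemma poset_proj_ideal (p q : free_alg F (nonbot Gam)) :
  poset_proj p = poset_proj q -> in_ideal (@poset_relations F d Gam) (p - q).
Proof. by move=> /(quotient_mapP (@poset_relations_proper F d Gam))/asboolP. Qed.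

End PosetSection.

Lemma gen_relS (F : fieldType) (d : Order.disp_t) (Gam : finBPOrderType d)
    (x : nonbot Gam) :
  gen F x * (\sum_(y | val y \in S_ (val x) 1) gen F y) = 0.
Proof.
rewrite -(raddf_sum (@poset_proj F d Gam)) -rmorphM -(raddf0 (@poset_proj F d Gam)).
apply/quotient_mapP; rewrite subr0; apply/asboolP/in_ideal_gen.
by right; exists x.
Qed.

(* Unification diverges when it unfolds the quotient. *)
Opaque poset_alg poset_proj poset_section.

Section PosetLift.
Variables (F : fieldType) (d : Order.disp_t) (Gam : finBPOrderType d).
Variables (B : nzRingType) (iota : {rmorphism F -> B}) (b : nonbot Gam -> B).

Definition satisfies_relations :=
  (forall x y : nonbot Gam, val y \notin S_ (val x) 1 -> b x * b y = 0) /\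
  (forall x : nonbot Gam, b x * (\sum_(y | val y \in S_ (val x) 1) b y) = 0).

Variables (iotaC : central_scalars iota) (b_rel : satisfies_relations).
Local Notation lift := (free_lift b iotaC).

Lemma free_lift_ideal p : in_ideal (@poset_relations F d Gam) p -> lift p = 0.
Proof.
elim=> {p} [p|||p q _|p q _].
- case=> [[x [y [xy ->]]]|[x ->]]; first by rewrite rmorphM /= !free_lift_letter (b_rel.1 _ _ xy).
  rewrite rmorphM /= free_lift_letter raddf_sum (eq_bigr b) ?(b_rel.2 x)// => y _.
  exact: free_lift_letter.
- exact: raddf0.
- by move=> p q _ p0 _ q0; rewrite raddfD /= p0 q0 addr0.
- by move=> q0; rewrite rmorphM /= q0 mulr0.
- by move=> p0; rewrite rmorphM /= p0 mul0r.
Qed.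

Definition poset_lift of satisfies_relations := locked (fun u : poset_alg F Gam => lift (poset_section u)).

Lemma poset_liftE p : poset_lift b_rel (poset_proj p) = lift p.
Proof.
rewrite /poset_lift -lock.
apply/eqP; rewrite -subr_eq0 -raddfB; apply/eqP/free_lift_ideal.
by apply: poset_proj_ideal; rewrite poset_sectionK.
Qed.

Lemma poset_lift_zmod : zmod_morphism (poset_lift b_rel).
Proof.
move=> u v; rewrite -[u]poset_sectionK; move: (poset_section u) => p; rewrite -[v]poset_sectionK; move: (poset_section v) => q.
by rewrite -raddfB !poset_liftE raddfB.
Qed.

HB.instance Definition _ :=
  GRing.isZmodMorphism.Build (poset_alg F Gam) B (poset_lift b_rel) poset_lift_zmod.

Lemma poset_lift_monoid : monoid_morphism (poset_lift b_rel).
Proof.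
split=> [|u v]; first by rewrite -[1](rmorph1 (@poset_proj F d Gam)) poset_liftE rmorph1.
rewrite -[u]poset_sectionK; move: (poset_section u) => p; rewrite -[v]poset_sectionK; move: (poset_section v) => q.
by rewrite -rmorphM !poset_liftE rmorphM.
Qed.

HB.instance Definition _ :=
  GRing.isMonoidMorphism.Build (poset_alg F Gam) B (poset_lift b_rel) poset_lift_monoid.

Lemma poset_lift_gen x : poset_lift b_rel (gen F x) = b x.
Proof. by rewrite /gen poset_liftE free_lift_letter. Qed.

Lemma poset_liftZ c u : poset_lift b_rel (c *: u) = iota c * poset_lift b_rel u.
Proof.
rewrite -[u]poset_sectionK; move: (poset_section u) => p.
by rewrite -linearZ !poset_liftE free_liftZ.
Qed.

End PosetLift.

(** * Computations in polynomial and matrix rings *)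

Lemma polyCX_mul (A : nzRingType) (a b : A) :
  (a%:P * 'X) * (b%:P * 'X) = (a * b)%:P * 'X^2.
Proof. by rewrite -mulrA (mulrA 'X) -commr_polyX -mulrA mulrA -polyCM. Qed.

Lemma polyCX_sum (A : nzRingType) (I : finType) (P : pred I) (a : I -> A) :
  \sum_(i | P i) (a i)%:P * 'X = (\sum_(i | P i) a i)%:P * 'X.
Proof. by rewrite -mulr_suml -raddf_sum. Qed.

Lemma bool_mulr (A : nzRingType) (b : bool) (a : A) : b%:R * a = if b then a else 0.
Proof. by case: b; rewrite ?mul1r ?mul0r. Qed.

Lemma scale_add_sum (F : fieldType) (V : lmodType F) (I : finType) (c : F)
    (a b : V) (f g : I -> V) :
  c *: a + b + \sum_i (c *: f i + g i) = c *: (a + \sum_i f i) + (b + \sum_i g i).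
Proof. by rewrite big_split /= -scaler_sumr addrACA -scalerDr. Qed.

Lemma sum_mul_delta (A : nzRingType) (I : finType) (c : I -> A) a :
  \sum_i c i * (i == a)%:R = c a.
Proof.
rewrite (bigD1 a)//= eqxx mulr1 big1 ?addr0// => i /negPf->.
by rewrite mulr0.
Qed.

Lemma horner1M (A : nzRingType) (p q : {poly A}) : (p * q).[1] = p.[1] * q.[1].
Proof. by rewrite hornerM_comm// /comm_poly mulr1 mul1r. Qed.

Lemma horner1E (A : nzRingType) (p : {poly A}) : p.[1] = \sum_(i < size p) p`_i.
Proof. by rewrite horner_coef; apply: eq_bigr => i _; rewrite expr1n mulr1. Qed.

Lemma mxM01 (A : nzRingType) (M N : 'M[A]_2) :
  (M * N) 0 1 = M 0 0 * N 0 1 + M 0 1 * N 1 1.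
Proof.
rewrite mxE big_ord_recl big_ord1; congr (_ * _ + M _ _ * N _ _); exact/val_inj.
Qed.

(** Of a product of such matrices, the two entries of the last column differ in the first letter
    only: a replaces c there. *)
Definition mx01 (A : nzRingType) (a c : A) : 'M[A]_2 :=
  \matrix_(i, j) if j == 0 then 0 else if i == 0 then a else c.

Lemma mx01_mul (A : nzRingType) (a c a' c' : A) :
  mx01 a c * mx01 a' c' = mx01 (a * c') (c * c').
Proof.
apply/matrixP => i j; rewrite !mxE !big_ord_recl big_ord0 !mxE /= mul0r add0r addr0.
by case: (j == 0); rewrite ?mulr0//; case: (i == 0).
Qed.

Lemma mx01_mulE (A : nzRingType) (a c : A) (M : 'M[A]_2) i j :
  (mx01 a c * M) i j = (if i == 0 then a else c) * M 1 j.
Proof.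
rewrite mxE big_ord_recl big_ord1 !mxE /= mul0r add0r; congr (_ * M _ j).
exact/val_inj.
Qed.

Lemma mx01_sum (A : nzRingType) (I : finType) (P : pred I) (a c : I -> A) :
  \sum_(i | P i) mx01 (a i) (c i) = mx01 (\sum_(i | P i) a i) (\sum_(i | P i) c i).
Proof.
apply/matrixP => i j; rewrite summxE !mxE; under eq_bigr do rewrite mxE.
by case: (j == 0); [rewrite big1|case: (i == 0)].
Qed.

Lemma mx01_0 (A : nzRingType) : mx01 0 0 = 0 :> 'M[A]_2.
Proof. by apply/matrixP => i j; rewrite !mxE; do 2?case: ifP. Qed.

(** Strictly upper triangular: a product of two such matrices has its only entry in the corner, and
    longer products vanish. *)
Definition mx012 (A : nzRingType) (a c : A) : 'M[A]_3 :=
  \matrix_(i, j) if (i == 0) && (j == 1) then a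
                 else if (i == 1) && (j == 2%:R) then c else 0.

Lemma mx012_mul (A : nzRingType) (a c a' c' : A) :
  mx012 a c * mx012 a' c' =
  \matrix_(i, j) if (i == 0) && (j == 2%:R) then a * c' else 0.
Proof.
apply/matrixP => i j; rewrite !mxE !big_ord_recl big_ord0 !mxE /=.
by case: i => [[|[|[|?]]] ?] //=; case: j => [[|[|[|?]]] ?] //=;
  rewrite ?(mulr0, mul0r, addr0, add0r).
Qed.

Lemma mx012_mulE (A : nzRingType) (a c : A) (N : 'M[A]_3) j :
  (mx012 a c * N) 0 j = a * N 1 j.
Proof.
rewrite mxE (bigD1 1)//= big1 => [|k k1]; rewrite !mxE /= ?addr0//.
by rewrite (negPf k1) mul0r.
Qed.

Lemma mx012_sum (A : nzRingType) (I : finType) (P : pred I) (a c : I -> A) :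
  \sum_(i | P i) mx012 (a i) (c i) = mx012 (\sum_(i | P i) a i) (\sum_(i | P i) c i).
Proof.
apply/matrixP => i j; rewrite summxE !mxE; under eq_bigr do rewrite mxE.
by do 2?case: ifP => // _; rewrite big1.
Qed.

Lemma scalar_comm (F : fieldType) (A : algType F) n :
  central_scalars (@scalar_mx A n.+1 \o in_alg A).
Proof.
move=> c M /=; apply/matrixP => i j.
rewrite -[_ * M]/(_ *m M) -[M * _]/(M *m _) -diag_const_mx mul_mx_diag mul_diag_mx.
by rewrite !mxE mulr_algl mulr_algr.
Qed.

(** * Augmentation, grading and decomposition by the first letter *)

Section PosetAlg.
Variables (F : fieldType) (d : Order.disp_t) (Gam : finBPOrderType d).
Local Notation R := (poset_alg F Gam).
Local Notation nb := (nonbot Gam).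
Implicit Types (x y z : nb) (u v : R).

Lemma poset_alg_ind (P : R -> Prop) :
  P 1 -> (forall x u, P u -> P (gen F x * u)) ->
  (forall c u v, P u -> P v -> P (c *: u + v)) -> P 0 -> forall u, P u.
Proof.
move=> P1 PX PL P0 u; rewrite -[u]poset_sectionK; move: (poset_section u) => p.
elim/(@free_alg_ind F nb): p => [|x p Pp|c p q Pp Pq|].
- by rewrite rmorph1.
- by rewrite rmorphM; apply: PX.
- by rewrite poset_projP; apply: PL.
- by rewrite poset_proj0.
Qed.

Lemma aug_iotaC : central_scalars (idfun : {rmorphism F -> F}).
Proof. by move=> c x; exact: mulrC. Qed.

Fact aug_rel : @satisfies_relations d Gam F (fun=> 0).
Proof. by split=> [x y _|x]; rewrite mul0r. Qed.

Definition aug : R -> F := poset_lift aug_iotaC aug_rel.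

HB.instance Definition _ := GRing.RMorphism.on aug.

Lemma aug_gen x : aug (gen F x) = 0.
Proof. exact: poset_lift_gen. Qed.

Lemma augZ c u : aug (c *: u) = c * aug u.
Proof. exact: poset_liftZ. Qed.

Lemma aug1 : aug 1 = 1.
Proof. exact: rmorph1. Qed.

Lemma augM u v : aug (u * v) = aug u * aug v.
Proof. exact: rmorphM. Qed.

Lemma augP c u v : aug (c *: u + v) = c * aug u + aug v.
Proof. by rewrite -augZ; exact: raddfD. Qed.

Lemma aug0 : aug 0 = 0.
Proof. exact: raddf0. Qed.

Lemma aug_genM x u : aug (gen F x * u) = 0.
Proof. by rewrite augM aug_gen mul0r. Qed.

(* The coaction of the grading: the coefficient of 'X^m is the homogeneous
   component of degree m. *)
Fact coaction_iotaC : central_scalars (polyC \o in_alg R).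
Proof.
by move=> c p; apply/polyP => i; rewrite /= coefCM coefMC mulr_algl mulr_algr.
Qed.

Fact coaction_rel : @satisfies_relations d Gam {poly R} (fun x => (gen F x)%:P * 'X).
Proof.
split=> [x y xy|x].
  by rewrite polyCX_mul gen_gen0// mul0r.
by rewrite polyCX_sum polyCX_mul gen_relS mul0r.
Qed.

Definition coaction : R -> {poly R} := poset_lift coaction_iotaC coaction_rel.

HB.instance Definition _ := GRing.RMorphism.on coaction.

Lemma coaction1 : coaction 1 = 1.
Proof. exact: rmorph1. Qed.

Lemma coaction0 : coaction 0 = 0.
Proof. exact: raddf0. Qed.

Lemma coactionM u v : coaction (u * v) = coaction u * coaction v.
Proof. exact: rmorphM. Qed.

Lemma coaction_gen x : coaction (gen F x) = (gen F x)%:P * 'X.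
Proof. exact: poset_lift_gen. Qed.

Lemma coactionP c u v : coaction (c *: u + v) = c%:A%:P * coaction u + coaction v.
Proof.
have -> : coaction (c *: u + v) = coaction (c *: u) + coaction v by exact: raddfD.
by rewrite {1}/coaction poset_liftZ.
Qed.

Definition hpart m u : R := (coaction u)`_m.

Lemma comp_linear m : linear (hpart m).
Proof.
by move=> c u v; rewrite /hpart coactionP coefD coefCM mulr_algl.
Qed.

HB.instance Definition _ m := GRing.isLinear.Build F R R *:%R (hpart m) (comp_linear m).

Lemma compP m c u v : hpart m (c *: u + v) = c *: hpart m u + hpart m v.
Proof. exact: comp_linear. Qed.

Lemma comp0r m : hpart m 0 = 0.
Proof. exact: (linear0 (hpart m)). Qed.

Lemma compM m u v : hpart m (u * v) = \sum_(i < m.+1) hpart i u * hpart (m - i) v.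
Proof. by rewrite /hpart coactionM coefM. Qed.

Lemma comp1 m : hpart m 1 = (m == 0)%:R.
Proof. by rewrite /hpart coaction1 coef1. Qed.

Lemma comp_gen m x : hpart m (gen F x) = (m == 1)%:R * gen F x.
Proof.
rewrite /hpart coaction_gen coefMX coefC.
by case: m => [|[|m]] /=; rewrite ?mul0r ?mul1r.
Qed.

Lemma comp_genM m x u :
  hpart m (gen F x * u) = if m is m'.+1 then gen F x * hpart m' u else 0.
Proof.
rewrite /hpart coactionM coaction_gen -mulrA -commr_polyX mulrA.
by rewrite coefMX; case: m => //= m; rewrite coefCM.
Qed.

Lemma comp0 u : hpart 0 u = (aug u)%:A.
Proof.
elim/poset_alg_ind: u => [|x u _|c u v IHu IHv|].
- by rewrite comp1 aug1 scale1r.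
- by rewrite comp_genM aug_genM scale0r.
- by rewrite compP IHu IHv augP scalerDl scalerA.
- by rewrite comp0r aug0 scale0r.
Qed.

Lemma comp_comp m k u : hpart m (hpart k u) = if m == k then hpart k u else 0.
Proof.
elim/poset_alg_ind: u m k => [|x u IHu|c u v IHu IHv|] m k.
- by case: k => [|k]; rewrite comp1 ?comp1 ?comp0r; case: eqP.
- case: k => [|k]; rewrite comp_genM; first by rewrite comp0r if_same.
  case: m => [|m]; rewrite comp_genM// IHu eqSS; case: ifP => //.
  by rewrite mulr0.
- rewrite !compP IHu IHv; case: (m == k); first by [].
  by rewrite scaler0 addr0.
- by rewrite !comp0r if_same.
Qed.

Lemma comp_deg m u : poset_alg_deg m (hpart m u).
Proof.
have [+ cl] := poset_alg_deg_submod F Gam m; rewrite inE => deg0.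
elim/poset_alg_ind: u m {cl deg0} => [|x u IHu|c u v IHu IHv|] m;
  have [+ cl] := poset_alg_deg_submod F Gam m; rewrite inE => deg0.
- rewrite comp1; case: eqP => [->|//]; exists 1; last by rewrite rmorph1.
  by move=> w; rewrite mcoeff1; have [-> _|_] := eqVneq w _; rewrite ?fdeg1 ?eqxx.
- by rewrite comp_genM; case: m {cl deg0} => [|m]; [have [+ _] := poset_alg_deg_submod F Gam 0; rewrite inE|exact: gen_deg].
- by rewrite compP; move: (cl c (hpart m u) (hpart m v)); rewrite !inE; apply.
- by rewrite comp0r.
Qed.

Lemma comp_monomial c w :
  hpart (fdeg w) (poset_proj (mkmalgU w c : free_alg F nb)) = poset_proj (mkmalgU w c).
Proof.
have -> : mkmalgU w c = c *: mkmalgU w 1 + 0 :> free_alg F nb.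
  by rewrite addr0; exact: monomialE.
rewrite poset_projP compP poset_proj0 comp0r.
suff -> : hpart (fdeg w) (poset_proj (mkmalgU w 1)) = poset_proj (mkmalgU w 1) by [].
case: w => w; rewrite fdegE /=; elim: w => [|x w IHw].
  by rewrite -[FMonom _]fmoneE poset_proj1 comp1.
by rewrite [size _]/= monomial_cons poset_projM comp_genM IHw.
Qed.

(** The degree m part, defined as an image of homogeneous polynomials, is handled from here on as
    the fixed vectors of a projection. *)
Lemma deg_comp m u : poset_alg_deg m u <-> hpart m u = u.
Proof.
split=> [[p hp <-]|<-]; last exact: comp_deg.
rewrite (monalgE p) (raddf_sum (@poset_proj F d Gam)) raddf_sum big_seq [RHS]big_seq.
apply: eq_bigr => w; rewrite -mcoeff_neq0 => /hp <-.
exact: comp_monomial.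
Qed.

(** Counit law of the coaction: setting the variable to 1 gives back u. *)
Lemma sum_hpart u : u = \sum_(m < size (coaction u)) hpart m u.
Proof.
transitivity (coaction u).[1]; last exact: horner1E.
elim/poset_alg_ind: u => [|x u IHu|c u v IHu IHv|].
- by rewrite coaction1 hornerC.
- by rewrite coactionM horner1M -IHu coaction_gen hornerMX hornerC mulr1.
- rewrite coactionP hornerD horner1M hornerC mulr_algl.
  by rewrite -IHu -IHv.
- by rewrite coaction0 horner0.
Qed.

Fact proj_rel z :
  @satisfies_relations d Gam 'M[R]_2 (fun x => mx01 ((x == z)%:R * gen F x) (gen F x)).
Proof.
split=> [x y xy|x]; first by rewrite mx01_mul -mulrA gen_gen0// mulr0 mx01_0.
by rewrite mx01_sum mx01_mul -mulrA gen_relS mulr0 mx01_0.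
Qed.

(** A triangular representation with diagonal ([aug u], u). Its corner, a twisted derivation, keeps
    the words that start with z, and so projects the augmentation ideal onto the right ideal r_z
    R. *)
Definition proj_mx z : R -> 'M[R]_2 := poset_lift (@scalar_comm F R 1) (proj_rel z).

HB.instance Definition _ z := GRing.RMorphism.on (proj_mx z).

Definition letter_part z u : R := proj_mx z u 0 1.

Lemma proj_mx1 z : proj_mx z 1 = 1.
Proof. exact: rmorph1. Qed.

Lemma proj_mx0 z : proj_mx z 0 = 0.
Proof. exact: raddf0. Qed.

Lemma proj_mxM z u v : proj_mx z (u * v) = proj_mx z u * proj_mx z v.
Proof. exact: rmorphM. Qed.

Lemma proj_mx_gen z x :
  proj_mx z (gen F x) = mx01 ((x == z)%:R * gen F x) (gen F x).
Proof. exact: poset_lift_gen. Qed.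

Lemma proj_mxP z c u v i j :
  proj_mx z (c *: u + v) i j = c *: proj_mx z u i j + proj_mx z v i j.
Proof.
have -> : proj_mx z (c *: u + v) = proj_mx z (c *: u) + proj_mx z v by exact: raddfD.
rewrite mxE {1}/proj_mx poset_liftZ /= -[_ * _]/(_ *m _) mul_scalar_mx mxE.
by rewrite mulr_algl.
Qed.

Lemma proj_linear z : linear (letter_part z).
Proof. by move=> c u v; exact: proj_mxP. Qed.

HB.instance Definition _ z := GRing.isLinear.Build F R R *:%R (letter_part z) (proj_linear z).

Lemma projP z c u v : letter_part z (c *: u + v) = c *: letter_part z u + letter_part z v.
Proof. exact: proj_linear. Qed.

Lemma proj0 z : letter_part z 0 = 0.
Proof. exact: (linear0 (letter_part z)). Qed.

Lemma proj_mxE z u :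
  [/\ proj_mx z u 0 0 = (aug u)%:A, proj_mx z u 1 0 = 0 & proj_mx z u 1 1 = u].
Proof.
have gM x v i j : proj_mx z (gen F x * v) i j =
    (if i == 0 then (x == z)%:R * gen F x else gen F x) * proj_mx z v 1 j.
  by rewrite proj_mxM proj_mx_gen mx01_mulE.
elim/poset_alg_ind: u => [|x u [h1 h2 h3]|c u v [h1 h2 h3] [k1 k2 k3]|].
- by rewrite proj_mx1 !mxE aug1 scale1r.
- by rewrite !gM h2 h3 !mulr0 aug_genM scale0r.
- rewrite !proj_mxP k1 k2 k3 h1 h2 h3 augP scaler0 addr0.
  by rewrite scalerDl scalerA.
- by rewrite proj_mx0 !mxE aug0 scale0r.
Qed.

Lemma projM z u v : letter_part z (u * v) = aug u *: letter_part z v + letter_part z u * v.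
Proof.
have [h1 _ _] := proj_mxE z u; have [_ _ h3] := proj_mxE z v.
by rewrite /letter_part proj_mxM mxM01 h1 h3 mulr_algl.
Qed.

Lemma proj_genM z x u : letter_part z (gen F x * u) = if x == z then gen F x * u else 0.
Proof.
rewrite projM aug_gen scale0r add0r /letter_part proj_mx_gen mxE [_ == 0]/= eqxx.
rewrite bool_mulr; case: (x == z); first by [].
by rewrite mul0r.
Qed.

Lemma proj1 z : letter_part z 1 = 0.
Proof. by rewrite /letter_part proj_mx1 mxE. Qed.

Lemma proj_sum u : u = (aug u)%:A + \sum_z letter_part z u.
Proof.
elim/poset_alg_ind: u => [|x u _|c u v IHu IHv|].
- by rewrite aug1 scale1r big1 ?addr0// => z _; exact: proj1.
- rewrite aug_genM scale0r add0r (bigD1 x)//= proj_genM eqxx.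
  by rewrite big1 ?addr0// => z; rewrite proj_genM eq_sym => /negPf->.
- rewrite augP scalerDl -scalerA.
  under eq_bigr do rewrite projP.
  rewrite scale_add_sum.
  exact: (f_equal2 (fun a b => c *: a + b) IHu IHv).
- by rewrite aug0 scale0r big1 ?addr0// => z _; rewrite proj0.
Qed.

Lemma proj_gen_ex z u : exists v, letter_part z u = gen F z * v.
Proof.
elim/poset_alg_ind: u => [|x u _|c u v [u' IHu] [v' IHv]|].
- by exists 0; rewrite proj1 mulr0.
- by rewrite proj_genM; case: eqP => [->|_]; [exists u|exists 0; rewrite mulr0].
- by exists (c *: u' + v'); rewrite projP IHu IHv mulrDr scalerAr.
- by exists 0; rewrite proj0 mulr0.
Qed.

(** A representation that detects c a - c b: r_x r_a and r_x r_b have opposite corners, hence the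
    sum relation of x is respected. *)
Fact pair_rel (x a b : nb) :
  val a \in S_ (val x) 1 -> val b \in S_ (val x) 1 ->
  @satisfies_relations d Gam 'M[F]_3
    (fun y : nb => mx012 (y == x)%:R ((y == a)%:R - (y == b)%:R)).
Proof.
have mx0 : \matrix_(i < 3, j < 3) (if (i == 0) && (j == 2%:R) then 0 else 0) = 0 :> 'M[F]_3.
  by apply/matrixP => i j; rewrite !mxE if_same.
move=> xa xb; split=> [y z yz|y]; rewrite ?mx012_sum mx012_mul -[RHS]mx0.
  apply/matrixP => i j; rewrite !mxE; case: ifP => // _.
  have [yx|] := eqVneq y x; rewrite ?mul0r// mul1r.
  have [za|_] := eqVneq z a; first by rewrite yx za xa in yz.
  have [zb|_] := eqVneq z b; first by rewrite yx zb xb in yz.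
  by rewrite subrr.
apply/matrixP => i j; rewrite !mxE; case: ifP => // _.
have [yx|] := eqVneq y x; rewrite ?mul0r// mul1r yx sumrB.
have one c : val c \in S_ (val x) 1 ->
    \sum_(z : nb | val z \in S_ (val x) 1) (z == c)%:R = 1 :> F.
  move=> xc; rewrite (bigD1 c)//= eqxx big1 ?addr0// => z /andP[_ /negPf->] //.
by rewrite !one// subrr.
Qed.

Lemma gen_span_const x (c : nb -> F) a b :
  val a \in S_ (val x) 1 -> val b \in S_ (val x) 1 ->
  gen F x * (\sum_z c z *: gen F z) = 0 -> c a = c b.
Proof.
move=> xa xb; have [<- //|ab] := eqVneq a b.
pose h : R -> 'M[F]_3 := poset_lift (@scalar_comm F F^o 2) (pair_rel xa xb).
have hM u v : h (u * v) = h u * h v by exact: rmorphM.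
have hg y : h (gen F y) = mx012 (y == x)%:R ((y == a)%:R - (y == b)%:R).
  exact: poset_lift_gen.
have hZ k u i j : h (k *: u) i j = k * h u i j.
  rewrite /h poset_liftZ /= -[_ * _]/(_ *m _) mul_scalar_mx mxE.
  by rewrite -[_%:A]/(k * 1) mulr1.
have h0 : h 0 = 0 by exact: raddf0.
have hS i j : h (\sum_z c z *: gen F z) i j = \sum_z c z * h (gen F z) i j.
  have -> : h (\sum_z c z *: gen F z) = \sum_z h (c z *: gen F z) by exact: raddf_sum.
  by rewrite summxE; apply: eq_bigr => z _; exact: hZ.
move=> /(congr1 (fun u => h u 0 2%:R)); rewrite hM hg h0 mx012_mulE hS eqxx mul1r mxE.
under eq_bigr do rewrite hg mxE /= mulrBr.
rewrite sumrB (sum_mul_delta c a) (sum_mul_delta c b).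
by move=> /eqP; rewrite subr_eq0 => /eqP.
Qed.

Fact single_rel (x : nb) :
  @satisfies_relations d Gam 'M[F]_2 (fun y : nb => mx01 (y == x)%:R 0).
Proof.
split=> [y z yz|y]; rewrite ?mx01_sum mx01_mul ?mulr0 ?mx01_0//.
by rewrite big1 ?mulr0 ?mx01_0.
Qed.

(** The generators are nonzero: r_x can act by a nonzero matrix of square zero, and all other
    generators by 0. *)
Lemma gen_scaler_eq0 x (c : F) : c *: gen F x = 0 -> c = 0.
Proof.
pose h : R -> 'M[F]_2 := poset_lift (@scalar_comm F F^o 1) (single_rel x).
have hg y : h (gen F y) = mx01 (y == x)%:R 0 by exact: poset_lift_gen.
have h0 : h 0 = 0 by exact: raddf0.
move=> /(congr1 h); rewrite {1}/h poset_liftZ -/h hg h0.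
move=> /matrixP /(_ 0 1); rewrite /= -[_ * _]/(_ *m _) mul_scalar_mx !mxE /=.
by rewrite eqxx mulr1 -[_%:A]/(c * 1) mulr1.
Qed.

End PosetAlg.

(** * Annihilators in Koszul algebras *)

(** Take a matrix of largest rank with rows in S: a vector of S outside its row space would raise
    the rank. *)
Lemma subspace_row_basis (F : fieldType) (n : nat) (S : 'rV[F]_n -> Prop) :
  exists r (B : 'M[F]_(r, n)),
    (forall i, S (row i B)) /\ forall v, S v -> exists w, v = w *m B.
Proof.
pose P r := `[< exists m (B : 'M[F]_(m, n)), (forall i, S (row i B)) /\ \rank B = r >].
have exP : exists r, P r.
  by exists 0; apply/asboolP; exists 0, 0; split=> [[]|]; rewrite ?mxrank0.
have ubP r : P r -> (r <= n)%N by move=> /asboolP[m [B [_ <-]]]; exact: rank_leq_col.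
case: (ex_maxnP exP ubP) => r /asboolP[m [B [BS Br]]] maxr.
exists m, B; split=> // v Sv.
suff /submxP[w ->] : (v <= B)%MS by exists w.
have BB : (B <= col_mx B v)%MS by rewrite -addsmxE addsmxSl.
have /maxr : P (\rank (col_mx B v)).
  apply/asboolP; exists (m + 1)%N, (col_mx B v); split=> // i.
  case: (split_ordP i) => j ->; first by rewrite rowKu.
  by rewrite rowKd row_id; congr (S _): Sv.
rewrite -Br => le; have [le' eq] := mxrank_leqif_sup BB.
have: (col_mx B v <= B)%MS by rewrite -eq eqn_leq le' le.
by rewrite col_mx_sub => /andP[].
Qed.

Section ConnectedGraded.
Variables (F : fieldType) (A : algType F) (AG : nat -> set A).
Variables (aug : A -> F) (comp : nat -> A -> A).

Record connected_graded : Prop := {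
  cg_augP : forall c u v, aug (c *: u + v) = c * aug u + aug v;
  cg_augM : forall u v, aug (u * v) = aug u * aug v;
  cg_aug1 : aug 1 = 1;
  cg_compP : forall m c u v, comp m (c *: u + v) = c *: comp m u + comp m v;
  cg_comp_comp : forall m k u, comp m (comp k u) = if m == k then comp k u else 0;
  cg_compM : forall m u v,
    comp m (u * v) = \sum_(i < m.+1) comp i u * comp (m - i) v;
  cg_comp0 : forall u, comp 0 u = (aug u)%:A;
  cg_deg : forall m u, AG m u <-> comp m u = u }.

Hypothesis cg : connected_graded.

Lemma aug_zmod : zmod_morphism aug.
Proof.
move=> u v; rewrite -[u - v]addrC -scaleN1r cg_augP//.
by rewrite mulN1r addrC.
Qed.

HB.instance Definition _ := GRing.isZmodMorphism.Build A F aug aug_zmod.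

Lemma comp_lin m : linear (comp m).
Proof. by move=> c u v; rewrite cg_compP. Qed.

HB.instance Definition _ m := GRing.isLinear.Build F A A *:%R (comp m) (comp_lin m).

Variables (D : nat) (comp_sum : forall u, u = \sum_(m < D) comp m u).
Variables (N : nat) (b : 'I_N -> A).
Hypothesis b_span : forall u, exists c : 'I_N -> F, u = \sum_i c i *: b i.

Lemma comp_ge m u : (D <= m)%N -> comp m u = 0.
Proof.
move=> Dm; rewrite [u]comp_sum raddf_sum big1// => i _ /=.
by rewrite (cg_comp_comp cg) gtn_eqF// (leq_trans _ Dm).
Qed.

Lemma compM_hom k e u v : comp e v = v ->
  comp k (u * v) = if (e <= k)%N then comp (k - e) u * v else 0.
Proof.
move=> hv; rewrite (cg_compM cg).
have cv i : comp i v = if i == e then v else 0.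
  by rewrite -hv (cg_comp_comp cg) hv.
case: leqP => [ek|ke].
  have ki : (k - e < k.+1)%N by rewrite ltnS leq_subr.
  rewrite (bigD1 (Ordinal ki))//= subKn// cv eqxx big1 ?addr0// => i.
  rewrite -val_eqE /= cv => ni; case: eqP => [ie|]; last by rewrite mulr0.
  by case/eqP: ni; rewrite -ie subKn// -ltnS.
rewrite big1// => i _; rewrite cv ltn_eqF ?mulr0//.
by rewrite (leq_ltn_trans _ ke)// leq_subr.
Qed.

(** Rows are vectors of the graded free module with generators in degrees [a j]: coordinate j of a
    vector of degree m has degree [m - a j], and is zero if that is negative. *)
Definition hcomp n (a : 'I_n -> nat) m (p : 'rV[A]_n) : 'rV[A]_n :=
  \row_j (if (a j <= m)%N then comp (m - a j) (p 0 j) else 0).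

Definition hom_mx m n (e : 'I_m -> nat) (a : 'I_n -> nat) (E : 'M[A]_(m, n)) :=
  forall i j, (if (a j <= e i)%N then comp (e i - a j) (E i j) else 0) = E i j.

Lemma hcompM m n (e : 'I_m -> nat) (a : 'I_n -> nat) (E : 'M[A]_(m, n)) k p :
  hom_mx e a E -> hcomp a k (p *m E) = hcomp e k p *m E.
Proof.
move=> hE; apply/rowP => j; rewrite !mxE.
transitivity (\sum_i if (a j <= k)%N then comp (k - a j) (p 0 i * E i j) else 0).
  by case: ifP => // _; [rewrite raddf_sum|rewrite big1].
apply: eq_bigr => i _; rewrite mxE; have := hE i j.
case: leqP => [ae|ea]; last by move=> <-; rewrite !mulr0 raddf0 if_same.
move=> /compM_hom ->.
case: (leqP (a j) k) => ak; case: (leqP (e i) k) => ek.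
- rewrite leq_sub2rE// ek; congr (comp _ _ * _).
  by rewrite subnBA// subnK.
- by rewrite leq_sub2rE// leqNgt ek mul0r.
- by move: ak; rewrite ltnNge (leq_trans ae).
- by rewrite mul0r.
Qed.

Lemma hcomp_zmod n (a : 'I_n -> nat) m : zmod_morphism (hcomp a m).
Proof.
move=> p q; apply/rowP => j; rewrite !mxE.
by case: ifP => _; rewrite ?subr0// raddfB.
Qed.

HB.instance Definition _ n a m :=
  GRing.isZmodMorphism.Build 'rV[A]_n 'rV[A]_n (hcomp a m) (@hcomp_zmod n a m).

Lemma hcomp_hcomp n (a : 'I_n -> nat) m k p :
  hcomp a m (hcomp a k p) = if m == k then hcomp a k p else 0.
Proof.
apply/rowP => j; rewrite !mxE; case: (leqP (a j) k) => ak; last first.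
  by rewrite raddf0 if_same; case: eqP => _; rewrite mxE// leqNgt ak.
rewrite (cg_comp_comp cg); case: leqP => am.
  rewrite eqn_sub2rE//; case: eqP => [_|]; rewrite mxE//.
  by rewrite ak.
by rewrite ltn_eqF ?mxE// (leq_trans am).
Qed.

Lemma hcomp_sum n (a : 'I_n -> nat) (L : nat) p : (forall j, a j <= L)%N ->
  p = \sum_(m < D + L) hcomp a m p.
Proof.
move=> aL; apply/rowP => j; rewrite summxE; under eq_bigr do rewrite mxE.
rewrite -(big_mkord xpredT
  (fun m => if (a j <= m)%N then comp (m - a j) (p 0 j) else 0)).
rewrite (@big_cat_nat _ _ _ (a j))//= ?(leq_trans (aL j)) ?leq_addl//.
rewrite big_nat big1 ?add0r => [|m /andP[_ ma]]; last by rewrite leqNgt ma.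
rewrite -[X in index_iota X _]add0n big_addn (@big_cat_nat _ _ _ D)//=; last first.
  by rewrite leq_subRL ?(leq_trans (aL j)) ?leq_addl// addnC leq_add2l.
rewrite [X in _ + X]big_nat [X in _ + X]big1 ?addr0 => [|m /andP[Dm _]]; last first.
  by rewrite leq_addl addnK comp_ge.
rewrite [LHS]comp_sum big_mkord; apply: eq_bigr => m _.
by rewrite leq_addl addnK.
Qed.

(** * Minimal generators of graded submodules of free modules *)

Section MinimalGenerators.
Variables (n : nat) (a : 'I_n -> nat) (K : 'rV[A]_n -> Prop).

Record graded_submodule : Prop := {
  gs0 : K 0;
  gsD : forall p q, K p -> K q -> K (p + q);
  gsZ : forall u p, K p -> K (u *: p);
  gs_hcomp : forall m p, K p -> K (hcomp a m p) }.

Definition generators m (e : 'I_m -> nat) (E : 'M[A]_(m, n)) :=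
  [/\ hom_mx e a E, forall i, K (row i E)
    & forall p, K p -> exists u : 'rV[A]_m, p = u *m E].

Hypothesis gK : graded_submodule.

Lemma gs_sum (I : Type) (s : seq I) (P : pred I) (f : I -> 'rV[A]_n) :
  (forall i, P i -> K (f i)) -> K (\sum_(i <- s | P i) f i).
Proof. move=> Kf; apply: big_ind => //; [exact: gs0|exact: gsD]. Qed.

(** A is finite dimensional, so K is spanned over F by finitely many vectors; their homogeneous
    components remain in K and are homogeneous generators. *)
Lemma generators_ex : exists m e E, @generators m e E.
Proof.
pose phi (v : 'rV[F]_(n * N)) : 'rV[A]_n := \row_j \sum_k vec_mx v j k *: b k.
have phiD (I : finType) (c : I -> F) v :
    phi (\sum_i c i *: v i) = \sum_i (c i)%:A *: phi (v i).
  apply/rowP => j; rewrite mxE summxE.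
  under [RHS]eq_bigr do rewrite !mxE mulr_algl scaler_sumr.
  rewrite exchange_big /=; apply: eq_bigr => k _.
  rewrite linear_sum /= summxE scaler_suml; apply: eq_bigr => i _.
  by rewrite linearZ /= mxE scalerA.
have phi_surj p : exists v, p = phi v.
  have [c hc] := choice (fun j => b_span (p 0 j)).
  exists (mxvec (\matrix_(j, k) c j k)); apply/rowP => j.
  by rewrite mxE mxvecK hc; apply: eq_bigr => k _; rewrite mxE.
have [r [B [KB Bspan]]] := subspace_row_basis (fun v => K (phi v)).
pose L := \max_j a j; have aL j : (a j <= L)%N by exact: leq_bigmax.
pose T : finType := ('I_r * 'I_(D + L))%type.
pose tv (t : 'I_#|T|) : 'I_r * 'I_(D + L) := enum_val t.
pose E : 'M[A]_(#|T|, n) :=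
  \matrix_(t < #|T|) hcomp a (nat_of_ord (tv t).2) (phi (row (tv t).1 B)).
exists #|T|, (fun t => nat_of_ord (tv t).2), E; split=> [t j|t|p Kp].
- rewrite /E !mxE; case: ifP => // ->.
  by rewrite (cg_comp_comp cg) eqxx.
- by rewrite rowK; apply: gs_hcomp => //; exact: KB.
have [v pv] := phi_surj p; have Sv : K (phi v) by rewrite -pv.
have [w vw] := Bspan v Sv.
exists (\row_t (w 0 (tv t).1)%:A).
rewrite mulmx_sum_row.
under eq_bigr do rewrite mxE rowK.
rewrite -(big_enum_val (fun t : T =>
  (w 0 t.1)%:A *: hcomp a (nat_of_ord t.2) (phi (row t.1 B)))) /=.
rewrite -(pair_big xpredT xpredT (fun i k =>
  (w 0 i)%:A *: hcomp a (nat_of_ord k) (phi (row i B)))) /=.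
rewrite pv vw mulmx_sum_row phiD; apply: eq_bigr => i _.
by rewrite -scaler_sumr -hcomp_sum.
Qed.

(** Graded Nakayama lemma: take as few generators as possible. A relation with a coefficient outside
    the augmentation ideal would express one generator through the others. *)
Lemma minimal_generators : exists m e E, @generators m e E /\
  forall u : 'rV[A]_m, u *m E = 0 -> forall i, aug (u 0 i) = 0.
Proof.
pose P m := `[< exists e E, @generators m e E >].
have exP : exists m, P m.
  by have [m [e [E gE]]] := generators_ex; exists m; apply/asboolP; exists e, E.
case: (ex_minnP exP) => m /asboolP[e [E gE]] minm.
exists m, e, E; split=> // u uE i; apply/eqP; apply: contraT => c0.
have [hE KE genE] := gE.
case: m e E gE minm u uE i c0 hE KE genE => [|m] e E gE minm u uE i c0 hE KE genE.
  by case: i {c0}.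
suff /minm : P m by rewrite ltnn.
(* In the degree of generator i, the coefficient of this generator is a nonzero scalar, hence
   invertible. *)
pose u' := hcomp e (e i) u.
have u'E : u' *m E = 0 by rewrite -(hcompM _ _ hE) uE raddf0.
have u'i : u' 0 i = (aug (u 0 i))%:A by rewrite mxE leqnn subnn (cg_comp0 cg).
pose w := - ((aug (u 0 i))^-1%:A *: col' i u').
have mulE (v : 'rV[A]_m.+1) : v *m E = v 0 i *: row i E + col' i v *m row' i E.
  rewrite !mulmx_sum_row (bigD1_ord i)//=; congr (_ + _).
  by apply: eq_bigr => k _; rewrite mxE; congr (_ *: _); apply/rowP => j; rewrite !mxE.
have rE : row i E = w *m row' i E.
  move: u'E; rewrite mulE u'i => /eqP; rewrite addr_eq0 => /eqP h.
  rewrite mulNmx -scalemxAl -scalerN -h scalerA.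
  by rewrite mulr_algl scalerA mulVf// !scale1r.
apply/asboolP; exists (fun k => e (lift i k)), (row' i E); split.
- by move=> k j; rewrite mxE; exact: hE.
- move=> k; suff -> : row k (row' i E) = row (lift i k) E by exact: KE.
  by apply/rowP => j; rewrite !mxE.
- move=> p /genE[v ->]; exists (v 0 i *: w + col' i v).
  by rewrite mulE mulmxDl -scalemxAl -rE.
Qed.

End MinimalGenerators.

(** * The minimal free resolution of the trivial module *)

Lemma aug_deg m u : m != 0%N -> comp m u = u -> aug u = 0.
Proof.
move=> m0 hu; have := cg_comp0 cg u; rewrite -[in LHS]hu (cg_comp_comp cg).
rewrite eq_sym (negPf m0) => /esym /eqP; rewrite -[_%:A]/(in_alg A _) fmorph_eq0.
by move=> /eqP.
Qed.

Lemma aug_scale c u : aug (c%:A * u) = c * aug u.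
Proof. by rewrite mulr_algl -[c *: u]addr0 (cg_augP cg) raddf0 addr0. Qed.

Lemma aug_mulmx m n (p : 'rV[A]_m) (H : 'M[A]_(m, n)) j :
  (forall k, aug (p 0 k) = 0) -> aug ((p *m H) 0 j) = 0.
Proof.
move=> p0; rewrite mxE raddf_sum big1// => k _ /=.
by rewrite (cg_augM cg) p0 mul0r.
Qed.

(** One differential of the resolution with the degrees of the generators on both sides. Its source
    is by conversion the target of the next stage, so the recursion needs no casts. *)
Record stage := Stage {
  dim0 : nat; deg0 : 'I_dim0 -> nat;
  dim1 : nat; deg1 : 'I_dim1 -> nat;
  mat : 'M[A]_(dim1, dim0);
  stage_hom : hom_mx deg1 deg0 mat }.

Definition minimal_mx m n (E : 'M[A]_(m, n)) :=
  forall u : 'rV[A]_m, u *m E = 0 -> forall i, aug (u 0 i) = 0.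

Lemma first_submodule :
  graded_submodule (fun _ : 'I_1 => 0%N) (fun p => aug (p 0 0) = 0).
Proof.
split=> [|p q p0 q0|u p p0|m p p0]; rewrite mxE ?raddf0 ?raddfD /= ?p0 ?q0 ?addr0//.
  by rewrite (cg_augM cg) p0 mulr0.
rewrite subn0; case: m => [|m]; first by rewrite (cg_comp0 cg) p0 scale0r raddf0.
by apply: (@aug_deg m.+1) => //; rewrite (cg_comp_comp cg) eqxx.
Qed.

Lemma next_submodule (s : stage) :
  graded_submodule (@deg1 s) (fun p => p *m mat s = 0).
Proof.
split=> [|p q p0 q0|u p p0|m p p0]; first exact: mul0mx.
- by rewrite mulmxDl p0 q0 addr0.
- by rewrite -scalemxAl p0 scaler0.
- by rewrite -(hcompM _ _ (@stage_hom s)) p0 raddf0.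
Qed.

Lemma min_generators_sig n (a : 'I_n -> nat) K : graded_submodule a K ->
  {m : nat & {e : 'I_m -> nat & {E : 'M[A]_(m, n) |
     generators a K e E /\ minimal_mx E}}}.
Proof.
move=> /minimal_generators /cid[m] /cid[e] /cid[E h].
by exists m, e, E.
Qed.

Lemma cover_hom n (a : 'I_n -> nat) K (gK : graded_submodule a K) :
  let t := min_generators_sig gK in
  hom_mx (projT1 (projT2 t)) a (sval (projT2 (projT2 t))).
Proof. by case: min_generators_sig => m [e [E [[]]]]. Qed.

Definition cover n (a : 'I_n -> nat) K (gK : graded_submodule a K) : stage :=
  Stage (@cover_hom n a K gK).

Lemma coverP n (a : 'I_n -> nat) K (gK : graded_submodule a K) p :
  K p <-> exists q, q *m mat (cover gK) = p.
Proof.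
rewrite /cover /=; case: min_generators_sig => m [e [M [[hM KM gM] mM]]] /=.
split=> [/gM[u ->]|[q <-]]; first by exists u.
by rewrite mulmx_sum_row; apply: (gs_sum gK) => k _; exact: (gsZ gK).
Qed.

Lemma cover_min n (a : 'I_n -> nat) K (gK : graded_submodule a K) :
  minimal_mx (mat (cover gK)).
Proof. by rewrite /cover /=; case: min_generators_sig => m [e [M []]]. Qed.

Definition next (s : stage) : stage := cover (next_submodule s).

Definition first : stage := cover first_submodule.

Definition st i : stage := iter i next first.

Local Notation dim i := (dim0 (st i)).
Local Notation E i := (mat (st i) : 'M[A]_(dim i.+1, dim i)).

Lemma min_mat i : minimal_mx (E i).
Proof. by case: i => [|i]; exact: cover_min. Qed.

Lemma exact_mat0 (p : 'rV[A]_(dim 0)) :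
  aug (p 0 0) = 0 <-> exists q, q *m E 0 = p.
Proof. exact: (coverP first_submodule). Qed.

Lemma exact_mat i (p : 'rV[A]_(dim i.+1)) :
  p *m E i = 0 <-> exists q, q *m E i.+1 = p.
Proof. exact: (coverP (next_submodule (st i))). Qed.

Lemma mat_mat i : E i.+1 *m E i = 0.
Proof.
apply/row_matrixP => k; rewrite row_mul row0; apply/exact_mat.
by exists (row k 1%:M); rewrite -row_mul mul1mx.
Qed.

(** Minimality: the entries lie in the augmentation ideal, so all differentials become zero in
    Hom(-, F). *)
Lemma aug_mat i k l : aug (E i k l) = 0.
Proof.
case: i k l => [|i] k l.
  have [_] := exact_mat0 (row k (E 0)); rewrite mxE ord1; apply.
  by exists (row k 1%:M); rewrite -row_mul mul1mx.
have := @min_mat i (row k (E i.+1)); rewrite -row_mul mat_mat row0 => /(_ erefl l).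
by rewrite mxE.
Qed.

Lemma aug_mulmat i (q : 'rV[A]_(dim i.+1)) l : aug ((q *m E i) 0 l) = 0.
Proof.
rewrite mxE raddf_sum big1// => k _ /=.
by rewrite (cg_augM cg) aug_mat mulr0.
Qed.

Local Notation deg i := (@deg0 (st i)).

Definition res_mod i : lmodType A := 'rV[A]_(dim i).

Definition res_deg i m : set (res_mod i) :=
  [set p : 'rV[A]_(dim i) | hcomp (deg i) m p = p].

Definition res_map i : {linear res_mod i.+1 -> res_mod i} := mulmxr (E i).

Definition res_eps (p : res_mod 0) : F := aug ((p : 'rV[A]_(dim 0)) 0 0).

Lemma row_projective n : @projective F A ('rV[A]_n).
Proof.
move=> M M' g f gsurj.
have [x xE] := choice (fun j : 'I_n => gsurj (f (delta_mx 0 j))).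
pose h (p : 'rV[A]_n) : M := \sum_j p 0 j *: x j.
have h_lin : linear h.
  move=> u p q; rewrite /h scaler_sumr -big_split; apply: eq_bigr => j _ /=.
  by rewrite !mxE scalerDl scalerA.
pose hL := GRing.isLinear.Build A 'rV[A]_n M *:%R h h_lin.
pose hh : {linear 'rV[A]_n -> M} := HB.pack h hL.
exists hh => p; rewrite /= /h linear_sum [p in RHS]row_sum_delta linear_sum.
by apply: eq_bigr => j _; rewrite (linearZ_LR g) (linearZ_LR f) xE.
Qed.

Lemma res_graded_lemma i : is_graded AG (@res_deg i).
Proof.
split.
- by move=> m; exact: raddf0.
- by move=> m p q hp hq; rewrite /res_deg /= raddfB /= hp hq.
- move=> k m u p /(cg_deg cg) hu hp; rewrite /res_deg /=; apply/rowP => j.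
  have := congr1 (fun q : 'rV[A]_(dim i) => q 0 j) hp; rewrite !mxE.
  case: leqP => [am|am <-]; last by rewrite mulr0 raddf0 if_same.
  move=> hj; rewrite (compM_hom _ _ hj) (leq_trans am) ?leq_addl//.
  by rewrite leq_sub2r ?leq_addl// subnBA// subnK ?(leq_trans am) ?leq_addl// addnK hu.
- move=> p; exists (D + \max_j deg i j)%N, (fun m => hcomp (deg i) m p); split.
    by move=> m; rewrite /res_deg /= hcomp_hcomp eqxx.
  by apply: hcomp_sum => j; exact: leq_bigmax.
- move=> L c hc sum0 m mL; rewrite -[c m]hc.
  have := congr1 (hcomp (deg i) m) sum0; rewrite raddf0 raddf_sum /= => <-.
  rewrite (bigD1 (Ordinal mL))//= big1 ?addr0// => k km.
  have mk : (m == k) = false.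
    by apply: contraNF km => /eqP mk; apply/eqP/val_inj.
  by rewrite -[c k]hc hcomp_hcomp mk.
Qed.

Lemma res_map_deg i m (p : res_mod i.+1) :
  res_deg m p -> res_deg m (res_map i p).
Proof.
rewrite /res_deg /= => hp.
by rewrite (hcompM _ _ (@stage_hom (st i))) -[deg1 (s:=st i)]/(deg i.+1) hp.
Qed.

Lemma res_eps_hom : trivial_hom AG (@res_deg 0) 0 res_eps.
Proof.
split.
- by move=> p q; rewrite /res_eps !mxE raddfB.
- by move=> c p; rewrite /res_eps mxE aug_scale.
- move=> m u p /(cg_deg cg) hu; rewrite /res_eps mxE (cg_augM cg).
  by rewrite (aug_deg _ hu) ?mul0r.
- move=> m p /(congr1 (fun q : 'rV[A]_(dim 0) => q 0 0)) /= + m0.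
  by rewrite mxE /= subn0; exact: aug_deg.
Qed.

Lemma res_eps_surj c : exists p, res_eps p = c.
Proof.
exists (const_mx c%:A); rewrite /res_eps mxE -[_%:A]mulr1 aug_scale.
by rewrite (cg_aug1 cg) mulr1.
Qed.

Definition min_res : graded_projective_resolution AG :=
  {| res := res_mod; resG := @res_deg; res_d := res_map; res_aug := res_eps;
     res_graded := res_graded_lemma; res_projective := fun i => @row_projective (dim i);
     res_d_deg := res_map_deg; res_aug_hom := res_eps_hom;
     res_aug_surj := res_eps_surj; res_exact0 := exact_mat0;
     res_exact := exact_mat |}.

(** * Linearity of the minimal resolution of a Koszul algebra *)

Lemma mul_row1 m n (M : 'M[A]_(m, n)) k : row k 1%:M *m M = row k M.
Proof. by rewrite -row_mul mul1mx. Qed.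

Lemma lift_mx m n l (M : 'M[A]_(l, n)) (B : 'M[A]_(m, n)) :
  (forall k, exists y, y *m B = row k M) -> exists H, M = H *m B.
Proof.
move=> /choice[y hy]; exists (\matrix_k y k); apply/row_matrixP => k.
by rewrite row_mul rowK hy.
Qed.

Lemma trivial_hom_kill i j (f : 'rV[A]_(dim i) -> F) :
  trivial_hom AG (@res_deg i) j f ->
  forall p : 'rV[A]_(dim i), (forall k, aug (p 0 k) = 0) -> f p = 0.
Proof.
move=> [fB _ f_aug _] p p0.
have f0 : f 0 = 0 by rewrite -(subrr 0) fB subrr.
have fD p1 p2 : f (p1 + p2) = f p1 + f p2.
  by rewrite -[p2 in LHS]opprK fB -sub0r fB f0 sub0r opprK.
have f_sum (I : Type) (s : seq I) (g : I -> 'rV[A]_(dim i)) :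
    f (\sum_(x <- s) g x) = \sum_(x <- s) f (g x).
  by elim: s => [|x s IHs]; rewrite ?big_nil// !big_cons fD IHs.
rewrite [p]row_sum_delta f_sum big1// => k _.
rewrite [p 0 k]comp_sum scaler_suml f_sum big1// => -[[|m] mD] _ /=.
  by rewrite (cg_comp0 cg) p0 scale0r scale0r.
by apply: (f_aug m); apply/(cg_deg cg); rewrite (cg_comp_comp cg) eqxx.
Qed.

(** As the differentials vanish in Hom(-, F), cochains are classes, and the second clause says that
    classes off the diagonal are zero. The first clause is what survives composition with a lift. *)
Definition diagonal i j (f : 'rV[A]_(dim i) -> F) :=
  (forall p : 'rV[A]_(dim i), (forall k, aug (p 0 k) = 0) -> f p = 0) /\ (i <> j -> forall p, f p = 0).

(* If f vanishes then the lift phi of f is null-homotopic, and by minimality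
   all its coordinates lie in the augmentation ideal. *)
Lemma null_lift i (phi : forall m, {linear res_mod (m + i) -> res_mod m}) :
  (forall x, res_eps (phi 0%N x) = 0) ->
  (forall m x, res_map m (phi m.+1 x) = phi m (res_map (m + i) x)) ->
  forall m (x : 'rV[A]_(dim (m + i))) k,
    aug ((phi m x : 'rV[A]_(dim m)) 0 k) = 0.
Proof.
move=> phi0 phiS.
pose Phi m : 'M[A]_(dim (m + i), dim m) := lin1_mx (phi m).
have PhiE m x : (phi m x : 'rV[A]_(dim m)) = x *m Phi m by rewrite mul_rV_lin1.
have comm m : Phi m.+1 *m E m = E (m + i) *m Phi m.
  apply/row_matrixP => k; rewrite !row_mul -[row k (Phi m.+1)]mul_row1 -!PhiE.
  have := phiS m (row k 1%:M); rewrite /res_map /= mul_row1 => <-.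
  by rewrite PhiE.
suff key m : (exists H : 'M[A]_(dim (m + i), dim m.+1),
      Phi m.+1 *m E m = E (m + i) *m H *m E m) /\
    forall (x : 'rV[A]_(dim (m + i))) k, aug ((x *m Phi m) 0 k) = 0.
  by move=> m x k; rewrite PhiE; exact: (key m).2.
elim: m => [|m [[H hH] IHm]].
  have [|H hH] := @lift_mx _ _ _ (Phi 0) (E 0).
    move=> k; apply/exact_mat0; rewrite rowE -PhiE; exact: phi0.
  split; first by exists H; rewrite comm hH mulmxA.
  by move=> x k; rewrite hH mulmxA aug_mulmat.
have [|H' hH'] := @lift_mx _ _ _ (Phi m.+1 - E (m + i) *m H) (E m.+1).
  move=> k; apply/exact_mat; rewrite -row_mul mulmxBl hH subrr row0//.
have PhiS : Phi m.+1 = E (m + i) *m H + H' *m E m.+1.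
  by rewrite -hH' addrC subrK.
split.
  exists H'; rewrite comm PhiS mulmxDr mulmxA.
  have -> : E (m.+1 + i) *m (E (m + i) *m H) = 0.
    by rewrite mulmxA [X in X *m _]mat_mat mul0mx.
  by rewrite add0r.
move=> x k; rewrite PhiS mulmxDr mxE raddfD /= !mulmxA.
have -> : aug ((x *m H' *m E m.+1) 0 k) = 0 by exact: aug_mulmat.
by rewrite addr0; apply: aug_mulmx => l; exact: aug_mulmat.
Qed.

(** The delicate case is a product whose factor f is off the diagonal. Then f is zero, but the
    chosen lift [phi] need not be; its coordinates lie in the augmentation ideal, where g
    vanishes. *)
Lemma ext11_diagonal i j (f : res min_res i -> F) :
  ext11_generated j f -> diagonal j f.
Proof.
elim=> {i j f} [|f [hf _]|i j f hf|i j c f g _ [f0 fij] _ [g0 gij]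
    |i j k l f g h _ [f0 fij] _ [g0 gkl] [phi [_ phi0 phiS hE]]].
- split=> [p p0|//]; exact: p0.
- by split=> [|//]; exact: trivial_hom_kill hf.
- suff fz p : f p = 0 by split.
  case: i f hf p => [|i] f /=; first by [].
  by move=> [g hg fE] p; rewrite fE (trivial_hom_kill hg)// => k; exact: aug_mulmat.
- split=> [p p0|ij p]; first by rewrite f0// g0// mulr0 addr0.
  by rewrite fij// gij// mulr0 addr0.
- split=> [p p0|ne p]; rewrite hE.
    by apply: g0 => t; rewrite -(mul_rV_lin1 (phi k)); exact: aug_mulmx.
  have [ij|/eqP ij] := eqVneq i j; last first.
    by apply: g0; apply: null_lift => // x; rewrite -(fij ij x); exact: phi0.
  by apply: gkl => kl; apply: ne; rewrite ij kl.
Qed.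

(** The coordinate function of basis vector t is a cocycle of bidegree (i, [deg i t]) with value 1
    on that vector, so it cannot be off the diagonal. *)
Theorem koszul_linear : koszul AG -> forall i t, deg i t = i.
Proof.
move=> kA i t; apply/eqP; apply: contraT => /eqP ne.
pose f (p : res min_res i) : F := aug ((p : 'rV[A]_(dim i)) 0 t).
have hf : ext_cocycle (P := min_res) (deg i t) f.
  split; last by move=> y; exact: aug_mulmat.
  split.
  - by move=> p q; rewrite /f !mxE raddfB.
  - by move=> c p; rewrite /f mxE aug_scale.
  - move=> m u p /(cg_deg cg) hu; rewrite /f mxE (cg_augM cg).
    by rewrite (aug_deg _ hu) ?mul0r.
  - move=> m p /(congr1 (fun q : 'rV[A]_(dim i) => q 0 t)) /=.
    rewrite mxE /f; case: leqP => [am h mt|am <- _]; last by rewrite raddf0.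
    by apply: aug_deg h; rewrite subn_eq0 -ltnNge ltn_neqAle eq_sym mt am.
have [_ /(_ _ (delta_mx 0 t))] := ext11_diagonal (kA min_res i _ f hf).
move=> /(_ (fun e => ne (esym e))) /eqP.
by rewrite /f mxE !eqxx (cg_aug1 cg) oner_eq0.
Qed.

Hypothesis koszulA : koszul AG.

(** * Right ideals with a linear resolution *)

Lemma comp1_mat i k l : comp 1 (E i k l) = E i k l.
Proof.
have := @stage_hom (st i) k l.
rewrite -[deg1 (s:=st i) k]/(deg i.+1 k) !koszul_linear// leqnSn.
by rewrite subSnn.
Qed.

(** In homological degree 0, a vector of positive degree lies in the augmentation ideal and is
    therefore a boundary. *)
Definition closed i : 'rV[A]_(dim i) -> Prop :=
  if i is i'.+1 then fun p => p *m E i' = 0 else fun=> True.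

Lemma comp_mulmat m i (q : 'rV[A]_(dim i.+1)) l :
  comp m.+1 ((q *m E i) 0 l) = (map_mx (comp m) q *m E i) 0 l.
Proof.
rewrite !mxE raddf_sum; apply: eq_bigr => k _ /=.
by rewrite (compM_hom _ _ (comp1_mat k l)) mxE subn1.
Qed.

(** The matrices have entries of degree 1, so the homogeneous part of a preimage one degree lower is
    again a preimage. *)
Lemma linear_exact m i (p : 'rV[A]_(dim i)) :
  (forall l, comp m.+1 (p 0 l) = p 0 l) -> closed p ->
  exists q : 'rV[A]_(dim i.+1),
    (forall k, comp m (q 0 k) = q 0 k) /\ q *m E i = p.
Proof.
move=> hp cp.
have [q qp] : exists q, q *m E i = p.
  case: i p hp cp => [|i] p hp cp; last exact/exact_mat.
  by apply/exact_mat0; apply: aug_deg (hp 0).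
exists (map_mx (comp m) q); split.
  by move=> k; rewrite mxE (cg_comp_comp cg) eqxx.
by apply/rowP => l; rewrite -comp_mulmat qp hp.
Qed.

(* For a right ideal M, the tensor product of M with the resolution is the
   subcomplex of vectors with coordinates in M; strand_exact M says that it is
   exact away from the strand where these coordinates have degree 1. *)
Definition strand_exact (M : A -> Prop) := forall i m (p : 'rV[A]_(dim i)),
  (0 < m)%N -> (forall l, M (p 0 l)) -> (forall l, comp m.+1 (p 0 l) = p 0 l) ->
  closed p ->
  exists q : 'rV[A]_(dim i.+1), [/\ forall k, M (q 0 k),
    forall k, comp m (q 0 k) = q 0 k & q *m E i = p].

Definition right_multiples (a u : A) := exists v, u = a * v.
Definition right_annihilator (a u : A) := a * u = 0.

Lemma comp_mul1 m a u : comp 1 a = a -> comp m.+1 (a * u) = a * comp m u.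
Proof.
move=> ha; have ca i : comp i a = if i == 1%N then a else 0.
  by rewrite -ha (cg_comp_comp cg) ha.
rewrite (cg_compM cg) !big_ord_recl !ca /= mul0r add0r subSS subn0.
by rewrite big1 ?addr0// => i _; rewrite ca mul0r.
Qed.

(** Dimension shifting along 0 -> ann(a) -> A -> a A -> 0. If p = q E, then a q is a cycle with
    coordinates in a A, so it is the image of some a w''; subtracting the image of w'' from q gives
    a preimage of p with coordinates in ann(a). *)
Lemma strand_exact_annihilator a : comp 1 a = a ->
  strand_exact (right_multiples a) -> strand_exact (right_annihilator a).
Proof.
move=> a1 exa i m p m0 ap hp cp.
have [q [hq qp]] := linear_exact hp cp.
have [l|l||w [aw hw wE]] := exa i.+1 m (a *: q) m0.
- by exists (q 0 l); rewrite mxE.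
- by rewrite mxE comp_mul1// hq.
- by rewrite /closed -scalemxAl qp; apply/rowP => l; rewrite !mxE; exact: ap.
have [w' ww'] := choice aw.
(* The vector w has degree m and is divisible by a, so w'' has degree m - 1. This is where m > 0
   enters. *)
case: m m0 hp hq hw => // m _ hp hq hw.
pose w'' : 'rV[A]_(dim i.+2) := \row_k comp m (w' k).
have waw : w = a *: w''.
  by apply/rowP => k; rewrite !mxE -comp_mul1// -ww' hw.
exists (q - w'' *m E i.+1); split=> [k|k|].
- have h : a *: (q - w'' *m E i.+1) = 0.
    by rewrite scalerBr scalemxAl -waw wE subrr.
  by rewrite /right_annihilator; have /rowP/(_ k) := h; rewrite !mxE.
- have hE : comp m.+1 ((w'' *m E i.+1) 0 k) = (w'' *m E i.+1) 0 k.
    rewrite (@comp_mulmat m i.+1 w'' k); congr ((_ *m _) 0 k).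
    by apply/rowP => l; rewrite !mxE (cg_comp_comp cg) eqxx.
  have -> : (q - w'' *m E i.+1) 0 k = q 0 k - (w'' *m E i.+1) 0 k by rewrite !mxE.
  by rewrite raddfB /= hq hE.
rewrite mulmxBl -mulmxA qp.
have -> : E i.+1 *m E i = 0 by exact: mat_mat.
by rewrite mulmx0 subr0.
Qed.

(** * The right ideals generated by the layers below an element *)

Section PosetStrands.
Variables (X : finType) (r : X -> A) (proj : X -> A -> A).
Variable S : X -> nat -> pred X.

(* The combinatorial data of a uniform ranked poset together with the
   decomposition of the augmentation ideal into the right ideals r_z A. *)
Record strand_data : Prop := {
  sd_S0 : forall x y, S x 0 y = (y == x);
  sd_Sstep : forall x k y z, S x k y -> S y 1 z -> S x k.+1 z;
  sd_conn : forall (T : Type) x k (c : X -> T),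
    (forall y, S x k y -> forall z w, S y 1 z -> S y 1 w -> c z = c w) ->
    forall z w, S x k.+1 z -> S x k.+1 w -> c z = c w;
  sd_deg1 : forall x, comp 1 (r x) = r x;
  sd_rel0 : forall y z, ~~ S y 1 z -> r y * r z = 0;
  sd_relS : forall y, r y * (\sum_(z | S y 1 z) r z) = 0;
  sd_const : forall y (c : X -> F), r y * (\sum_z c z *: r z) = 0 ->
    forall z w, S y 1 z -> S y 1 w -> c z = c w;
  sd_projP : forall z c u v, proj z (c *: u + v) = c *: proj z u + proj z v;
  sd_projM : forall z u v, aug u = 0 -> proj z (u * v) = proj z u * v;
  sd_proj_rM : forall z x u, proj z (r x * u) = if x == z then r x * u else 0;
  sd_proj_ex : forall z u, exists v, proj z u = r z * v;
  sd_proj_sum : forall u, aug u = 0 -> u = \sum_z proj z u }.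

Hypothesis sd : strand_data.

Lemma proj_lin z : linear (proj z).
Proof. by move=> c u v; rewrite sd_projP. Qed.

HB.instance Definition _ z := GRing.isLinear.Build F A A *:%R (proj z) (proj_lin z).

Definition layer x k : A := \sum_(y | S x k y) r y.
Definition layer_proj x k (u : A) : A := \sum_(y | S x k y) proj y u.

Lemma layer_proj_lin x k : linear (layer_proj x k).
Proof.
move=> c u v; rewrite /layer_proj scaler_sumr -big_split.
by apply: eq_bigr => y _; rewrite linearP.
Qed.

HB.instance Definition _ x k :=
  GRing.isLinear.Build F A A *:%R (layer_proj x k) (layer_proj_lin x k).

Lemma layer0 x : layer x 0 = r x.
Proof. by rewrite /layer (eq_bigl (pred1 x)) ?big_pred1_eq// => y; rewrite sd_S0. Qed.

Lemma aug_r x : aug (r x) = 0.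
Proof. by apply: aug_deg (sd_deg1 sd x). Qed.

Lemma comp1_layer x k : comp 1 (layer x k) = layer x k.
Proof. by rewrite raddf_sum; apply: eq_bigr => y _; exact: sd_deg1. Qed.

Lemma proj_layerM x k z u : proj z (layer x k * u) = if S x k z then r z * u else 0.
Proof.
rewrite mulr_suml raddf_sum /=; case: ifPn => [xz|/negP xz].
  rewrite (bigD1 z)//= sd_proj_rM// eqxx big1 ?addr0// => y /andP[_ /negPf yz].
  by rewrite sd_proj_rM// yz.
rewrite big1// => y xy; rewrite sd_proj_rM//; case: eqP => // yz.
by case: xz; rewrite -yz.
Qed.

Lemma layer_proj_layerM x k u : layer_proj x k (layer x k * u) = layer x k * u.
Proof.
rewrite /layer_proj; under eq_bigr => y xy do rewrite proj_layerM xy.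
by rewrite mulr_suml.
Qed.

Lemma layer_projM x k u v : aug u = 0 -> layer_proj x k (u * v) = layer_proj x k u * v.
Proof. by move=> u0; rewrite mulr_suml; apply: eq_bigr => y _; exact: sd_projM. Qed.

(** The right ideals r_y A are independent, so a vanishing sum has vanishing terms. *)
Lemma layer_annihilates x k u : layer x k * u = 0 -> forall y, S x k y -> r y * u = 0.
Proof.
by move=> /(congr1 (proj _)) h y xy; have := h y; rewrite proj_layerM xy raddf0.
Qed.

(** For y in S_x(k), the letters of S_x(k+1) that r_y does not kill are those of S_y(1), and the sum
    relation of y applies. *)
Lemma layer_layer x k : layer x k * layer x k.+1 = 0.
Proof.
rewrite /layer mulr_suml big1// => y xy; rewrite mulr_sumr (bigID (S y 1))/=.
rewrite [X in _ + X]big1 ?addr0 => [|z /andP[_]]; last exact: sd_rel0.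
rewrite -mulr_sumr -[RHS](sd_relS sd y); congr (_ * _); apply: eq_bigl => z.
by rewrite andb_idl// => yz; exact: sd_Sstep xy yz.
Qed.

Lemma comp_proj m z u : aug u = 0 -> comp m (proj z u) = proj z (comp m u).
Proof.
move=> u0; rewrite [in RHS](sd_proj_sum sd u0) !raddf_sum /=.
have pE y : proj z (comp m (proj y u)) = if y == z then comp m (proj y u) else 0.
  have [v ->] := sd_proj_ex sd y u; case: m => [|m].
    rewrite (cg_comp0 cg) (cg_augM cg) aug_r mul0r scale0r raddf0 if_same//.
  by rewrite comp_mul1 ?sd_proj_rM// sd_deg1.
under eq_bigr do rewrite pE.
by rewrite -big_mkcond big_pred1_eq.
Qed.

Lemma comp_layer_proj m x k u : aug u = 0 ->
  comp m (layer_proj x k u) = layer_proj x k (comp m u).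
Proof. by move=> u0; rewrite raddf_sum; apply: eq_bigr => y _; exact: comp_proj. Qed.

(** In a combination v of generators, r_y v = 0 makes the coefficients equal on S_y(1), for each y
    in S_x(k). Uniformity makes them equal on all of S_x(k+1). *)
Lemma layer_annihilator_deg1 x k v :
  comp 1 v = v -> layer x k * v = 0 ->
  exists b, comp 0 b = b /\ layer_proj x k.+1 v = layer x k.+1 * b.
Proof.
move=> v1 lv; have v0 : aug v = 0 by apply: aug_deg v1.
have coef z : exists c, proj z v = c *: r z.
  have [w pw] := sd_proj_ex sd z v; exists (aug w).
  have := comp_proj 1 z v0; rewrite v1 pw comp_mul1 ?sd_deg1// => <-.
  by rewrite (cg_comp0 cg) mulr_algr.
have [c hc] := choice coef.
have cst y : S x k y -> forall z w, S y 1 z -> S y 1 w -> c z = c w.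
  move=> xy; apply: (sd_const sd).
  have := layer_annihilates lv xy; rewrite [X in _ * X](sd_proj_sum sd v0).
  by under eq_bigr do rewrite hc.
have {}cst := sd_conn sd cst.
have [z0 xz0|none] := pickP (S x k.+1); last first.
  exists 0; split; first exact: raddf0.
  by rewrite mulr0 /layer_proj big_pred0.
exists (c z0)%:A; split.
  have := aug_scale (c z0) 1; rewrite (cg_aug1 cg) !mulr1 => h.
  by rewrite (cg_comp0 cg) h.
rewrite mulr_algr scaler_sumr; apply: eq_bigr => z xz.
by rewrite hc (cst _ _ xz xz0).
Qed.

(** Exactness in homological degree 0 writes v as a sum of products q_l E_l, with q_l in the
    annihilator and of one degree less and E_l a generator of the augmentation ideal. The projection
    is right linear on such products, so induction on the degree applies. *)
Lemma layer_annihilator x k : strand_exact (right_annihilator (layer x k)) ->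
  forall m v, comp m.+1 v = v -> layer x k * v = 0 ->
  exists b, comp m b = b /\ layer_proj x k.+1 v = layer x k.+1 * b.
Proof.
move=> exk; elim=> [|m IHm] v hv lv; first exact: layer_annihilator_deg1.
have [//|l|l|//|q [lq hq qv]] := exk 0 m.+1 (const_mx v).
- by rewrite mxE.
- by rewrite mxE.
have [bb hb] := choice (fun l => IHm _ (hq l) (lq l)).
exists (\sum_l bb l * E 0 l 0); split.
  rewrite raddf_sum; apply: eq_bigr => l _ /=.
  by rewrite (compM_hom _ _ (comp1_mat l 0)) subn1 (hb l).1.
have /rowP/(_ 0) := qv; rewrite !mxE => <-.
rewrite raddf_sum mulr_sumr; apply: eq_bigr => l _ /=.
by rewrite layer_projM ?(aug_deg _ (hq l))// (hb l).2 mulrA.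
Qed.

(** For k = 0, preimages are projected onto the direct summand r_x A of the augmentation ideal. From
    k to k+1, a preimage with coordinates in the annihilator of layer k is projected to layer k+1,
    where [layer_annihilator] makes its coordinates multiples of the layer sum. *)
Lemma strand_exact_layer x k : strand_exact (right_multiples (layer x k)).
Proof.
elim: k => [|k IHk] i m p m0 Mp hp cp.
  rewrite layer0 in Mp *.
  have [q [hq qp]] := linear_exact hp cp.
  have q0 l : aug (q 0 l) = 0 by apply: aug_deg (hq l); rewrite -lt0n.
  exists (map_mx (proj x) q); split=> [l|l|].
  - by rewrite mxE; exact: sd_proj_ex.
  - by rewrite mxE comp_proj// hq.
  apply/rowP => l; have [v pv] := Mp l.
  have -> : p 0 l = proj x (p 0 l) by rewrite pv sd_proj_rM// eqxx.
  rewrite -qp !mxE raddf_sum; apply: eq_bigr => t _ /=.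
  by rewrite mxE sd_projM.
have exk := strand_exact_annihilator (comp1_layer x k) IHk.
have [|q [Mq hq qp]] := exk i m p m0 _ hp cp.
  by move=> l; have [v ->] := Mp l; rewrite /right_annihilator mulrA layer_layer mul0r.
have q0 l : aug (q 0 l) = 0 by apply: aug_deg (hq l); rewrite -lt0n.
exists (map_mx (layer_proj x k.+1) q); split=> [l|l|].
- rewrite mxE; case: m m0 hp hq => // m _ hp hq.
  by have [v [_ ->]] := layer_annihilator exk (hq l) (Mq l); exists v.
- by rewrite mxE comp_layer_proj// hq.
apply/rowP => l; have [v pv] := Mp l.
have -> : p 0 l = layer_proj x k.+1 (p 0 l) by rewrite pv layer_proj_layerM.
rewrite -qp !mxE raddf_sum; apply: eq_bigr => t _ /=.
by rewrite mxE layer_projM.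
Qed.

Theorem layer_exact x k m v : comp m.+1 v = v -> layer x k * v = 0 ->
  layer_proj x k.+1 v = v -> exists b, comp m b = b /\ v = layer x k.+1 * b.
Proof.
move=> hv lv pv.
have exk := strand_exact_annihilator (comp1_layer x k) (@strand_exact_layer x k).
by have [w [hw vw]] := layer_annihilator exk hv lv; exists w; rewrite -vw pv.
Qed.

End PosetStrands.

End ConnectedGraded.

(** * Ranked uniform posets *)

Section RankedPoset.
Variables (d : Order.disp_t) (Gam : finBPOrderType d).
Hypothesis Gam_ranked : ranked Gam.
Implicit Types (x y z a b : Gam) (C : {set Gam}).
Local Open Scope order_scope.

Lemma is_chainP C :
  reflect {in C &, forall x y, x >=< y} (is_chain C).
Proof.
apply: (iffP forall_inP) => [h x y xC yC|h x xC]; last first.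
  by apply/forall_inP => y yC; exact: h.
by move/forall_inP: (h x xC) => /(_ y yC).
Qed.

Let below b (D : {set Gam}) := (D \subset [set x | (x <= b)%O]%SET) && is_chain D.

Lemma below_extend b C : below b C -> exists2 D, maximal_chain b D & C \subset D.
Proof. by move=> /maxset_exists[D maxD CD]; exists D. Qed.

Lemma below0 b : below b finset.set0.
Proof. by rewrite /below finset.sub0set; apply/is_chainP => x y; rewrite inE. Qed.

Lemma belowU x b C : below x C -> (forall y, y \in C -> y <= b) -> x <= b ->
  below b (b |: C)%SET.
Proof.
move=> /andP[_ /is_chainP chC] Cb xb; apply/andP; split.
  by apply/fintype.subsetP => y; rewrite !inE => /predU1P[->|/Cb].
apply/is_chainP => y z; rewrite !inE => /predU1P[->|yC] /predU1P[->|zC].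
- exact: comparablexx.
- by rewrite comparable_sym; apply: le_comparable; exact: Cb.
- by apply: le_comparable; exact: Cb.
- exact: chC.
Qed.

Lemma maximal_chain_below b C : maximal_chain b C -> below b C.
Proof. by move/maxsetp. Qed.

Lemma maximal_chain_le b C y : maximal_chain b C -> y \in C -> y <= b.
Proof. by move=> /maximal_chain_below /andP[/fintype.subsetP h _] /h; rewrite inE. Qed.

Lemma maximal_chain_top b C : maximal_chain b C -> b \in C.
Proof.
move=> mC; have := mC => /maxsetsup => /(_ (b |: C)%SET) <-.
- by rewrite finset.setU11.
- apply: (@belowU b) => //; first exact: maximal_chain_below.
  by move=> y; exact: maximal_chain_le.
- exact: finset.subsetUr.
Qed.

Lemma rkE b C : maximal_chain b C -> #|C| = (rk b).+1.
Proof.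
move=> mC; have C0 : (0 < #|C|)%N by apply/card_gt0P; exists b; exact: maximal_chain_top.
rewrite -(prednK C0) /rk; congr _.+1; apply/eqP; rewrite eqn_leq; apply/andP; split.
  exact: (@leq_bigmax_cond _ _ (fun C => #|C|.-1)).
by apply/bigmax_leqP => D mD; rewrite (Gam_ranked mC mD).
Qed.

Lemma rk_lt x y : x < y -> (rk x < rk y)%N.
Proof.
move=> xy; have [C mC _] := below_extend (below0 x).
have yC : y \notin C.
  by apply/negP => /(maximal_chain_le mC); rewrite (lt_geF xy).
have [|D mD /subset_leq_card] := @below_extend y (y |: C)%SET.
  apply: (belowU (maximal_chain_below mC)) => [z /(maximal_chain_le mC) zx|]; exact: ltW (le_lt_trans _ xy).
by rewrite cardsU1 yC (rkE mC) (rkE mD).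
Qed.

Lemma rk_le x y : x <= y -> (rk x <= rk y)%N.
Proof. by rewrite le_eqVlt => /predU1P[->//|/rk_lt/ltnW]. Qed.

Lemma rk_le_eq x y : x <= y -> rk x = rk y -> x = y.
Proof. by rewrite le_eqVlt => /predU1P[//|/rk_lt]; rewrite ltn_neqAle => /andP[/eqP]. Qed.

Lemma rk_bot : rk (\bot : Gam) = 0%N.
Proof.
have [C mC _] := below_extend (below0 \bot).
have: (#|C| <= #|[set \bot : Gam]%SET|)%N.
  by apply/subset_leq_card/fintype.subsetP => y /(maximal_chain_le mC); rewrite lex0 inE.
by rewrite cards1 (rkE mC) ltnS leqn0 => /eqP.
Qed.

Lemma rk_eq0 x : (rk x == 0)%N = (x == \bot).
Proof.
apply/eqP/eqP => [x0|->]; last exact: rk_bot.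
by apply/esym/rk_le_eq; rewrite ?le0x// rk_bot.
Qed.

(** Take y of least rank among the elements above z and at most x: a maximal chain of z extended by
    y is a maximal chain of y. *)
Lemma cover_ex x z : z < x -> exists y, [/\ z < y, y <= x & rk y = (rk z).+1].
Proof.
move=> zx.
have Px : (z < x) && (x <= x) by rewrite zx lexx.
case: (@arg_minnP _ x (fun y => (z < y) && (y <= x)) (@rk d Gam) Px) => y /andP[zy yx] miny.
exists y; split=> //.
have [C mC _] := below_extend (below0 z).
have yC : y \notin C by apply/negP => /(maximal_chain_le mC); rewrite (lt_geF zy).
suff mD : maximal_chain y (y |: C)%SET by have := rkE mD; rewrite cardsU1 yC (rkE mC) => -[].
apply/maxsetP; split.
  apply: (belowU (maximal_chain_below mC)); last exact: ltW.
  by move=> t /(maximal_chain_le mC) tz; exact: ltW (le_lt_trans tz zy).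
move=> B /andP[By /is_chainP chB] CB; apply/eqP; rewrite eq_sym finset.eqEsubset CB /=.
apply/fintype.subsetP => t tB; rewrite !inE.
have ty : t <= y by move/fintype.subsetP: By => /(_ t tB); rewrite inE.
have zB : z \in B by apply: (fintype.subsetP CB); rewrite !inE (maximal_chain_top mC) orbT.
have [tz|tz] := boolP (t <= z); last first.
  have zt : z < t.
    have := chB _ _ tB zB; rewrite /Order.comparable (negPf tz) /= le_eqVlt.
    by case/predU1P => [zt|//]; rewrite zt lexx in tz.
  apply/orP; left; apply/eqP/rk_le_eq => //; apply/eqP; rewrite eqn_leq rk_le//=.
  by apply: miny; rewrite zt (le_trans ty).
apply/orP; right.
have cl : below z (t |: C)%SET.
  apply/andP; split.
    by apply/fintype.subsetP => w; rewrite !inE => /predU1P[->//|/(maximal_chain_le mC)].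
  apply/is_chainP => v w; rewrite !inE => vC wC; apply: chB.
    by case/predU1P: vC => [->//|vC]; apply: (fintype.subsetP CB); rewrite !inE vC orbT.
  by case/predU1P: wC => [->//|wC]; apply: (fintype.subsetP CB); rewrite !inE wC orbT.
have /maxsetsup := mC => /(_ _ cl (finset.subsetUr _ _)) <-.
exact: finset.setU11.
Qed.

Lemma S_P x k y : reflect (y <= x /\ (rk y + k = rk x)%N) (y \in S_ x k).
Proof. by rewrite inE; apply: (iffP andP) => -[yx /eqP]. Qed.

Lemma S_0 x y : (y \in S_ x 0) = (y == x).
Proof.
apply/S_P/eqP => [[yx]|->]; first by rewrite addn0; exact: rk_le_eq.
by rewrite lexx addn0.
Qed.

Lemma S_1 x y : (y \in S_ x 1) = (y < x) && ((rk y).+1 == rk x).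
Proof.
apply/S_P/andP => [[yx]|[yx /eqP <-]]; last by rewrite addn1 ltW.
rewrite addn1 => h; rewrite h eqxx; split=> //; rewrite lt_neqAle yx andbT.
by apply/eqP => yx'; move: h; rewrite yx' => /eqP; rewrite eqn_leq ltnn.
Qed.

Lemma S_step x k y z : y \in S_ x k -> z \in S_ y 1 -> z \in S_ x k.+1.
Proof.
move=> /S_P[yx yk] /S_P[zy zk]; apply/S_P; split; first exact: le_trans zy yx.
by rewrite -yk -zk addn1 addSnnS.
Qed.

Lemma S_above x k z : z \in S_ x k.+1 -> exists2 y, y \in S_ x k & z \in S_ y 1.
Proof.
move=> /S_P[zx zk]; have [|y [zy yx ry]] := @cover_ex x z.
  by rewrite lt_neqAle zx andbT; apply/eqP => e; move/eqP: zk; rewrite e -[eqbRHS]addn0 eqn_add2l.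
exists y; first by apply/S_P; split=> //; rewrite ry -zk addnS.
by rewrite S_1 zy ry eqxx.
Qed.

Hypothesis Gam_uniform : uniform Gam.

Lemma adjacent_connect x a b : x != \bot -> a \in S_ x 1 -> b \in S_ x 1 ->
  connect (adjacent x) a b.
Proof.
move=> x0 xa xb; have /eqP/cards1P[B partE] := Gam_uniform x0.
pose cl c := [set y in S_ x 1 | connect (adjacent x) c y]%SET.
have clB c : c \in S_ x 1 -> cl c = B.
  by move=> xc; apply/set1P; rewrite -partE; apply/imsetP; exists c.
have: b \in cl b by rewrite inE xb connect0.
by rewrite clB// -(clB a)// inE => /andP[].
Qed.

Lemma adjacent_invariant (T : Type) (f : Gam -> T) x a b : x != \bot ->
  a \in S_ x 1 -> b \in S_ x 1 ->
  (forall a b c, a \in S_ x 1 -> b \in S_ x 1 -> c \in S_ a 1 -> c \in S_ b 1 ->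
    f a = f b) -> f a = f b.
Proof.
move=> x0 xa xb inv; have /connectP[p] := adjacent_connect x0 xa xb.
elim: p a {xa} => [|c p IHp] a /=; first by move=> _ ->.
move=> /andP[/and3P[xa xc /existsP[e /andP[ea ec]]] pp] lp.
by rewrite (inv a c e)//; exact: IHp.
Qed.

Local Notation nb := (nonbot Gam).

(** Constancy is pushed upwards: c induces a function f on S_x(k+1), whose value at a is the common
    value of c on S_a(1). Elements of S_v(1) with a common lower cover have equal f, so uniformity
    and the induction hypothesis for f conclude. *)
Lemma layers_connected (T : Type) (x : nb) k (c : nb -> T) :
  (forall y : nb, val y \in S_ (val x) k -> forall z w : nb,
    val z \in S_ (val y) 1 -> val w \in S_ (val y) 1 -> c z = c w) ->
  forall z w : nb, val z \in S_ (val x) k.+1 -> val w \in S_ (val x) k.+1 ->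
  c z = c w.
Proof.
elim: k T c => [|k IHk] T c cst z w xz xw.
  by apply: (cst x) => //; rewrite S_0.
(* The value [None] is taken at atoms, which cover only the bottom element. *)
pose f (a : Gam) := omap c [pick t : nb | val t \in S_ a 1].
have fE (y t : nb) : val y \in S_ (val x) k.+1 -> val t \in S_ (val y) 1 ->
    f (val y) = Some (c t).
  move=> xy yt; rewrite /f; case: pickP => [u yu|/(_ t)]; last by rewrite yt.
  by rewrite /=; congr Some; exact: (cst y).
have up (t : nb) : val t \in S_ (val x) k.+2 ->
    exists2 y : nb, val y \in S_ (val x) k.+1 & val t \in S_ (val y) 1.
  move=> /S_above[y xy ty]; have y0 : y != \bot.
    by apply/eqP => e; move: ty; rewrite e S_1 ltx0.
  by exists (Sub y y0 : nb).
have [y xy yz] := up z xz; have [y' xy' y'w] := up w xw.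
suff : f (val y) = f (val y') by rewrite (fE y z)// (fE y' w)// => -[].
apply: (IHk _ (fun y : nb => f (val y))) => // v xv a b va vb.
apply: (@adjacent_invariant _ f (val v)) => //; first exact: (valP v).
move=> {a b va vb} a b e va vb ea eb.
have [e0|e0] := eqVneq e \bot.
  have fN g : g \in S_ (val v) 1 -> e \in S_ g 1 -> f g = None.
    move=> vg eg; rewrite /f; case: pickP => //= t gt.
    have := valP t; rewrite -rk_eq0; move: eg gt; rewrite !S_1 e0 rk_bot.
    by move=> /andP[_ /eqP<-] /andP[_]; rewrite eqSS => ->.
  by rewrite !fN.
have nb0 g : e \in S_ g 1 -> g != \bot.
  by move=> eg; apply/eqP => h; move: eg; rewrite h S_1 ltx0.
rewrite (fE (Sub a (nb0 _ ea)) (Sub e e0)) ?(fE (Sub b (nb0 _ eb)) (Sub e e0))//=.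
  exact: S_step xv vb.
exact: S_step xv va.
Qed.

End RankedPoset.

(** * Finite dimensionality and layer exactness for R_Gamma *)

Lemma sum_ord_eventually0 (V : zmodType) (f : nat -> V) m n :
  (forall k, (m <= k)%N -> f k = 0) -> (forall k, (n <= k)%N -> f k = 0) ->
  \sum_(k < m) f k = \sum_(k < n) f k.
Proof.
move=> fm fn; rewrite (big_ord_widen (m + n) f) ?leq_addr//.
rewrite [RHS](big_ord_widen (m + n) f) ?leq_addl//.
rewrite big_mkcond [RHS]big_mkcond; apply: eq_bigr => k _.
case: ltnP => [km|mk]; case: ltnP => [kn|nk] //; first exact: fn.
by rewrite fm.
Qed.

Lemma sum_option (V : nmodType) (T : finType) (f : option T -> V) :
  \sum_t f t = f None + \sum_t f (Some t).
Proof.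
rewrite (bigD1 None)//=; congr (_ + _).
rewrite (@reindex_omap _ _ _ _ _ Some id) => [|[t|]] //=.
by apply: eq_bigl => t; rewrite eqxx.
Qed.

Section PosetAlgebraStrands.
Variables (F : fieldType) (d : Order.disp_t) (Gam : finBPOrderType d).
Hypothesis Gam_ranked : ranked Gam.
Local Notation R := (poset_alg F Gam).
Local Notation nb := (nonbot Gam).
Implicit Types (x y z : nb) (u v : R).

Lemma poset_alg_connected :
  connected_graded (@poset_alg_deg F d Gam) (@aug F d Gam) (@hpart F d Gam).
Proof.
split; [exact: augP|exact: augM|exact: aug1|exact: compP|exact: comp_comp
  |exact: compM|exact: comp0|exact: deg_comp].
Qed.

Lemma hpart_big (I : Type) (s : seq I) (P : pred I) (f : I -> R) m :
  hpart m (\sum_(i <- s | P i) f i) = \sum_(i <- s | P i) hpart m (f i).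
Proof.
have hD u v : hpart m (u + v) = hpart m u + hpart m v.
  by rewrite -[u]scale1r compP !scale1r.
elim: s => [|i s IHs]; first by rewrite !big_nil comp0r.
by rewrite !big_cons; case: (P i); rewrite ?hD IHs.
Qed.

Lemma proj_big (I : Type) (s : seq I) (P : pred I) (f : I -> R) z :
  letter_part z (\sum_(i <- s | P i) f i) = \sum_(i <- s | P i) letter_part z (f i).
Proof.
have hD u v : letter_part z (u + v) = letter_part z u + letter_part z v.
  by rewrite -[u]scale1r projP !scale1r.
elim: s => [|i s IHs]; first by rewrite !big_nil proj0.
by rewrite !big_cons; case: (P i); rewrite ?hD IHs.
Qed.

Lemma letter_part_sum z (g : nb -> R) :
  letter_part z (\sum_x gen F x * g x) = gen F z * g z.
Proof.
rewrite proj_big; under eq_bigr do rewrite proj_genM.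
by rewrite -big_mkcond big_pred1_eq.
Qed.

Lemma gen_decomp u : exists w : nb -> R, u = (aug u)%:A + \sum_z gen F z * w z.
Proof.
have [w hw] := choice (fun z => proj_gen_ex z u); exists w.
by rewrite {1}[u]proj_sum; under eq_bigr do rewrite hw.
Qed.

Lemma hpart_decomp m u (w : nb -> R) :
  u = (aug u)%:A + \sum_z gen F z * w z ->
  hpart m.+1 u = \sum_z gen F z * hpart m (w z).
Proof.
move=> uE; rewrite uE compP hpart_big (comp1 _ _ m.+1).
rewrite [_%:R]/= scaler0 add0r.
by apply: eq_bigr => z _; rewrite comp_genM.
Qed.

(** A nonzero word descends by covers from its first letter without reaching the bottom, so its
    length is at most the rank of that letter. *)
Lemma gen_mul_high m y u : (rk (val y) <= m)%N -> gen F y * hpart m u = 0.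
Proof.
elim: m y u => [|m IHm] y u.
  by rewrite leqn0 (rk_eq0 Gam_ranked) (negPf (valP y)).
move=> ym; have [w /(hpart_decomp m) ->] := gen_decomp u.
rewrite mulr_sumr big1// => z _; rewrite mulrA.
have [yz|yz] := boolP (val z \in S_ (val y) 1); last by rewrite gen_gen0// mul0r.
rewrite -mulrA IHm; first exact: mulr0.
by move: yz; rewrite S_1 => /andP[_ /eqP yz]; rewrite -yz in ym.
Qed.

Definition top_rank := (\max_(z : nb) rk (val z)).+1.

Lemma hpart_high m u : (top_rank <= m)%N -> hpart m u = 0.
Proof.
case: m => // m mD; have [w /(hpart_decomp m) ->] := gen_decomp u.
rewrite /top_rank ltnS in mD.
rewrite big1// => z _; apply: gen_mul_high; apply: leq_trans mD.
exact: (@leq_bigmax_cond _ _ (fun z : nb => rk (val z))).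
Qed.

Lemma hpart_sum u : u = \sum_(m < top_rank) hpart m u.
Proof.
have [N hN] : exists N, u = \sum_(m < N) hpart m u.
  by exists (size (coaction u)); exact: sum_hpart.
rewrite [LHS]hN; apply: (@sum_ord_eventually0 R (fun m => hpart m u)).
  move=> k Nk; rewrite hN hpart_big big1// => i _; rewrite comp_comp.
  by rewrite gtn_eqF// (leq_trans (ltn_ord i)).
by move=> k; exact: hpart_high.
Qed.

(** In an element without components of degree above m, what follows a leading letter may be
    truncated to degrees below m. *)
Lemma truncation_span m : exists (T : finType) (b : T -> R),
  forall u, (forall k, (m <= k)%N -> hpart k u = 0) ->
  exists c : T -> F, u = \sum_t c t *: b t.
Proof.
elim: m => [|m [T [b hb]]].
  exists void, (fun=> 0) => u u0; exists (fun=> 0).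
  by rewrite [LHS]hpart_sum !big1// => k _; rewrite ?u0 ?scaler0.
(* [None] stands for 1 and [Some (z, t)] for r_z times the spanning element t. *)
exists (option (nb * T))%type, (oapp (fun t => gen F t.1 * b t.2) 1) => u um.
have [w uE] := gen_decomp u.
pose tr v := \sum_(k < m) hpart k v.
have wtr z : gen F z * w z = gen F z * tr (w z).
  rewrite [w z in LHS](hpart_sum (w z)) /tr !mulr_sumr.
  apply: (@sum_ord_eventually0 R (fun k => gen F z * hpart k (w z))) => k.
    by move=> /(@hpart_high k (w z)) ->; exact: mulr0.
  move=> mk; have := letter_part_sum z (fun x => hpart k (w x)).
  rewrite -(hpart_decomp k uE) (um k.+1) ?proj0; last by [].
  by move=> <-.
have tr_span z : exists c : T -> F, tr (w z) = \sum_t c t *: b t.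
  apply: hb => k mk; rewrite hpart_big big1// => i _ /=.
  by rewrite comp_comp gtn_eqF// (leq_trans (ltn_ord i)).
have [c hc] := choice tr_span.
exists (oapp (fun t => c t.1 t.2) (aug u)).
rewrite sum_option /= [LHS]uE; congr (_ + _).
rewrite -(pair_big xpredT xpredT (fun z t => c z t *: (gen F z * b t))) /=.
apply: eq_bigr => z _; rewrite wtr hc mulr_sumr; apply: eq_bigr => t _.
by rewrite scalerAr.
Qed.

Lemma finite_span : exists N (b : 'I_N -> R),
  forall u, exists c : 'I_N -> F, u = \sum_i c i *: b i.
Proof.
have [T [b hb]] := truncation_span top_rank.
exists #|T|, (fun i => b (enum_val i)) => u.
have [k|c uE] := hb u; first exact: hpart_high.
exists (fun i => c (enum_val i)); rewrite [LHS]uE.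
by rewrite (big_enum_val (fun t => c t *: b t)).
Qed.

Hypothesis Gam_uniform : uniform Gam.

Definition below_by x k : pred nb := fun y => val y \in S_ (val x) k.

Lemma poset_strand_data :
  strand_data (@aug F d Gam) (@hpart F d Gam) (@gen F d Gam) (@letter_part F d Gam) below_by.
Proof.
split.
- by move=> x y; rewrite /below_by (S_0 Gam_ranked) val_eqE.
- by move=> x k y z; exact: S_step.
- by move=> T x k c; exact: layers_connected.
- by move=> x; rewrite comp_gen mul1r.
- exact: gen_gen0.
- exact: gen_relS.
- by move=> y c rel z w yz yw; exact: gen_span_const rel.
- exact: projP.
- by move=> z u v u0; rewrite projM u0 scale0r add0r.
- exact: proj_genM.
- exact: proj_gen_ex.
- by move=> u u0; rewrite {1}[u]proj_sum u0 scale0r add0r.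
Qed.

Theorem poset_layer_exact : koszul (@poset_alg_deg F d Gam) ->
  forall x k m v, hpart m.+1 v = v ->
  layer (@gen F d Gam) below_by x k * v = 0 ->
  layer_proj (@letter_part F d Gam) below_by x k.+1 v = v ->
  exists b, hpart m b = b /\ v = layer (@gen F d Gam) below_by x k.+1 * b.
Proof.
move=> kR x k m v; have [N [b span]] := finite_span.
exact: (layer_exact poset_alg_connected hpart_sum span kR poset_strand_data).
Qed.

End PosetAlgebraStrands.

(** * Cochains of tuples *)

Section TupleCochains.
Variables (T : Type) (F : comNzRingType).

Definition tnil : 'I_0 -> T := fun i => False_rect T (notF (ltn_ord i)).

Definition tcons n (b : T) (p : 'I_n -> T) : 'I_n.+1 -> T :=
  fun i => if unlift ord0 i is Some j then p j else b.

(* Cochains of tuples are indexed by the number n of vertices; n = 0 is the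
   augmentation. *)
Definition delta n (u : ('I_n -> T) -> F) (p : 'I_n.+1 -> T) : F :=
  \sum_(i < n.+1) (-1) ^+ i * u (p \o lift i).

Lemma tnil_unique (p q : 'I_0 -> T) : p = q.
Proof. by apply/funext => -[]. Qed.

Lemma tcons_head n b (p : 'I_n -> T) : tcons b p ord0 = b.
Proof. by rewrite /tcons unlift_none. Qed.

Lemma tcons_tail n b (p : 'I_n -> T) j : tcons b p (lift ord0 j) = p j.
Proof. by rewrite /tcons liftK. Qed.

Lemma tcons_lift0 n b (p : 'I_n -> T) : tcons b p \o lift ord0 = p.
Proof. by apply/funext => j; rewrite /= tcons_tail. Qed.

Lemma lift_lift0 n (i : 'I_n.+1) (j : 'I_n) :
  lift (lift ord0 i) (lift ord0 j) = lift ord0 (lift i j).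
Proof. by apply/val_inj; rewrite /= /bump !add1n ltnS addnS. Qed.

Lemma tcons_liftS n b (p : 'I_n.+1 -> T) i :
  tcons b p \o lift (lift ord0 i) = tcons b (p \o lift i).
Proof.
apply/funext => j /=; case: (unliftP ord0 j) => [k|] ->; last first.
  rewrite tcons_head; suff -> : lift (lift ord0 i) ord0 = ord0 by rewrite tcons_head.
  exact/val_inj.
by rewrite lift_lift0 !tcons_tail.
Qed.

Lemma tconsE n (p : 'I_n.+1 -> T) : p = tcons (p ord0) (p \o lift ord0).
Proof.
apply/funext => i; case: (unliftP ord0 i) => [j|] ->; last by rewrite tcons_head.
by rewrite tcons_tail.
Qed.

Lemma deltaB n (u v : ('I_n -> T) -> F) (p : 'I_n.+1 -> T) :
  delta (fun q => u q - v q) p = delta u p - delta v p.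
Proof. by rewrite /delta -sumrB; apply: eq_bigr => i _; rewrite mulrBr. Qed.

Lemma deltaD n (u v : ('I_n -> T) -> F) (p : 'I_n.+1 -> T) :
  delta (fun q => u q + v q) p = delta u p + delta v p.
Proof. by rewrite /delta -big_split; apply: eq_bigr => i _; rewrite mulrDr. Qed.

Lemma eq_delta n (u v : ('I_n -> T) -> F) (p : 'I_n.+1 -> T) :
  (forall i, u (p \o lift i) = v (p \o lift i)) -> delta u p = delta v p.
Proof. by move=> uv; apply: eq_bigr => i _; rewrite uv. Qed.

Lemma delta0 n (p : 'I_n.+1 -> T) : delta (fun=> 0) p = 0.
Proof. by rewrite /delta big1// => i _; rewrite mulr0. Qed.

Lemma delta_nil (u : ('I_0 -> T) -> F) p : delta u p = u tnil.
Proof. by rewrite /delta big_ord1 expr0 mul1r; congr u; exact: tnil_unique. Qed.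

(** The boundary of a cone with apex b; the inductions on the length of a tuple rest on this
    formula. *)
Lemma delta_cons n (u : ('I_n.+1 -> T) -> F) b p :
  delta u (tcons b p) = u p - delta (fun q => u (tcons b q)) p.
Proof.
rewrite /delta big_ord_recl expr0 mul1r tcons_lift0 -sumrN; congr (_ + _).
by apply: eq_bigr => i _; rewrite tcons_liftS /= exprS mulN1r mulNr.
Qed.

(** All faces but the one opposite to b still contain b. *)
Lemma delta_cons_out n (u : ('I_n -> T) -> F) b p :
  (forall q i, q i = b -> u q = 0) -> delta u (tcons b p) = u p.
Proof.
case: n u p => [|n] u p ub; first by rewrite delta_nil; congr u; exact: tnil_unique.
rewrite delta_cons (eq_delta (v := fun=> 0)) ?delta0 ?subr0// => i.
by apply: (ub _ ord0); rewrite tcons_head.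
Qed.

Lemma delta_delta n (u : ('I_n -> T) -> F) (p : 'I_n.+2 -> T) : delta (delta u) p = 0.
Proof.
elim: n u p => [|n IHn] u p; rewrite (tconsE p) delta_cons.
  by rewrite [X in _ - X]delta_nil !delta_nil subrr.
rewrite [X in _ - X](_ : _ = delta u (p \o lift ord0)) ?subrr//.
transitivity (delta (fun q => u q - delta (fun q' => u (tcons (p ord0) q')) q)
    (p \o lift ord0)).
  by apply: eq_delta => i; rewrite delta_cons.
by rewrite deltaB IHn subr0.
Qed.

Section Subdivision.
Variable b : forall n, ('I_n.+1 -> T) -> T.

(* The cochain operators dual to subdivision of a simplex p by coning from
   the point b p, and to the chain homotopy from it to the identity. *)
Fixpoint sdiv n : (('I_n -> T) -> F) -> ('I_n -> T) -> F :=
  if n is n'.+1 then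
    fun u p => delta (@sdiv n' (fun q => u (tcons (b p) q))) p
  else fun u p => u p.

Fixpoint sdiv_htpy n : (('I_n.+1 -> T) -> F) -> ('I_n -> T) -> F :=
  if n is n'.+1 then
    fun u p => u (tcons (b p) p) -
      delta (@sdiv_htpy n' (fun q => u (tcons (b p) q))) p
  else fun _ _ => 0.

Lemma sdivS n (u : ('I_n.+1 -> T) -> F) p :
  sdiv u p = delta (sdiv (fun q => u (tcons (b p) q))) p.
Proof. by []. Qed.

Lemma sdiv_htpyS n (u : ('I_n.+2 -> T) -> F) (p : 'I_n.+1 -> T) :
  sdiv_htpy u p =
  u (tcons (b p) p) - delta (sdiv_htpy (fun q => u (tcons (b p) q))) p.
Proof. by []. Qed.

Lemma sdivB n (u v : ('I_n -> T) -> F) p :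
  sdiv (fun q => u q - v q) p = sdiv u p - sdiv v p.
Proof.
elim: n u v p => [//|n IHn] u v p; rewrite !sdivS -deltaB.
by apply: eq_delta => i; rewrite IHn.
Qed.

Lemma sdiv_htpyB n (u v : ('I_n.+1 -> T) -> F) p :
  sdiv_htpy (fun q => u q - v q) p = sdiv_htpy u p - sdiv_htpy v p.
Proof.
elim: n u v p => [|n IHn] u v p; first by rewrite /= subr0.
rewrite !sdiv_htpyS.
have -> : delta (sdiv_htpy (fun q => u (tcons (b p) q) - v (tcons (b p) q))) p =
    delta (sdiv_htpy (fun q => u (tcons (b p) q))) p -
    delta (sdiv_htpy (fun q => v (tcons (b p) q))) p.
  by rewrite -deltaB; apply: eq_delta => i; exact: IHn.
ring.
Qed.

Lemma sdiv_delta n (u : ('I_n -> T) -> F) (p : 'I_n.+1 -> T) :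
  sdiv (delta u) p = delta (sdiv u) p.
Proof.
elim: n u p => [|n IHn] u p; rewrite sdivS.
  by apply: eq_delta => i; rewrite /= delta_nil; congr u; exact: tnil_unique.
transitivity (delta (fun q => sdiv u q -
    delta (sdiv (fun q' => u (tcons (b p) q'))) q) p); last first.
  by rewrite deltaB delta_delta subr0.
apply: eq_delta => i; rewrite -IHn -sdivB.
by congr (sdiv _ _); apply/funext => q; rewrite delta_cons.
Qed.

Lemma sdiv_htpyP n (u : ('I_n.+1 -> T) -> F) (p : 'I_n.+1 -> T) :
  delta (sdiv_htpy u) p + sdiv_htpy (delta u) p = u p - sdiv u p.
Proof.
elim: n u p => [|n IHn] u p; rewrite (sdiv_htpyS (delta u)) delta_cons.
  by rewrite !delta0 subr0 add0r.
pose ub q := u (tcons (b p) q).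
have h q : sdiv_htpy (fun q' => delta u (tcons (b p) q')) q =
    sdiv_htpy u q - (ub q - sdiv ub q - delta (sdiv_htpy ub) q).
  rewrite -IHn [delta _ _ + _]addrC addrK -sdiv_htpyB.
  by congr (sdiv_htpy _ _); apply/funext => q'; rewrite delta_cons.
have -> : delta (sdiv_htpy (fun q => delta u (tcons (b p) q))) p =
    delta (sdiv_htpy u) p - (delta ub p - delta (sdiv ub) p - 0).
  rewrite -(delta_delta (sdiv_htpy ub) p) -!deltaB.
  by apply: eq_delta => i; exact: h.
rewrite (sdivS u) -/ub; ring.
Qed.

End Subdivision.

(** * Size of the simplices of a subdivision *)

Section Locality.
Variable b : forall n, ('I_n.+1 -> T) -> T.
Variables (near_r near_s : T -> T -> Prop) (M : nat).

(** The convex hull as seen by balls: a ball of radius s that contains p contains q. *)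
Definition in_hull m n (q : 'I_m -> T) (p : 'I_n -> T) :=
  forall x, (forall j, near_s x (p j)) -> forall i, near_s x (q i).

Hypothesis near_s_refl : forall x, near_s x x.
Hypothesis near_s_sym : forall x y, near_s x y -> near_s y x.
Hypothesis b_near : forall n (p : 'I_n.+1 -> T), (n < M)%N ->
  (forall i j, near_r (p i) (p j)) -> forall i, near_s (b p) (p i).
Hypothesis b_hull : forall n (p : 'I_n.+1 -> T), in_hull (fun _ : 'I_1 => b p) p.

(** The apex is near every vertex of p, hence near q, which lies in the hull of p. *)
Lemma near_tcons m n (p : 'I_n.+1 -> T) (q : 'I_m -> T) : (n < M)%N ->
  (forall i j, near_r (p i) (p j)) -> in_hull q p ->
  (forall i j, near_s (q i) (q j)) ->
  (forall i j, near_s (tcons (b p) q i) (tcons (b p) q j)) /\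
  in_hull (tcons (b p) q) p.
Proof.
move=> nM pr qp qs; have bq i : near_s (b p) (q i) by apply: qp; exact: b_near.
split=> [i j|x xp i].
  case: (unliftP ord0 i) => [k|] ->; case: (unliftP ord0 j) => [l|] ->;
    rewrite ?tcons_head ?tcons_tail//; exact: near_s_sym.
case: (unliftP ord0 i) => [k|] ->; rewrite ?tcons_head ?tcons_tail; last exact: (b_hull xp ord0).
exact: qp.
Qed.

Lemma in_hull_lift n (p : 'I_n.+1 -> T) m (q : 'I_m -> T) i :
  in_hull q (p \o lift i) -> in_hull q p.
Proof. by move=> qp x xp; apply: qp => j; exact: xp. Qed.

Lemma sdiv_local n (u : ('I_n -> T) -> F) (p : 'I_n -> T) : (n <= M)%N ->
  (forall i j, near_r (p i) (p j)) ->
  (forall q, (forall i j, near_s (q i) (q j)) -> in_hull q p -> u q = 0) ->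
  sdiv b u p = 0.
Proof.
elim: n u p => [|n IHn] u p nM pr u0; first by apply: u0 => [[]|x _ []].
rewrite sdivS (eq_delta (v := fun=> 0)) ?delta0// => i.
apply: IHn => [|j k|q qs qp]; [exact: ltnW|exact: pr|].
by have [? ?] := near_tcons nM pr (in_hull_lift qp) qs; exact: u0.
Qed.

Lemma sdiv_htpy_local n (u : ('I_n.+1 -> T) -> F) (p : 'I_n -> T) : (n <= M)%N ->
  (forall i j, near_r (p i) (p j)) -> (forall i j, near_s (p i) (p j)) ->
  (forall q, (forall i j, near_s (q i) (q j)) -> in_hull q p -> u q = 0) ->
  sdiv_htpy b u p = 0.
Proof.
elim: n u p => [//|n IHn] u p nM pr ps u0.
rewrite sdiv_htpyS (eq_delta (v := fun=> 0)) ?delta0.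
  have [|? ?] := near_tcons (q := p) nM pr _ ps; first by move=> x.
  by rewrite subr0; exact: u0.
move=> i; apply: IHn => [|j k|j k|q qs qp]; [exact: ltnW|exact: pr|exact: ps|].
by have [? ?] := near_tcons nM pr (in_hull_lift qp) qs; exact: u0.
Qed.

End Locality.

(* The cochain operator dual to the triangulation of the prism on a and b by
   the simplices a_0, .., a_i, b_i, .., b_n. *)
Fixpoint prism n : (('I_n.+1 -> T) -> F) -> ('I_n -> T) -> ('I_n -> T) -> F :=
  if n is n'.+1 then
    fun u a b => u (tcons (a ord0) b) -
      @prism n' (fun q => u (tcons (a ord0) q)) (a \o lift ord0) (b \o lift ord0)
  else fun _ _ _ => 0.

Lemma prismS n (u : ('I_n.+2 -> T) -> F) (a b : 'I_n.+1 -> T) :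
  prism u a b = u (tcons (a ord0) b) -
    prism (fun q => u (tcons (a ord0) q)) (a \o lift ord0) (b \o lift ord0).
Proof. by []. Qed.

Lemma prismB n (u v : ('I_n.+1 -> T) -> F) a b :
  prism (fun q => u q - v q) a b = prism u a b - prism v a b.
Proof.
elim: n u v a b => [|n IHn] u v a b; first by rewrite /= subr0.
rewrite !prismS IHn; ring.
Qed.

Lemma prism_htpy n (u : ('I_n.+1 -> T) -> F) (a b : 'I_n.+1 -> T) :
  prism (delta u) a b +
    \sum_(i < n.+1) (-1) ^+ i * prism u (a \o lift i) (b \o lift i) = u b - u a.
Proof.
elim: n u a b => [|n IHn] u a b; rewrite prismS delta_cons.
  rewrite /= big_ord1 mulr0 delta_nil addr0 subr0; congr (_ - u _).
  by rewrite [RHS]tconsE; congr tcons; exact: tnil_unique.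
have cons_lift (p : 'I_n.+2 -> T) j :
    p \o lift (lift ord0 j) = tcons (p ord0) ((p \o lift ord0) \o lift j).
  by rewrite {1}(tconsE p) tcons_liftS.
pose u' q := u (tcons (a ord0) q).
pose a' := a \o lift ord0; pose b' := b \o lift ord0.
have -> : (fun q => delta u (tcons (a ord0) q)) = (fun q => u q - delta u' q).
  by apply/funext => q; rewrite delta_cons.
have {IHn}IH := IHn u' a' b'.
rewrite prismB big_ord_recl expr0 mul1r -/u' -/a' -/b'.
have -> : \sum_(i < n.+1) (-1) ^+ bump 0 i * prism u (a \o lift (lift ord0 i)) (b \o lift (lift ord0 i))
   = \sum_(i < n.+1) (-1) ^+ i * prism u' (a' \o lift i) (b' \o lift i)
     - delta (fun q => u' (tcons (b ord0) q)) b'.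
  rewrite /delta -sumrB; apply: eq_bigr => i _; rewrite !cons_lift prismS.
  rewrite tcons_head exprS /u'; have tl (x : T) (q : 'I_n -> T) := tcons_lift0 x q.
  rewrite !tl; ring.
have -> : delta u' b = u' b' - delta (fun q => u' (tcons (b ord0) q)) b'.
  by rewrite {1}(tconsE b) delta_cons.
have -> : u a = u' a' by rewrite /u' -tconsE.
rewrite -/u'; move: IH; set s := \sum_(i < _) _; set z := prism (delta u') _ _.
move=> IH; have -> : z = u' b' - u' a' - s by rewrite -IH addrK.
ring.
Qed.

End TupleCochains.

Section Naturality.
Variables (T T' : Type) (F : comNzRingType) (phi : T -> T').

Lemma comp_tcons n x (p : 'I_n -> T) : phi \o tcons x p = tcons (phi x) (phi \o p).
Proof.
apply/funext => i /=.
by case: (unliftP ord0 i) => [j|] ->; rewrite ?tcons_head ?tcons_tail.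
Qed.

Section Subdivision.
Variables (b : forall n, ('I_n.+1 -> T) -> T) (b' : forall n, ('I_n.+1 -> T') -> T').
Hypothesis b_nat : forall n (p : 'I_n.+1 -> T), phi (b p) = b' (phi \o p).

Lemma sdiv_nat n (u : ('I_n -> T') -> F) p :
  sdiv b' u (phi \o p) = sdiv b (fun q => u (phi \o q)) p.
Proof.
elim: n u p => [//|n IHn] u p; rewrite !sdivS; apply: eq_bigr => i _.
rewrite -[_ \o lift i]/(phi \o (p \o lift i)) IHn; congr (_ * sdiv _ _ _).
by apply/funext => q; rewrite comp_tcons b_nat.
Qed.

Lemma sdiv_htpy_nat n (u : ('I_n.+1 -> T') -> F) p :
  sdiv_htpy b' u (phi \o p) = sdiv_htpy b (fun q => u (phi \o q)) p.
Proof.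
elim: n u p => [//|n IHn] u p; rewrite !sdiv_htpyS comp_tcons b_nat.
congr (_ - _); apply: eq_bigr => i _.
rewrite -[_ \o lift i]/(phi \o (p \o lift i)) IHn; congr (_ * sdiv_htpy _ _ _).
by apply/funext => q; rewrite comp_tcons b_nat.
Qed.

End Subdivision.

Lemma prism_nat n (u : ('I_n.+1 -> T') -> F) a b :
  prism u (phi \o a) (phi \o b) = prism (fun q => u (phi \o q)) a b.
Proof.
elim: n u a b => [//|n IHn] u a b; rewrite !prismS comp_tcons.
congr (_ - _); rewrite -[(phi \o a) \o _]/(phi \o (a \o lift ord0)).
rewrite -[(phi \o b) \o _]/(phi \o (b \o lift ord0)) IHn.
by congr (prism _ _ _); apply/funext => q; rewrite comp_tcons.
Qed.

End Naturality.

(** * Tuples of comparable elements *)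

Section OrderedCochains.
Variables (F : fieldType) (d : Order.disp_t) (Gam : finBPOrderType d).
Hypothesis Gam_ranked : ranked Gam.
Local Notation nb := (nonbot Gam).
Variables (A : algType F) (AG : nat -> set A) (aug : A -> F) (comp : nat -> A -> A).
Hypothesis cg : connected_graded AG aug comp.
Variables (r : nb -> A) (lp : nb -> A -> A).
Local Notation S := (@below_by d Gam).
Hypothesis sd : strand_data aug comp r lp S.
Hypothesis r_free : forall x (c : F), c *: r x = 0 -> c = 0.
Hypothesis exact_layers : forall x k m v, comp m.+1 v = v ->
  layer r S x k * v = 0 -> layer_proj lp S x k.+1 v = v ->
  exists b, comp m b = b /\ v = layer r S x k.+1 * b.

Implicit Types (Q : pred nb) (x y z : nb).
Local Notation rank x := (rk (val x)).

HB.instance Definition _ z := GRing.isLinear.Build F A A *:%R (lp z) (proj_lin sd z).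
HB.instance Definition _ m := GRing.isLinear.Build F A A *:%R (comp m) (comp_lin cg m).

Lemma rank_gt0 x : (0 < rank x)%N.
Proof. by rewrite lt0n (rk_eq0 Gam_ranked) (valP x). Qed.

Definition under x : pred nb := fun y => (val y < val x)%O.

Definition lower Q := forall x y, Q x -> under x y -> Q y.

Lemma under_lower x : lower (under x).
Proof. by move=> y z; rewrite /under => yx zy; exact: lt_trans zy yx. Qed.

Lemma S1E x y : S x 1 y = under x y && ((rank y).+1 == rank x).
Proof. by rewrite /below_by S_1. Qed.

(** The basis of the ordered chain complex: neither distinctness nor increasing order is imposed, as
    tuples of heavy vertices have neither. *)
Record valid Q n (p : 'I_n -> nb) : Prop := Valid {
  valid_in : forall i, Q (p i);
  valid_cmp : forall i j, (val (p i) >=< val (p j))%O }.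

Lemma valid_sub Q m n (p : 'I_n -> nb) (f : 'I_m -> 'I_n) :
  valid Q p -> valid Q (p \o f).
Proof. by case=> pQ pc; split=> *; [exact: pQ|exact: pc]. Qed.

Lemma valid_nil Q (p : 'I_0 -> nb) : valid Q p.
Proof. by split=> -[]. Qed.

Lemma valid_cons Q x n (q : 'I_n -> nb) : lower Q -> Q x ->
  valid (under x) q -> valid Q (tcons x q).
Proof.
move=> lQ Qx [qx qc]; have h i : (val x >=< val (tcons x q i))%O.
  case: (unliftP ord0 i) => [j|] ->; last by rewrite tcons_head comparablexx.
  by rewrite tcons_tail comparable_sym; apply/le_comparable/ltW/qx.
split=> [i|i j].
  case: (unliftP ord0 i) => [k|] ->; last by rewrite tcons_head.
  by rewrite tcons_tail; exact: lQ (qx k).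
case: (unliftP ord0 i) => [k|] ->; last by rewrite tcons_head.
case: (unliftP ord0 j) => [l|] ->; last by rewrite tcons_head comparable_sym.
by rewrite !tcons_tail.
Qed.

Lemma valid_cons_le Q x n (q : 'I_n -> nb) : Q x ->
  valid Q q -> (forall i, val (q i) <= val x)%O -> valid Q (tcons x q).
Proof.
move=> Qx [qQ qc] qx; have h i : (val x >=< val (tcons x q i))%O.
  case: (unliftP ord0 i) => [j|] ->; last by rewrite tcons_head comparablexx.
  by rewrite tcons_tail comparable_sym; apply/le_comparable/qx.
split=> [i|i j].
  by case: (unliftP ord0 i) => [k|] ->; rewrite ?tcons_head ?tcons_tail.
case: (unliftP ord0 i) => [k|] ->; last by rewrite tcons_head.
case: (unliftP ord0 j) => [l|] ->; last by rewrite tcons_head comparable_sym.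
by rewrite !tcons_tail.
Qed.

(** * The map from cochains to the algebra *)

Fixpoint Psi Q n : (('I_n -> nb) -> F) -> A :=
  if n is n'.+1 then
    fun f => \sum_(y | Q y && (rank y == n'.+1)) r y * @Psi Q n' (fun q => f (tcons y q))
  else fun f => (f (@tnil nb))%:A.

Lemma PsiS Q n (f : ('I_n.+1 -> nb) -> F) :
  Psi Q f = \sum_(y | Q y && (rank y == n.+1)) r y * Psi Q (fun q => f (tcons y q)).
Proof. by []. Qed.

Definition dsum Q m : A := \sum_(y | Q y && (rank y == m)) r y.

Lemma PsiB Q n (f g : ('I_n -> nb) -> F) :
  Psi Q (fun p => f p - g p) = Psi Q f - Psi Q g.
Proof.
elim: n f g => [|n IHn] f g; first by rewrite /= scalerBl.
rewrite !PsiS -sumrB; apply: eq_bigr => y _.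
by rewrite IHn mulrBr.
Qed.

Lemma PsiP Q n c (f g : ('I_n -> nb) -> F) :
  Psi Q (fun p => c * f p + g p) = c *: Psi Q f + Psi Q g.
Proof.
elim: n f g => [|n IHn] f g; first by rewrite /= scalerDl scalerA.
rewrite !PsiS scaler_sumr -big_split; apply: eq_bigr => y _ /=.
by rewrite IHn mulrDr scalerAr.
Qed.

Lemma comp0_scalar (c : F) : comp 0 c%:A = c%:A.
Proof.
have := aug_scale cg c 1; rewrite (cg_aug1 cg) !mulr1 => h.
by rewrite (cg_comp0 cg) h.
Qed.

Lemma Psi_deg Q n (f : ('I_n -> nb) -> F) : comp n (Psi Q f) = Psi Q f.
Proof.
elim: n f => [|n IHn] f.
  exact: comp0_scalar.
rewrite PsiS linear_sum; apply: eq_bigr => y _ /=.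
by rewrite (comp_mul1 cg) ?IHn//; exact: (sd_deg1 sd).
Qed.

(** Multiplication by r_y kills every word that does not continue below y. *)
Lemma r_Psi_eq Q Q' y n (f : ('I_n -> nb) -> F) :
  (forall z, under y z -> Q z = Q' z) -> r y * Psi Q f = r y * Psi Q' f.
Proof.
elim: n y f => [//|n IHn] y f QQ'.
rewrite !PsiS !mulr_sumr big_mkcond [RHS]big_mkcond; apply: eq_bigr => z _ /=.
have [yz|yz] := boolP (S y 1 z); last first.
  by rewrite !mulrA (sd_rel0 sd yz) !mul0r !if_same.
move: yz; rewrite S1E => /andP[yz _]; rewrite (QQ' z yz).
by case: ifP => // _; rewrite (IHn z)// => t /(under_lower yz); exact: QQ'.
Qed.

Lemma eq_Psi Q n (f g : ('I_n -> nb) -> F) : lower Q ->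
  (forall p, valid Q p -> (forall i, (rank (p i) <= n)%N) -> f p = g p) ->
  Psi Q f = Psi Q g.
Proof.
elim: n Q f g => [|n IHn] Q f g lQ fg; first by rewrite /= fg//; [exact: valid_nil|case].
rewrite !PsiS; apply: eq_bigr => y /andP[Qy /eqP yn].
have Qu z : under y z -> Q z = under y z by move=> yz; rewrite (lQ y z).
rewrite (r_Psi_eq _ Qu) [RHS](r_Psi_eq _ Qu); congr (_ * _).
apply: IHn; first exact: under_lower.
move=> q vq qn; apply: fg; first exact: valid_cons.
move=> i; case: (unliftP ord0 i) => [j|] ->; last by rewrite tcons_head yn.
by rewrite tcons_tail leqW.
Qed.

Lemma Psi_eq0 Q n (f : ('I_n -> nb) -> F) : lower Q ->
  (forall p, valid Q p -> (forall i, (rank (p i) <= n)%N) -> f p = 0) -> Psi Q f = 0.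
Proof.
move=> lQ f0; rewrite (eq_Psi (g := fun p => f p - f p))// ?PsiB ?subrr// => p vp pn.
by rewrite subrr f0.
Qed.

Lemma r_dsum Q y n : lower Q -> Q y -> rank y = n.+1 -> r y * dsum Q n = 0.
Proof.
move=> lQ Qy yn; rewrite -(sd_relS sd y) /dsum !mulr_sumr big_mkcond [RHS]big_mkcond.
apply: eq_bigr => z _; rewrite S1E yn eqSS.
have [yz|nyz] := boolP (under y z); first by rewrite (lQ y z).
by case: ifP => // _; rewrite (sd_rel0 sd)// S1E (negPf nyz).
Qed.

(** By the cone formula, omitting the first entry y gives the product with the sum of the
    generators. The other faces assemble to r_y times a multiple of [dsum], which the sum relation
    of y annihilates. *)
Lemma Psi_delta Q n (f : ('I_n -> nb) -> F) : lower Q ->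
  Psi Q (delta f) = dsum Q n.+1 * Psi Q f.
Proof.
move=> lQ; elim: n f => [|n IHn] f; rewrite PsiS /dsum mulr_suml;
    apply: eq_bigr => y /andP[Qy /eqP yn].
  by rewrite /= delta_nil.
rewrite (eq_Psi (g := fun q => f q - delta (fun q' => f (tcons y q')) q))//.
  by rewrite PsiB mulrBr IHn mulrA r_dsum// mul0r subr0.
by move=> p _ _; rewrite delta_cons.
Qed.

Lemma lp_sum (P : pred nb) (a : nb -> A) y :
  lp y (\sum_(z | P z) r z * a z) = if P y then r y * a y else 0.
Proof.
rewrite linear_sum big_mkcond (bigD1 y)//= (sd_proj_rM sd) eqxx big1 ?addr0// => z zy.
by rewrite (sd_proj_rM sd) (negPf zy) if_same.
Qed.

Definition in_layer Q n (w : A) :=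
  comp n w = w /\ \sum_(y | Q y && (rank y == n)) lp y w = w.

Lemma sum_in_layer Q n (a : nb -> A) : (forall y, comp n (a y) = a y) ->
  in_layer Q n.+1 (\sum_(y | Q y && (rank y == n.+1)) r y * a y).
Proof.
move=> ha; split; last by apply: eq_bigr => y yn; rewrite lp_sum yn.
by rewrite linear_sum; apply: eq_bigr => y _; rewrite /= (comp_mul1 cg) ?ha//; exact: (sd_deg1 sd).
Qed.

Lemma Psi_in_layer Q n (f : ('I_n.+1 -> nb) -> F) : in_layer Q n.+1 (Psi Q f).
Proof. by rewrite PsiS; apply: sum_in_layer => y; exact: Psi_deg. Qed.

Lemma sum_r_layer n (a : nb -> A) w :
  w = \sum_(y | rank y == n.+1) r y * a y -> (\sum_x r x) * w = dsum predT n.+2 * w.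
Proof.
move=> ->; rewrite /dsum !mulr_suml [RHS]big_mkcond; apply: eq_bigr => x _ /=.
case: ifPn => // xn; rewrite mulr_sumr big1// => y /eqP yn.
rewrite mulrA (sd_rel0 sd) ?mul0r// S1E negb_and; apply/orP; right.
by rewrite yn eq_sym.
Qed.

Lemma in_layerB Q n v w : in_layer Q n v -> in_layer Q n w -> in_layer Q n (v - w).
Proof.
move=> [v1 v2] [w1 w2]; split; first by rewrite raddfB /= v1 w1.
by rewrite -[in RHS]v2 -[in RHS]w2 -sumrB; apply: eq_bigr => y _; rewrite raddfB.
Qed.

Lemma lp_ex n y u : comp n.+1 u = u ->
  exists v, comp n v = v /\ lp y u = r y * v.
Proof.
move=> hu; have [v pv] := sd_proj_ex sd y u; exists (comp n v).
rewrite (cg_comp_comp cg) eqxx; split=> //.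
rewrite -(comp_mul1 cg) ?(sd_deg1 sd)// -pv (comp_proj cg sd) ?hu//.
exact: (aug_deg cg (isT : n.+1 != 0%N) hu).
Qed.

Lemma in_layer_proj Q n u : comp n.+1 u = u ->
  in_layer Q n.+1 (\sum_(y | Q y && (rank y == n.+1)) lp y u).
Proof.
move=> hu; have u0 : aug u = 0 by exact: (aug_deg cg (isT : n.+1 != 0%N) hu).
split.
  by rewrite linear_sum; apply: eq_bigr => y _ /=; rewrite (comp_proj cg sd)// hu.
have [v hv] := choice (fun y => lp_ex y hu).
have -> : \sum_(y | Q y && (rank y == n.+1)) lp y u =
    \sum_(y | Q y && (rank y == n.+1)) r y * v y.
  by apply: eq_bigr => y _; rewrite (hv y).2.
by apply: eq_bigr => y yn; rewrite lp_sum yn.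
Qed.

Lemma r_sum_lp y u (P : pred nb) : aug u = 0 -> (forall z, S y 1 z -> P z) ->
  r y * u = r y * \sum_(z | P z) lp z u.
Proof.
move=> u0 yP; rewrite {1}[u](sd_proj_sum sd)// !mulr_sumr [RHS]big_mkcond.
apply: eq_bigr => z _; case: ifPn => // /negP Pz.
have [w ->] := sd_proj_ex sd z u.
by rewrite mulrA (sd_rel0 sd) ?mul0r//; apply/negP => /yP.
Qed.

Definition cocycle_on Q n (f : ('I_n -> nb) -> F) :=
  forall p : 'I_n.+1 -> nb, valid Q p -> delta f p = 0.

(* The complex of all tuples is acyclic, so that [g] is a coboundary. *)
Definition bounds_on Q n (f : ('I_n -> nb) -> F) :=
  exists g : ('I_n -> nb) -> F,
    (forall p : 'I_n.+1 -> nb, delta g p = 0) /\ forall p, valid Q p -> f p = g p.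

(** Since n counts vertices and n = 0 is allowed, this is about the reduced cohomology of the
    elements below x. Chains there have at most [rank x] - 1 elements, and in that top degree r_x
    [Psi] f is the obstruction. *)
Definition Acyclic x := forall n (f : ('I_n -> nb) -> F), cocycle_on (under x) f ->
  (n.+1 = rank x -> r x * Psi (under x) f = 0) -> bounds_on (under x) f.

(** The counterpart in the top degree: each value r_x v there comes from a cocycle. *)
Definition Represented x := forall v, comp (rank x).-1 v = v ->
  exists h : ('I_(rank x).-1 -> nb) -> F,
    cocycle_on (under x) h /\ r x * v = r x * Psi (under x) h.

(** * Gluing over a lower set, one rank at a time *)

Section LowerSet.
Variable Q : pred nb.
Hypotheses (lQ : lower Q) (acQ : forall x, Q x -> Acyclic x)
  (repQ : forall x, Q x -> Represented x).

(** Cochains are filtered by the largest rank of an entry. *)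
Definition vanishes_below n m (f : ('I_n -> nb) -> F) :=
  forall p, valid Q p -> (forall i, (rank (p i) < m)%N) -> f p = 0.

Lemma top_unique n (p : 'I_n -> nb) m i : valid Q p ->
  (forall j, (rank (p j) <= m)%N) -> rank (p i) = m ->
  forall j, (val (p j) <= val (p i))%O /\ (rank (p j) = m -> p j = p i).
Proof.
move=> vp pm im j; have /orP[ij|ji] := valid_cmp vp i j; last first.
  by split=> // jm; apply/val_inj/(rk_le_eq Gam_ranked) => //; rewrite jm im.
have e : val (p i) = val (p j).
  apply: (rk_le_eq Gam_ranked) => //; apply/eqP; rewrite eqn_leq im pm andbT.
  by rewrite -im (rk_le Gam_ranked).
by split=> [|_]; [rewrite e|exact/val_inj].
Qed.

(** Glues one cochain for each x of rank m. On a valid tuple with ranks at most m, all entries of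
    rank m coincide, so the choice of i is immaterial. *)
Definition at_top m n (H : nb -> ('I_n -> nb) -> F) (p : 'I_n -> nb) : F :=
  if [pick i | rank (p i) == m] is Some i then H (p i) p else 0.

Lemma at_top_low m n (H : nb -> ('I_n -> nb) -> F) p :
  (forall i, (rank (p i) < m)%N) -> at_top m H p = 0.
Proof.
move=> pm; rewrite /at_top; case: pickP => // i /eqP im.
by have := pm i; rewrite im ltnn.
Qed.

Lemma delta_at_top m n (H : nb -> ('I_n -> nb) -> F) (p : 'I_n.+1 -> nb) i :
  valid Q p -> (forall j, (rank (p j) <= m)%N) -> rank (p i) = m ->
  (forall q, valid (under (p i)) q -> H (p i) q = 0) ->
  delta (at_top m H) p = delta (H (p i)) p.
Proof.
move=> vp pm im Hlow; apply: eq_delta => k; have top := top_unique vp pm im.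
rewrite /at_top; case: pickP => [j /eqP jm|none].
  by rewrite /= (top (lift k j)).2.
rewrite Hlow//; have := valid_sub (lift k) vp; case=> _ cmp; split=> // j.
have [le eqm] := top (lift k j); rewrite /under lt_neqAle /= le andbT.
by apply/eqP => /val_inj e; have := none j; rewrite /= e im eqxx.
Qed.

Lemma at_top_cons m n (H : nb -> ('I_n.+1 -> nb) -> F) x (q : 'I_n -> nb) :
  Q x -> rank x = m -> valid (under x) q -> at_top m H (tcons x q) = H x (tcons x q).
Proof.
move=> Qx xm vq; have vp := valid_cons lQ Qx vq.
have pm j : (rank (tcons x q j) <= m)%N.
  case: (unliftP ord0 j) => [k|] ->; last by rewrite tcons_head xm.
  by rewrite tcons_tail -xm (rk_le Gam_ranked)//; apply/ltW/(valid_in vq).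
have top := @top_unique _ _ m ord0 vp pm; rewrite tcons_head in top.
rewrite /at_top; case: pickP => [i /eqP im|/(_ ord0)]; first by rewrite (top xm i).2.
by rewrite tcons_head xm eqxx.
Qed.

(** Represent the part of w that starts with y by a cocycle h below y, extend h by zero, and take
    its coboundary on the tuples with top y. At (y, q) this is h(q), and a coboundary is closed. *)
Lemma layer_lift n w : in_layer Q n.+1 w ->
  exists f : ('I_n.+1 -> nb) -> F, [/\ Psi Q f = w, vanishes_below n.+1 f
    & forall p : 'I_n.+2 -> nb, valid Q p ->
        (forall i, (rank (p i) <= n.+1)%N) -> delta f p = 0].
Proof.
move=> [hw wQ].
have ex y : exists h : ('I_n -> nb) -> F, Q y && (rank y == n.+1) ->
    cocycle_on (under y) h /\ lp y w = r y * Psi (under y) h.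
  have [/andP[Qy /eqP yn]|_] := boolP (Q y && (rank y == n.+1)); last by exists (fun=> 0).
  have [v [hv ->]] := lp_ex y hw.
  have := repQ Qy; rewrite /Represented yn => /(_ v hv)[h hh].
  by exists h.
have [h hh] := choice ex.
pose hx y (q : 'I_n -> nb) := if [forall i, under y (q i)] then h y q else 0.
have hx_under y q : valid (under y) q -> hx y q = h y q.
  by move=> vq; rewrite /hx; case: ifPn => // /forallPn[i]; rewrite (valid_in vq).
have hx_coc y p : Q y -> rank y = n.+1 -> valid (under y) p -> delta (hx y) p = 0.
  move=> Qy yn vp; have [|coc _] := hh y; first by rewrite Qy yn eqxx.
  by rewrite -(coc p vp); apply: eq_delta => i; apply/hx_under/valid_sub.
exists (at_top n.+1 (fun y => delta (hx y))); split.
- rewrite PsiS -wQ; apply: eq_bigr => y yP; have [coc ->] := hh y yP.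
  have /andP[Qy /eqP yn] := yP.
  rewrite (@r_Psi_eq Q (under y)) => [|z yz]; last by rewrite yz (lQ Qy yz).
  congr (_ * _); apply: eq_Psi; first exact: under_lower.
  move=> q vq _; rewrite at_top_cons//.
  rewrite delta_cons_out ?hx_under// => q' i e.
  by rewrite /hx; case: ifP => // /forallP/(_ i); rewrite e /under ltxx.
- by move=> p _; exact: at_top_low.
move=> p vp pn.
have [i /eqP ipn|none] := pickP (fun i => rank (p i) == n.+1).
  rewrite (delta_at_top vp pn ipn) ?delta_delta// => q vq.
  by apply: hx_coc => //; exact: (valid_in vp).
rewrite -(delta0 _ p); apply: eq_delta => i; apply: at_top_low => j.
by rewrite ltn_neqAle pn none.
Qed.

(** For x of rank m, e(x, q) is a cocycle in q below x because e vanishes there, and acyclicity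
    extends it to a closed g. By the cone formula, e(x, p) - g(p) has coboundary e(p) on tuples with
    top x. An obstruction occurs for m = n+1 only. *)
Lemma kill_rank n m (e : ('I_n.+1 -> nb) -> F) : cocycle_on Q e ->
  vanishes_below m e -> (m = n.+1 -> Psi Q e = 0) ->
  exists h : ('I_n -> nb) -> F, vanishes_below m h /\
    vanishes_below m.+1 (fun p => e p - delta h p).
Proof.
move=> coc low Psi0.
have ex x : exists g : ('I_n -> nb) -> F, Q x && (rank x == m) ->
    (forall p : 'I_n.+1 -> nb, delta g p = 0) /\
    forall q, valid (under x) q -> e (tcons x q) = g q.
  have [/andP[Qx /eqP xm]|_] := boolP (Q x && (rank x == m)); last by exists (fun=> 0).
  have [||g hg] := @acQ x Qx n (fun q => e (tcons x q)); last by exists g.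
    move=> q vq; have := coc _ (valid_cons lQ Qx vq); rewrite delta_cons.
    have -> : e q = 0.
      apply: low; first by case: vq => qx qc; split=> // i; exact: lQ (qx i).
      by move=> i; rewrite -xm (rk_lt Gam_ranked)//; exact: (valid_in vq).
    by rewrite sub0r => /eqP; rewrite oppr_eq0 => /eqP.
  move=> nx; have := congr1 (lp x) (Psi0 _); rewrite raddf0 PsiS lp_sum Qx /=.
  rewrite -nx eqxx => <-; last by rewrite -xm -nx.
  by apply: r_Psi_eq => z xz; rewrite xz (lQ Qx xz).
have [g hg] := choice ex.
pose H x (p : 'I_n -> nb) := e (tcons x p) - g x p.
exists (at_top m H); split; first by move=> p _; exact: at_top_low.
move=> p vp pm.
have [i /eqP im|none] := pickP (fun i => rank (p i) == m); last first.
  have pm' i : (rank (p i) < m)%N by rewrite ltn_neqAle none /= -ltnS; exact: pm.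
  rewrite low// (eq_delta (v := fun=> 0)) ?delta0 ?subr0// => i.
  by apply: at_top_low => j; exact: pm'.
have Qx := valid_in vp i; have [|gclosed gE] := hg (p i); first by rewrite Qx im eqxx.
rewrite (delta_at_top vp _ im)// => [|q vq]; last by rewrite /H gE// subrr.
rewrite /H deltaB gclosed subr0.
have := coc _ (valid_cons_le Qx vp (fun j => (top_unique vp (fun k => pm k) im j).1)).
by rewrite delta_cons.
Qed.

Lemma cocycle_subdelta n (e : ('I_n.+1 -> nb) -> F) (h : ('I_n -> nb) -> F) :
  cocycle_on Q e -> cocycle_on Q (fun p => e p - delta h p).
Proof. by move=> coc p vp; rewrite deltaB delta_delta subr0 coc. Qed.

Lemma vanishes_belowS n m m' (f : ('I_n -> nb) -> F) : (m <= m')%N ->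
  vanishes_below m' f -> vanishes_below m f.
Proof. by move=> mm low p vp pm; apply: low => // i; exact: leq_trans (pm i) mm. Qed.

(** The ranks to be treated, m to m+N-1, have to avoid the obstructed rank n+1. *)
Lemma kill_ranks n m N (e : ('I_n.+1 -> nb) -> F) : cocycle_on Q e ->
  vanishes_below m e -> (n.+1 < m)%N || (m + N <= n.+1)%N ->
  exists h : ('I_n -> nb) -> F, vanishes_below m h /\
    vanishes_below (m + N) (fun p => e p - delta h p).
Proof.
move=> coc low; elim: N => [|N IHN] mN.
  exists (fun=> 0); split=> [//|p vp pm]; rewrite delta0 subr0.
  by apply: low => // i; rewrite -[m]addn0.
have [|h [hlow elow]] := IHN.
  by case/orP: mN => [->//|mN]; rewrite (leq_trans _ mN) ?orbT// leq_add2l.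
have [|h' [h'low e'low]] := kill_rank (cocycle_subdelta h coc) elow.
  by move=> e1; exfalso; move: mN; rewrite addnS e1 ltnn orbF -e1 ltnNge leq_addr.
exists (fun p => h p + h' p); split=> [p vp pm|p vp pm].
  rewrite hlow// add0r; apply: (vanishes_belowS _ h'low vp pm).
  exact: leq_addr.
by rewrite deltaD opprD addrA e'low// => i; rewrite -addnS.
Qed.

Lemma Psi_vanishing n (f : ('I_n -> nb) -> F) :
  vanishes_below n.+1 f -> Psi Q f = 0.
Proof.
by move=> low; apply: Psi_eq0 => // p vp pn; exact: low.
Qed.

Lemma coboundary_above n (e : ('I_n.+1 -> nb) -> F) : cocycle_on Q e ->
  vanishes_below n.+1 e -> Psi Q e = 0 ->
  exists g : ('I_n -> nb) -> F, vanishes_below n.+1 g /\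
    forall p, valid Q p -> e p = delta g p.
Proof.
move=> coc low Psi0.
have [//|h [hlow elow]] := kill_rank coc low.
pose N := \max_(x : nb) rank x.
have [|h' [h'low e'low]] := @kill_ranks n n.+2 N _ (cocycle_subdelta h coc) elow.
  by rewrite leqnn.
exists (fun p => h p + h' p); split=> [p vp pm|p vp].
  by rewrite hlow// add0r; apply: (vanishes_belowS _ h'low vp pm).
apply/eqP; rewrite -subr_eq0 deltaD opprD addrA e'low// => i.
have : (rank (p i) <= N)%N by exact: (@leq_bigmax_cond _ _ (fun x : nb => rank x)).
by move=> /leq_trans h0; rewrite !addSn ltnS leqW// h0// leq_addl.
Qed.

(** A cochain h removes the ranks up to n. The rest has image [dsum] times w - [Psi] h; subtracting
    the coboundary of a lift of w - [Psi] h removes the obstruction at rank n+1, and the higher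
    ranks are unobstructed. *)
Lemma coboundary_of_Psi n (e : ('I_n.+1 -> nb) -> F) w : cocycle_on Q e ->
  (if n is 0 then w = 0 else in_layer Q n w) -> Psi Q e = dsum Q n.+1 * w ->
  exists g : ('I_n -> nb) -> F, (n = 0%N -> forall p, g p = 0) /\
    forall p, valid Q p -> e p = delta g p.
Proof.
case: n e => [|n] e coc hw eE.
  have [||g [glow gE]] := coboundary_above coc; last first.
    by exists g; split=> // _ p; apply: glow; [exact: valid_nil|case].
    by rewrite eE hw mulr0.
  by move=> p vp /(_ ord0); rewrite ltnS leqNgt rank_gt0.
have [||h [_ elow]] := @kill_ranks n.+1 0 n.+2 e coc.
- by move=> p _ /(_ ord0).
- by rewrite add0n leqnn orbT.
have hw' := in_layerB hw (Psi_in_layer Q h).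
have [f [fE flow fcoc]] := layer_lift hw'.
have coc' := cocycle_subdelta f (cocycle_subdelta h coc).
have [||g [_ gE]] := coboundary_above coc'.
- move=> p vp pm; rewrite elow// fcoc ?subr0// => i; exact: pm.
- by rewrite !PsiB !Psi_delta// eE fE -!mulrBr opprB addrA subrK subrr mulr0.
exists (fun p => h p + f p + g p); split=> // p vp.
rewrite !deltaD -gE//; ring.
Qed.

(** A lift of v is closed on tuples of ranks at most n+1, and [Psi] kills its coboundary. So this is
    the coboundary of some g that vanishes on such tuples, and subtracting g leaves [Psi]
    unchanged. *)
Lemma cocycle_of_layer n v : in_layer Q n.+1 v -> dsum Q n.+2 * v = 0 ->
  exists f : ('I_n.+1 -> nb) -> F, cocycle_on Q f /\ Psi Q f = v.
Proof.
move=> hv dv; have [f [fE flow fcoc]] := layer_lift hv.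
have coc : cocycle_on Q (delta f) by move=> p _; rewrite delta_delta.
have [||g [glow gE]] := coboundary_above coc.
- by move=> p vp pm; apply: fcoc => // i; exact: pm.
- by rewrite Psi_delta// fE.
exists (fun p => f p - g p); split=> [p vp|]; first by rewrite deltaB gE ?subrr.
by rewrite PsiB fE Psi_vanishing ?subr0.
Qed.

End LowerSet.

(** * Induction on the rank *)

Lemma under_rank x y : under x y -> (rank y < rank x)%N.
Proof. exact: (rk_lt Gam_ranked). Qed.

Lemma dsum_under_high x n : (rank x <= n)%N -> dsum (under x) n = 0.
Proof.
move=> xn; rewrite /dsum big1// => y /andP[/under_rank yx /eqP yn].
by move: yx; rewrite yn ltnNge xn.
Qed.

Lemma layer_index x k n : (n + k.+1 = rank x)%N ->
  S x k.+1 =1 (fun y => under x y && (rank y == n)).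
Proof.
move=> nk y; rewrite /below_by; apply/S_P/andP => [[yx yk]|[yx /eqP yn]].
  rewrite /under lt_neqAle yx andbT; split.
    apply/eqP => e; move/eqP: yk; rewrite e -[eqbRHS]addn0 eqn_add2l//.
  by rewrite -(eqn_add2r k.+1) yk nk.
by rewrite yn nk ltW.
Qed.

(** The elements of rank n+1 below x form S_x(k+1) with k = [rank x] - n - 2. That the sum over
    S_x(k) kills [Psi] f is the cocycle condition if k > 0, and the second hypothesis if k = 0,
    where the layer is x alone. *)
Lemma layer_exact_Psi x n (f : ('I_n.+1 -> nb) -> F) : cocycle_on (under x) f ->
  (n.+2 = rank x -> r x * Psi (under x) f = 0) ->
  exists b, comp n b = b /\ Psi (under x) f = dsum (under x) n.+1 * b.
Proof.
move=> coc Psi0; have lQ := @under_lower x.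
have [xn|nx] := leqP (rank x) n.+1.
  exists 0; split; first exact: raddf0.
  rewrite mulr0 PsiS big1// => y /andP[/under_rank yx /eqP yn].
  by move: yx; rewrite yn ltnNge xn.
pose k := (rank x - n.+2)%N.
have nk : (n.+1 + k.+1 = rank x)%N by rewrite addnS -addSn subnKC.
have [|||b [hb fb]] := @exact_layers x k n (Psi (under x) f).
- exact: Psi_deg.
- case: k nk => [|k] nk.
    by rewrite (layer0 sd) Psi0// -nk addn1.
  have nk' : (n.+2 + k.+1 = rank x)%N by rewrite -nk [RHS]addnS -addSn.
  rewrite /layer (eq_bigl _ _ (layer_index nk')) -[X in X * _]/(dsum (under x) n.+2).
  by rewrite -Psi_delta//; apply: Psi_eq0 => // p vp _; exact: coc.
- rewrite /layer_proj (eq_bigl _ _ (layer_index nk)).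
  exact: (Psi_in_layer (under x) f).2.
exists b; split=> //; rewrite {1}fb; congr (_ * _).
by rewrite /layer (eq_bigl _ _ (layer_index nk)).
Qed.

(** The elements below x form a lower set whose members are settled by induction. Layer exactness
    supplies the equation [Psi] f = [dsum] b from which [coboundary_of_Psi] starts. *)
Lemma acyclic_represented x : Acyclic x /\ Represented x.
Proof.
have [N] := ubnP (rank x); elim: N x => // N IHN x; rewrite ltnS => xN.
have lQ := @under_lower x.
have IH y : under x y -> Acyclic y /\ Represented y.
  by move=> /under_rank yx; apply: IHN; exact: leq_trans yx xN.
have acQ y : under x y -> Acyclic y by move=> /IH[].
have repQ y : under x y -> Represented y by move=> /IH[].
split=> [n f coc Psi0|].
  case: n f coc Psi0 => [|n] f coc Psi0.
    exists (fun=> 0); split=> [p|p _]; first exact: delta0.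
    (* On the empty tuple f is a scalar. It is zero because r_x is nonzero if x is an atom, and by
       the cocycle condition at some y below x otherwise. *)
    have [x1|x1] := eqVneq (rank x) 1%N.
      apply: (r_free (x := x)); rewrite -mulr_algr (tnil_unique p (@tnil nb)).
      exact: Psi0.
    have [|y [y0 yx ry]] := @cover_ex _ _ Gam_ranked (val x) \bot%O.
      by rewrite lt0x (valP x).
    have ny : y != \bot%O by rewrite -(rk_eq0 Gam_ranked) ry.
    have xy : under x (Sub y ny).
      rewrite /under /= lt_neqAle yx andbT; apply/eqP => e; move: ry x1.
      by rewrite -[\val x]e (rk_bot Gam_ranked) => ->.
    have := coc (fun=> Sub y ny); rewrite delta_nil => <-; first by congr f; exact: tnil_unique.
    by split=> // i j; exact: comparablexx.
  have [b [hb fb]] := layer_exact_Psi coc Psi0.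
  case: n f coc Psi0 hb fb => [|n] f coc Psi0 hb fb.
    (* Here b is a scalar; the constant cochain with this value is the coboundary of a cochain on
       the empty tuple. *)
    pose c (p : 'I_0 -> nb) := aug b.
    have coc' := cocycle_subdelta c coc.
    have [|g [_ gE]] := @coboundary_of_Psi (under x) lQ acQ repQ 0 _ 0 coc' erefl.
      by rewrite PsiB Psi_delta// fb /= -(cg_comp0 cg) hb subrr mulr0.
    exists (fun p => delta c p + delta g p); split=> [p|p vp].
      by rewrite deltaD !delta_delta addr0.
    by rewrite -gE// addrC subrK.
  pose w := \sum_(z | under x z && (rank z == n.+1)) lp z b.
  have hw : in_layer (under x) n.+1 w by exact: in_layer_proj.
  have [|g [_ gE]] := @coboundary_of_Psi (under x) lQ acQ repQ n.+1 _ w coc hw.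
    rewrite fb /dsum !mulr_suml; apply: eq_bigr => y /andP[xy /eqP yn].
    apply: r_sum_lp; first exact: (aug_deg cg (isT : n.+1 != 0%N) hb).
    by move=> z; rewrite S1E yn eqSS => /andP[yz ->]; rewrite (lQ y z).
  by exists (delta g); split=> // p; exact: delta_delta.
suff rep m : rank x = m.+1 -> forall v, comp m v = v ->
    exists h : ('I_m -> nb) -> F,
      cocycle_on (under x) h /\ r x * v = r x * Psi (under x) h.
  by apply: rep; rewrite prednK ?rank_gt0.
case: m => [|m] xm v hv.
  exists (fun=> aug v); split=> [p vp|]; last by rewrite /= -(cg_comp0 cg) hv.
  by have := under_rank (valid_in vp ord0); rewrite xm ltnS leqNgt rank_gt0.
pose w := \sum_(z | under x z && (rank z == m.+1)) lp z v.
have hw : in_layer (under x) m.+1 w by exact: in_layer_proj.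
have [|h [coc hE]] := @cocycle_of_layer (under x) lQ acQ repQ m w hw.
  by rewrite dsum_under_high ?mul0r// xm.
exists h; split=> //; rewrite hE.
apply: r_sum_lp; first exact: (aug_deg cg (isT : m.+1 != 0%N) hv).
by move=> z; rewrite S1E xm eqSS => /andP[-> ->].
Qed.

(** Now Q is the whole poset. The clauses for n = 0 exclude the augmentation, since the cohomology
    of Y is not reduced. *)
Lemma cocycle_class_inj n (e : ('I_n.+1 -> nb) -> F) w : cocycle_on predT e ->
  (if n is 0 then w = 0 else in_layer predT n w) ->
  Psi predT e = dsum predT n.+1 * w ->
  exists g : ('I_n -> nb) -> F, (n = 0%N -> forall p, g p = 0) /\
    forall p, valid predT p -> e p = delta g p.
Proof.
apply: coboundary_of_Psi => // x _; [exact: (acyclic_represented x).1|].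
exact: (acyclic_represented x).2.
Qed.

Lemma cocycle_class_surj n v : in_layer predT n.+1 v -> dsum predT n.+2 * v = 0 ->
  exists f : ('I_n.+1 -> nb) -> F, cocycle_on predT f /\ Psi predT f = v.
Proof.
apply: cocycle_of_layer => // x _; [exact: (acyclic_represented x).1|].
exact: (acyclic_represented x).2.
Qed.

End OrderedCochains.

(** * Singular cochains of the order complex *)

Lemma compact_set_type (X : topologicalType) (A : set X) :
  compact A -> compact [set: A].
Proof.
move=> cA G FG _; have FvG : ProperFilter (set_val @ G) by exact: fmap_proper_filter.
have vGA : (set_val @ G) A.
  by rewrite /fmap /=; apply: (filterS _ filterT) => x _; exact: set_valP.
have [p [Ap clp]] := cA _ FvG vGA.
exists (SigSub (mem_set Ap)); split=> // B C GB /= [D [oD Dp DC]].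
case: oD Dp DC => E oE <- Ep EC.
have vB : (set_val @ G) (set_val @` B).
  by rewrite /fmap /=; apply: filterS GB => y By; exists y.
have [x [[y By <-] Ey]] := clp _ E vB (open_nbhs_nbhs (conj oE Ep)).
by exists y; split=> //; exact: EC.
Qed.

(** * Standard simplices: compactness, affine maps, barycenters *)

Section Realization.
Variable (R : realType).

Definition coord (V : finType) (K : {set {set V}}) (w : realization (R := R) K) (v : V) : R :=
  (set_val w : {ptws V -> R}) v.

Arguments coord {V K} w v.

Section Coordinates.
Variables (V : finType) (K : {set {set V}}).
Local Notation RK := (realization (R := R) K).
Implicit Types (w : RK).

Lemma coord_inj w w' : coord w =1 coord w' -> w = w'.
Proof. by move=> ww'; apply/val_inj/funext. Qed.

Lemma coord_ge0 w v : 0 <= coord w v.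
Proof. by have [h _ _] := set_valP w; exact: h. Qed.

Lemma coord_sum w : \sum_v coord w v = 1.
Proof. by have [_ h _] := set_valP w. Qed.

Lemma coord_le1 w v : coord w v <= 1.
Proof.
rewrite -(coord_sum w) (bigD1 v)//= lerDl.
by apply: sumr_ge0 => *; exact: coord_ge0.
Qed.

Lemma coord_continuous v : continuous (coord^~ v : RK -> R).
Proof.
move=> w; apply: (@continuous_comp _ _ _ (set_val : RK -> {ptws V -> R})
  (fun f : {ptws V -> R} => f v)); first exact: initial_continuous.
exact: (@proj_continuous V (fun=> R) v).
Qed.

Lemma realization_continuous (X : topologicalType) (g : X -> RK) :
  (forall v, continuous (fun x => coord (g x) v)) -> continuous g.
Proof.
by move=> cg; apply: continuous_comp_initial; apply: ptws_continuous => v; exact: cg.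
Qed.

End Coordinates.

Lemma continuous_sum (X : topologicalType) (I : finType) (P : pred I) (f : I -> X -> R) :
  (forall i, continuous (f i)) -> continuous (fun x => \sum_(i | P i) f i x).
Proof.
move=> cf x; apply: (@cvg_big R I +%R 0 _ _ _ (nbhs x) (index_enum I) f) => [|i _].
  exact: add_continuous.
exact: cf.
Qed.

Lemma std_simplex_compact n : compact (std_simplex R n).
Proof.
have c01 : compact [set w : {ptws 'I_n.+1 -> R} | forall v, `[0, 1]%classic (w v)].
  by apply: (@tychonoff 'I_n.+1 (fun=> R) (fun=> `[0, 1]%classic)) => i; exact: segment_compact.
apply: subclosed_compact c01 _; last first.
  move=> w [w0 w1 _] v; rewrite /= in_itv /= w0/= -w1 (bigD1 v)//= lerDl.
  by apply: sumr_ge0.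
have -> : std_simplex R n = [set w : {ptws 'I_n.+1 -> R} | forall v, 0 <= w v] `&`
    [set w | \sum_v w v = 1].
  by apply/seteqP; split=> w [w0 w1] //; split=> //; rewrite inE.
apply: closedI.
  rewrite (_ : [set _ | _] = \bigcap_(v in [set: 'I_n.+1]) [set w : {ptws 'I_n.+1 -> R} | 0 <= w v]); last first.
    by apply/seteqP; split=> w /= h v; [move=> _; exact: h|exact: h].
  apply: closed_bigI => v _.
  apply: (@preimage_closed _ _ (fun w : {ptws 'I_n.+1 -> R} => w v) [set x | 0 <= x]); last exact: closed_ge.
  by move=> w _; exact: (@proj_continuous 'I_n.+1 (fun=> R) v).
apply: (@preimage_closed _ _ (fun w : {ptws 'I_n.+1 -> R} => \sum_v w v) [set 1]); last exact: closed_eq.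
by move=> w _; apply: continuous_sum => v; exact: (@proj_continuous 'I_n.+1 (fun=> R) v).
Qed.

Definition near_by n (r : R) (x y : std_simplex R n) : Prop :=
  forall i, `|coord x i - coord y i| <= r.

(** On the compact set of pairs where f varies by at least e, the sum of the coordinate differences
    has a positive minimum. *)
Lemma std_simplex_unif_continuous n (f : std_simplex R n -> R) (e : R) :
  continuous f -> 0 < e ->
  exists2 r : R, 0 < r & forall x y, near_by r x y -> `|f x - f y| < e.
Proof.
move=> cf e0; pose X := std_simplex R n.
pose g (z : X * X) : R := \sum_i `|coord z.1 i - coord z.2 i|.
pose K := [set z : X * X | e <= `|f z.1 - f z.2|].
have cfst : continuous (fst : X * X -> X) by move=> z; exact: cvg_fst.
have csnd : continuous (snd : X * X -> X) by move=> z; exact: cvg_snd.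
have cdist (h : X -> R) : continuous h -> continuous (fun z : X * X => `|h z.1 - h z.2|).
  move=> ch z; apply: cvg_norm; apply: cvgB.
    by apply: (@continuous_comp _ _ _ fst h); [exact: cfst|exact: ch].
  by apply: (@continuous_comp _ _ _ snd h); [exact: csnd|exact: ch].
have cg : continuous g by apply: continuous_sum => i; exact: (cdist (coord^~ i) (@coord_continuous _ _ i)).
have cK : compact K.
  apply: (@subclosed_compact _ K [set: X * X]) => //.
    by apply: (@preimage_closed _ _ (fun z : X * X => `|f z.1 - f z.2|) [set x | e <= x]);
      [move=> z _; exact: cdist|exact: closed_ge].
  rewrite -setXTT; apply: compact_setX; apply: compact_set_type; exact: std_simplex_compact.
have [K0|K0] := pselect (K !=set0); last first.
  exists 1 => // x y _; rewrite ltNge; apply/negP => exy.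
  by apply: K0; exists (x, y).
have [|[c c'] /set_mem Kc gc] := derive.compact_EVT_min K0 cK (f := g).
  by apply: continuous_subspaceT.
have gc0 : 0 < g (c, c').
  rewrite lt_neqAle sumr_ge0 ?andbT// eq_sym; apply/eqP => /eqP.
  rewrite psumr_eq0// => /allP h; move: Kc; rewrite /K /= leNgt => /negP; apply.
  suff -> : c = c' by rewrite subrr normr0.
  apply: coord_inj => i; apply/eqP; rewrite -subr_eq0 -normr_eq0.
  by apply: h; rewrite mem_index_enum.
(* There are n+1 coordinates; dividing by n+2 makes the final inequality strict. *)
exists (g (c, c') / n.+2%:R); first by rewrite divr_gt0.
move=> x y xy; rewrite ltNge; apply/negP => exy.
have := gc (x, y) (mem_set exy); apply/negP; rewrite -ltNge.
apply: (@le_lt_trans _ _ (\sum_(i < n.+1) g (c, c') / n.+2%:R)).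
  by apply: ler_sum => i _; exact: xy.
rewrite sumr_const card_ord -[X in X < _]mulr_natr mulrAC ltr_pdivrMr// ltr_pM2l//.
by rewrite ltr_nat.
Qed.
Lemma sum_delta_coord (I : finType) (f : I -> R) i : \sum_j (j == i)%:R * f j = f i.
Proof.
rewrite (bigD1 i)//= eqxx mul1r big1 ?addr0// => j /negPf ji.
by rewrite ji mul0r.
Qed.

Lemma std_simplexP n (w : 'I_n.+1 -> R) :
  (forall i, 0 <= w i) -> \sum_i w i = 1 -> std_simplex R n w.
Proof. by move=> w0 w1; split=> //; rewrite inE. Qed.

Lemma affine_proof m n (p : 'I_m.+1 -> std_simplex R n) (t : std_simplex R m) :
  std_simplex R n (fun j => \sum_i coord t i * coord (p i) j).
Proof.
apply: std_simplexP => [j|].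
  by apply: sumr_ge0 => i _; apply: mulr_ge0; exact: coord_ge0.
rewrite exchange_big -[RHS](coord_sum t); apply: eq_bigr => i _.
by rewrite -mulr_sumr coord_sum mulr1.
Qed.

Definition affine m n (p : 'I_m.+1 -> std_simplex R n) (t : std_simplex R m) :
  std_simplex R n := SigSub (mem_set (affine_proof p t)).

Lemma coord_affine m n (p : 'I_m.+1 -> std_simplex R n) t j :
  coord (affine p t) j = \sum_i coord t i * coord (p i) j.
Proof. by []. Qed.

Lemma affine_continuous m n (p : 'I_m.+1 -> std_simplex R n) : continuous (affine p).
Proof.
apply: realization_continuous => j; apply: continuous_sum => i t.
exact: (continuousM (@coord_continuous _ _ i t) (@cst_continuous _ _ _ t)).
Qed.

HB.instance Definition _ m n (p : 'I_m.+1 -> std_simplex R n) :=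
  isContinuous.Build _ _ (affine p) (@affine_continuous m n p).

Lemma vertex_proof n (i : 'I_n.+1) : std_simplex R n (fun j => (j == i)%:R).
Proof.
apply: std_simplexP => [j|]; first exact: ler0n.
by rewrite (bigD1 i)//= eqxx big1 ?addr0// => j /negPf ->.
Qed.

Definition vertex n (i : 'I_n.+1) : std_simplex R n := SigSub (mem_set (vertex_proof i)).

Lemma coord_vertex n (i j : 'I_n.+1) : coord (vertex i) j = (j == i)%:R.
Proof. by []. Qed.

Lemma affine_vertex m n (p : 'I_m.+1 -> std_simplex R n) i : affine p (vertex i) = p i.
Proof.
apply: coord_inj => j; rewrite coord_affine.
by under eq_bigr do rewrite coord_vertex; rewrite sum_delta_coord.
Qed.

Lemma affine_id n (t : std_simplex R n) : affine (@vertex n) t = t.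
Proof.
apply: coord_inj => j; rewrite coord_affine.
under eq_bigr do rewrite coord_vertex eq_sym mulrC.
by rewrite sum_delta_coord.
Qed.

Lemma affine_comp k m n (p : 'I_m.+1 -> std_simplex R n) (q : 'I_k.+1 -> std_simplex R m) t :
  affine p (affine q t) = affine (affine p \o q) t.
Proof.
apply: coord_inj => j; rewrite !coord_affine.
under eq_bigr do rewrite coord_affine mulr_suml.
rewrite exchange_big; apply: eq_bigr => i _ /=.
by rewrite coord_affine mulr_sumr; apply: eq_bigr => l _; rewrite mulrA.
Qed.

Lemma coord_face n i (t : std_simplex R n) j :
  coord (face R n i t) j = \sum_(k | lift i k == j) coord t k.
Proof. by []. Qed.

Lemma face_affine n i (t : std_simplex R n) :
  face R n i t = affine (@vertex n.+1 \o lift i) t.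
Proof.
apply: coord_inj => j; rewrite coord_face coord_affine big_mkcond.
apply: eq_bigr => k _; rewrite coord_vertex eq_sym.
by case: eqP => _; rewrite ?mulr1 ?mulr0.
Qed.

Lemma face_vertex n i k : face R n i (vertex k) = vertex (lift i k).
Proof. by rewrite face_affine affine_vertex. Qed.

Lemma affine_face m n (p : 'I_m.+2 -> std_simplex R n) i t :
  affine p (face R m i t) = affine (p \o lift i) t.
Proof.
by rewrite face_affine affine_comp; congr affine; apply/funext => k /=; rewrite affine_vertex.
Qed.

Lemma barycenter_proof n : std_simplex R n (fun=> n.+1%:R^-1).
Proof.
apply: std_simplexP => [j|]; first by rewrite invr_ge0.
by rewrite sumr_const card_ord -[LHS]mulr_natr mulVf ?pnatr_eq0.
Qed.

Definition barycenter n (m : nat) (p : 'I_m.+1 -> std_simplex R n) : std_simplex R n :=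
  affine p (SigSub (mem_set (barycenter_proof m)) : std_simplex R m).

Lemma barycenter_nat k n m (f : 'I_n.+1 -> std_simplex R k) (p : 'I_m.+1 -> std_simplex R n) :
  affine f (barycenter p) = barycenter (affine f \o p).
Proof. exact: affine_comp. Qed.

Lemma near_by_affine m n (p : 'I_m.+1 -> std_simplex R n) t s x :
  (forall i, near_by s x (p i)) -> near_by s x (affine p t).
Proof.
move=> xp j; rewrite coord_affine -[coord x j]mul1r -(coord_sum t) mulr_suml -sumrB.
apply: le_trans (ler_norm_sum _ _ _) _.
rewrite -[s]mul1r -(coord_sum t) mulr_suml; apply: ler_sum => i _.
rewrite -mulrBr normrM ger0_norm ?coord_ge0//.
by apply: ler_wpM2l; [exact: coord_ge0|exact: xp].
Qed.

(** In the mean of the differences with [p i], the term of index i vanishes, which leaves m terms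
    out of m+1. *)
Lemma near_by_barycenter m n (p : 'I_m.+1 -> std_simplex R n) r :
  (forall i j, near_by r (p i) (p j)) ->
  forall i, near_by (m%:R / m.+1%:R * r) (barycenter p) (p i).
Proof.
move=> pr i j; rewrite /barycenter coord_affine.
have -> : \sum_(k < m.+1) m.+1%:R^-1 * coord (p k) j - coord (p i) j =
    m.+1%:R^-1 * \sum_(k < m.+1) (coord (p k) j - coord (p i) j).
  rewrite -mulr_sumr sumrB mulrBr; congr (_ - _).
  by rewrite sumr_const card_ord -[X in _ * X]mulr_natr mulrCA mulVf ?pnatr_eq0// mulr1.
rewrite normrM ger0_norm ?invr_ge0// mulrAC [X in _ <= X]mulrC.
apply: ler_wpM2l; first by rewrite invr_ge0.
rewrite (bigD1 i)//= subrr add0r; apply: le_trans (ler_norm_sum _ _ _) _.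
apply: (@le_trans _ _ (\sum_(k < m.+1 | k != i) r)).
  by apply: ler_sum => k _; exact: pr.
rewrite sumr_const -[X in X <= _]mulr_natl (_ : #|_| = m)//.
by rewrite cardC1 card_ord.
Qed.

Lemma near_by_sym n r (x y : std_simplex R n) : near_by r x y -> near_by r y x.
Proof. by move=> xy i; rewrite distrC. Qed.

Lemma near_by_refl n r (x : std_simplex R n) : 0 <= r -> near_by r x x.
Proof. by move=> r0 i; rewrite subrr normr0. Qed.

Lemma near_by1 n (x y : std_simplex R n) : near_by 1 x y.
Proof.
move=> i; rewrite ler_norml; have := coord_ge0 x i; have := coord_le1 x i.
have := coord_ge0 y i; have := coord_le1 y i; lra.
Qed.

Lemma near_by_le n r s (x y : std_simplex R n) : r <= s -> near_by r x y -> near_by s x y.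
Proof. by move=> rs xy i; exact: le_trans (xy i) rs. Qed.

(** * Reduction to small singular simplices *)

Section SmallSimplices.
Variables (F : fieldType) (X : topologicalType).
Local Notation simplex := (singular_simplex R X).
Local Notation cochain n := (simplex n -> F).

Definition subsimplex m n (s : simplex n) (p : 'I_m.+1 -> std_simplex R n) : simplex m :=
  s \o affine p : continuousType _ _.

Lemma subsimplex_comp k m n (s : simplex n) (p : 'I_m.+1 -> std_simplex R n)
    (q : 'I_k.+1 -> std_simplex R m) :
  subsimplex (subsimplex s p) q = subsimplex s (affine p \o q).
Proof. by apply/continuousEP => t; rewrite /= affine_comp. Qed.

Lemma subsimplex_id n (s : simplex n) : subsimplex s (@vertex n) = s.
Proof. by apply/continuousEP => t; rewrite /= affine_id. Qed.

Lemma subsimplex_face m n (s : simplex n) (p : 'I_m.+2 -> std_simplex R n) i :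
  (subsimplex s p \o face R m i : continuousType _ _) = subsimplex s (p \o lift i).
Proof. by apply/continuousEP => t; rewrite /= affine_face. Qed.

Lemma eq_singular_d n (u v : cochain n) (s : simplex n.+1) :
  (forall i, u (s \o face R n i : continuousType _ _) =
             v (s \o face R n i : continuousType _ _)) ->
  singular_d u s = singular_d v s.
Proof. by move=> uv; apply: eq_bigr => i _; rewrite uv. Qed.

Lemma delta_subsimplex m n (s : simplex n) (u : cochain m) (p : 'I_m.+2 -> std_simplex R n) :
  delta (fun q => u (subsimplex s q)) p = singular_d u (subsimplex s p).
Proof. by apply: eq_bigr => i _; rewrite subsimplex_face. Qed.

(** The subdivision takes place on affine tuples in the standard simplex, and s transports it to the
    space by composition. *)
Definition subdivide n (u : cochain n) : cochain n :=
  fun s => sdiv (@barycenter n) (fun p => u (subsimplex s p)) (@vertex n).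

Definition subdivide_htpy n (u : cochain n.+1) : cochain n :=
  fun s => sdiv_htpy (@barycenter n) (fun p => u (subsimplex s p)) (@vertex n).

Lemma subdivide_subsimplex m n (u : cochain m) (s : simplex n) p :
  subdivide u (subsimplex s p) = sdiv (@barycenter n) (fun q => u (subsimplex s q)) p.
Proof.
rewrite /subdivide.
rewrite (_ : (fun q => _) = (fun q => u (subsimplex s (affine p \o q)))); last first.
  by apply/funext => q; rewrite subsimplex_comp.
rewrite -(@sdiv_nat _ _ F (affine p) (@barycenter m) (@barycenter n) _ _ (fun q => u (subsimplex s q))).
  by congr sdiv; apply/funext => i /=; rewrite affine_vertex.
by move=> k q; exact: barycenter_nat.
Qed.

Lemma subdivide_htpy_subsimplex m n (u : cochain m.+1) (s : simplex n) p :
  subdivide_htpy u (subsimplex s p) =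
  sdiv_htpy (@barycenter n) (fun q => u (subsimplex s q)) p.
Proof.
rewrite /subdivide_htpy.
rewrite (_ : (fun q => _) = (fun q => u (subsimplex s (affine p \o q)))); last first.
  by apply/funext => q; rewrite subsimplex_comp.
rewrite -(@sdiv_htpy_nat _ _ F (affine p) (@barycenter m) (@barycenter n) _ _ (fun q => u (subsimplex s q))).
  by congr sdiv_htpy; apply/funext => i /=; rewrite affine_vertex.
by move=> k q; exact: barycenter_nat.
Qed.

Lemma subdivide_d n (u : cochain n) :
  subdivide (singular_d u) = singular_d (subdivide u) :> cochain n.+1.
Proof.
apply/funext => s; rewrite /subdivide -[RHS](congr1 _ (subsimplex_id s)).
rewrite -(delta_subsimplex s (subdivide u)).
rewrite (_ : (fun p => _) = delta (fun q => u (subsimplex s q))); last first.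
  by apply/funext => q; rewrite delta_subsimplex.
rewrite sdiv_delta; apply: eq_delta => i.
by rewrite subdivide_subsimplex.
Qed.

Lemma subdivide_htpyP n (u : cochain n.+1) (s : simplex n.+1) :
  singular_d (subdivide_htpy u) s + subdivide_htpy (singular_d u) s =
  u s - subdivide u s.
Proof.
rewrite -{1}[s](subsimplex_id s) -(delta_subsimplex s (subdivide_htpy u)).
rewrite -[in RHS](subsimplex_id s) subdivide_subsimplex -[X in _ = _ - X]/(sdiv _ _ _).
rewrite /subdivide_htpy;
rewrite (_ : (fun p => singular_d u (subsimplex s p)) = delta (fun q => u (subsimplex s q))); last first.
  by apply/funext => q; rewrite delta_subsimplex.
rewrite -(sdiv_htpyP _ (fun q => u (subsimplex s q))); congr (_ + _).
by apply: eq_delta => i; exact: (subdivide_htpy_subsimplex u s).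
Qed.

Definition vanishing n m (r : R) (u : cochain m) (s : simplex n) :=
  forall p, (forall i j, near_by r (p i) (p j)) -> u (subsimplex s p) = 0.

Lemma vanishing_subdivide n m r (u : cochain m) (s : simplex n) : 0 <= r ->
  vanishing (m%:R / m.+1%:R * r) u s -> vanishing r (subdivide u) s.
Proof.
move=> r0 us p pr; rewrite subdivide_subsimplex.
apply: (@sdiv_local _ _ (@barycenter n) (near_by r) (near_by (m%:R / m.+1%:R * r)) m.+1) => //.
- by move=> x; apply: near_by_refl; rewrite mulr_ge0 ?divr_ge0.
- by move=> x y; exact: near_by_sym.
- move=> k q km qr i; apply: near_by_le (near_by_barycenter qr i).
  (* The factor k/(k+1) grows with k, so m/(m+1) serves for all faces. *)
  apply: ler_wpM2r => //; rewrite ler_pdivrMr// mulrAC ler_pdivlMr//.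
  by rewrite -!natrM ler_nat; nia.
- by move=> k q x xq _; exact: near_by_affine.
- by move=> q qs _; exact: us.
Qed.

Lemma vanishing_subdivide_htpy n m r (u : cochain m.+1) (s : simplex n) : 0 <= r ->
  vanishing r u s -> vanishing r (subdivide_htpy u) s.
Proof.
move=> r0 us p pr; rewrite subdivide_htpy_subsimplex.
apply: (@sdiv_htpy_local _ _ (@barycenter n) (near_by r) (near_by r) m.+1) => //.
- by move=> x; exact: near_by_refl.
- by move=> x y; exact: near_by_sym.
- move=> k q km qr i; apply: near_by_le (near_by_barycenter qr i).
  rewrite -[X in _ <= X]mul1r; apply: ler_wpM2r => //.
  by rewrite ler_pdivrMr// mul1r ler_nat.
- by move=> k q x xq _; exact: near_by_affine.
- by move=> q qs _; exact: us.
Qed.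

Lemma vanishing_iter n m r (u : cochain m) (s : simplex n) j : 0 <= r ->
  vanishing ((m%:R / m.+1%:R) ^+ j * r) u s -> vanishing r (iter j (@subdivide m) u) s.
Proof.
move=> r0; elim: j r r0 => [|j IHj] r r0; first by rewrite expr0 mul1r.
move=> us /=; apply: vanishing_subdivide => //.
apply: IHj; first by rewrite mulr_ge0 ?divr_ge0.
by rewrite mulrA -exprSr.
Qed.

(** The coordinates differ by at most 1 to begin with, and the powers of m/(m+1) tend to 0. *)
Lemma iter_subdivide_eq0 m r (u : cochain m) (s : simplex m) : 0 < r ->
  vanishing r u s ->
  exists N, forall j, (N <= j)%N -> iter j (@subdivide m) u s = 0.
Proof.
move=> r0 us; have c1 : `|m%:R / m.+1%:R : R| < 1.
  by rewrite ger0_norm ?divr_ge0// ltr_pdivrMr// mul1r ltr_nat.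
have /cvgrPdist_lt/(_ _ r0)[N _ hN] := sequences.cvg_expr c1.
exists N => j Nj; rewrite -(subsimplex_id s).
apply: (@vanishing_iter _ _ 1); first by [].
  move=> p pr; apply: us => i k; apply: near_by_le (pr i k).
  have := hN j Nj; rewrite /= sub0r normrN mulr1 => /ltW; exact: le_trans (ler_norm _).
by move=> i k; exact: near_by1.
Qed.
Lemma subdivideB n (u v : cochain n) :
  subdivide (fun s => u s - v s) = (fun s => subdivide u s - subdivide v s).
Proof. by apply/funext => s; rewrite /subdivide sdivB. Qed.

Lemma subdivide_htpy0 n : subdivide_htpy (fun=> 0 : F) = (fun=> 0) :> cochain n.
Proof.
apply/funext => s; rewrite /subdivide_htpy.
have := sdiv_htpyB (@barycenter n) (fun=> 0 : F) (fun=> 0) (@vertex n).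
by rewrite !subrr.
Qed.

Variable good : forall n, simplex n -> Prop.
Hypothesis good_subsimplex : forall m n (s : simplex n) (p : 'I_m.+1 -> std_simplex R n),
  good s -> good (subsimplex s p).
Hypothesis small_good : forall n (s : simplex n), exists2 r : R, 0 < r &
  forall m (p : 'I_m.+1 -> std_simplex R n),
    (forall i j, near_by r (p i) (p j)) -> good (subsimplex s p).

(* The cochain bounded by [w] is the sum of the iterated subdivisions of the
   subdivision homotopy of [w], only finitely many of which are nonzero on a
   given simplex. *)
Lemma small_cochain_exact n (w : cochain n.+1) :
  singular_d w = (fun=> 0) -> (forall s, good s -> w s = 0) ->
  exists h : cochain n, (forall s, good s -> h s = 0) /\ singular_d h = w.
Proof.
move=> dw gw; pose a j := iter j (@subdivide n) (subdivide_htpy w).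
have vanish m k (u : cochain m) (s : simplex k) : (forall t, good t -> u t = 0) ->
    exists2 r, 0 < r & vanishing r u s.
  by move=> gu; have [r r0 hr] := small_good s; exists r => // p pr; exact/gu/hr.
have [N hN] : {N : simplex n -> nat & forall s j, (N s <= j)%N -> a j s = 0}.
  apply: (@choice _ _ (fun s N => forall j, (N <= j)%N -> a j s = 0)) => s.
  have [r r0 hr] := vanish _ _ _ s gw.
  by apply: (iter_subdivide_eq0 r0); apply: vanishing_subdivide_htpy => //; exact: ltW.
pose h s := \sum_(j < N s) a j s.
have hE s M : (N s <= M)%N -> h s = \sum_(j < M) a j s.
  move=> NM; rewrite /h (big_ord_widen _ (fun j => a j s) NM) big_mkcond.
  by apply: eq_bigr => j _; case: ltnP => // /hN ->.
exists h; split=> [s gs|].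
  rewrite /h big1// => -[j /= _] _; rewrite -(subsimplex_id s).
  apply: (@vanishing_iter _ _ 1) => //; last by move=> *; exact: near_by1.
  apply: vanishing_subdivide_htpy; first by rewrite mulr1 exprn_ge0 ?divr_ge0.
  by move=> p _; apply: gw; exact: good_subsimplex.
apply/funext => s; have [r r0 /(iter_subdivide_eq0 r0)[N' hN']] := vanish _ _ _ s gw.
(* Large enough for the partial sum to be complete on each face of s, and for the remainder of the
   telescoping sum to vanish on s. *)
pose M := (N' + \max_(i < n.+2) N (s \o face R n i : continuousType _ _))%N.
rewrite (@eq_singular_d _ _ (fun t => \sum_(j < M) a j t)); last first.
  move=> i; apply: hE; apply: leq_trans (leq_addl _ _).
  by rewrite (leq_bigmax (F := fun i => N (s \o face R n i : continuousType _ _))).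
have -> : singular_d (fun t => \sum_(j < M) a j t) s = \sum_(j < M) singular_d (a j) s.
  rewrite /singular_d exchange_big; apply: eq_bigr => i _ /=.
  by rewrite mulr_sumr.
(* The homotopy formula for the cocycle w, transported by the iterates of subdivision, makes the sum
   telescope. *)
have da j : singular_d (a j) = (fun t => iter j (@subdivide n.+1) w t - iter j.+1 (@subdivide n.+1) w t).
  elim: j => [|j IHj]; last by rewrite /a iterS -subdivide_d IHj subdivideB.
  apply/funext => t; rewrite -[RHS]subdivide_htpyP dw.
  by rewrite -[X in _ + X]/(subdivide_htpy (fun=> 0) t) subdivide_htpy0 addr0.
under eq_bigr do rewrite da.
rewrite -(big_mkord xpredT (fun j => iter j (@subdivide n.+1) w s - iter j.+1 (@subdivide n.+1) w s)).
rewrite (@telescope_sumr_eq _ 0 M (fun j => - iter j (@subdivide n.+1) w s))//.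
  by rewrite hN' ?leq_addr// oppr0 add0r opprK.
by move=> j _; rewrite opprK addrC.
Qed.

End SmallSimplices.

(** * Heavy vertices, good simplices and the straight-line homotopy *)

Section OrderComplex.
Variables (d : Order.disp_t) (Gam : finBPOrderType d).
Local Notation nb := (nonbot Gam).
Local Notation chains := (order_complex [set~ (\bot%O : Gam)]%SET).
Local Notation Y := (realization (R := R) chains).

Lemma order_complexP (w : Gam -> R) :
  (forall v, 0 <= w v) -> \sum_v w v = 1 -> w \bot%O = 0 ->
  (forall a b, 0 < w a -> 0 < w b -> (a >=< b)%O) -> Y w.
Proof.
move=> w0 w1 wb wc; have pos a : w a != 0 -> 0 < w a by rewrite lt_neqAle eq_sym w0 andbT.
split=> //; rewrite inE; apply/and3P; split.
- have [v wv] : exists v, w v != 0.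
    apply: contrapT => h; have : \sum_v w v = 0.
      by apply: big1 => v _; apply/eqP/negPn/negP => wv; apply: h; exists v.
    by rewrite w1; apply/eqP; exact: oner_neq0.
  by apply/finset.set0Pn; exists v; rewrite inE.
- apply/fintype.subsetP => a; rewrite !inE; apply: contraNneq => ->.
  by rewrite wb.
- apply/forallP => a; apply/implyP; rewrite inE => /pos wa.
  by apply/forallP => b; apply/implyP; rewrite inE => /pos wb'; exact: wc.
Qed.

Lemma coord_bot (y : Y) : coord y \bot%O = 0.
Proof.
have [_ _] := set_valP y; rewrite inE => /and3P[_ /fintype.subsetP h _].
by apply/eqP; apply/contraT => yb; have := h \bot%O; rewrite !inE eqxx => /(_ yb).
Qed.

Lemma coord_comparable (y : Y) a b : 0 < coord y a -> 0 < coord y b -> (a >=< b)%O.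
Proof.
have [_ _] := set_valP y; rewrite inE => /and3P[_ _ /forallP h] ya yb.
have /implyP := h a; rewrite inE => /(_ (lt0r_neq0 ya))/forallP/(_ b)/implyP.
by rewrite inE => /(_ (lt0r_neq0 yb)).
Qed.

(** Some coordinate is at least the mean [1/#|Gam|], and it is not that of the bottom element, which
    is 0. *)
Lemma heavy_ex (y : Y) : exists a : nb, #|Gam|%:R^-1 <= coord y (val a).
Proof.
have G0 : (0 < #|Gam|)%N by apply/card_gt0P; exists \bot%O.
have [a ha] : exists a, #|Gam|%:R^-1 <= coord y a.
  apply/not_existsP => h; have := coord_sum y; apply/eqP; rewrite lt_eqF//.
  have -> : 1 = \sum_(a : Gam) #|Gam|%:R^-1 :> R.
    by rewrite sumr_const -[RHS]mulr_natr mulVf// pnatr_eq0 -lt0n.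
  apply: ltr_sum; first by apply/hasP; exists (\bot%O : Gam); rewrite ?mem_index_enum.
  by move=> a _; rewrite ltNge; apply/negP/h.
have ab : a != \bot%O.
  apply: contraTneq ha => ->; rewrite coord_bot -ltNge invr_gt0 ltr0n//.
by exists (Sub a ab).
Qed.

Definition heavy (y : Y) : nb := projT1 (cid (heavy_ex y)).

Lemma le_coord_heavy y : #|Gam|%:R^-1 <= coord y (val (heavy y)).
Proof. exact: projT2 (cid (heavy_ex y)). Qed.

Lemma card_inv_gt0 : 0 < #|Gam|%:R^-1 :> R.
Proof. by rewrite invr_gt0 ltr0n; apply/card_gt0P; exists \bot%O. Qed.

Lemma coord_heavy y : 0 < coord y (val (heavy y)).
Proof. exact: lt_le_trans card_inv_gt0 (le_coord_heavy y). Qed.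

Lemma vertex_point_proof (a : nb) : Y (fun v => (v == val a)%:R).
Proof.
apply: order_complexP => [v|||b c]; first exact: ler0n.
- by rewrite (bigD1 (val a))//= eqxx big1 ?addr0// => v /negPf ->.
- by rewrite eq_sym (negPf (valP a)).
- by rewrite !ltr0n !lt0b => /eqP -> /eqP ->; exact: comparablexx.
Qed.

Definition vertex_point (a : nb) : Y := SigSub (mem_set (vertex_point_proof a)).

Local Notation simplex := (singular_simplex R Y).

(** The points t and t' are independent because the homotopy mixes the support at one point with
    heavy vertices found at others. *)
Definition good n (s : simplex n) : Prop :=
  forall t t' a, 0 < coord (s t) a -> (a >=< val (heavy (s t')))%O.

Lemma good_subsimplex m n (s : simplex n) (p : 'I_m.+1 -> std_simplex R n) :
  good s -> good (subsimplex s p).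
Proof. by move=> gs t t' a; exact: gs. Qed.

Lemma good0 (s : simplex 0) : good s.
Proof.
move=> t t' a ta; have -> : t' = t.
  apply: coord_inj => i; have := coord_sum t; have := coord_sum t'.
  by rewrite !big_ord1 (ord1 i) => -> ->.
exact: coord_comparable ta (coord_heavy _).
Qed.

(** Between nearby points a coordinate varies by less than [1/#|Gam|], so a heavy vertex at one
    point is in the support at the other, and that support is a chain. *)
Lemma small_good n (s : simplex n) : exists2 r : R, 0 < r &
  forall m (p : 'I_m.+1 -> std_simplex R n),
    (forall i j, near_by r (p i) (p j)) -> good (subsimplex s p).
Proof.
have cs v : continuous (fun t => coord (s t) v).
  move=> t; apply: (@continuous_comp _ _ _ s (coord^~ v)); first exact: cts_fun.
  exact: coord_continuous.
have /choice[f hf] : forall v, exists r : R, 0 < r /\ forall x y, near_by r x y ->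
    `|coord (s x) v - coord (s y) v| < #|Gam|%:R^-1.
  move=> v; have [r r0 hr] := std_simplex_unif_continuous (cs v) card_inv_gt0.
  by exists r.
exists (\big[Num.min/1]_v f v).
  by apply: lt_bigmin => [|v _]; [exact: ltr01|have [] := hf v].
move=> m p pr t t' a /= ta.
set x := affine p t; set y := affine p t'.
apply: coord_comparable ta _; rewrite -/x.
have xy : near_by (f (val (heavy (s y)))) x y.
  apply: (@near_by_le _ (\big[Num.min/1]_v f v)); first exact: bigmin_le.
  apply: near_by_affine => i; apply: near_by_sym; apply: near_by_affine => j.
  exact: pr.
have [_ /(_ _ _ xy)] := hf (val (heavy (s y))).
have := le_coord_heavy (s y); rewrite -/y distrC.
set u := coord (s y) _; set u' := coord (s x) _ => h1.
by move/(le_lt_trans (ler_norm _)); lra.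
Qed.
(* The constant simplex [y0] is a junk value. *)
Definition simplex_of n (y0 : Y) (f : std_simplex R n -> Gam -> R) : simplex n :=
  match pselect ((forall v, continuous (f^~ v)) /\ forall t, Y (f t)) with
  | left h => mkcts (realization_continuous
      (g := fun t => SigSub (mem_set (h.2 t)) : Y) h.1)
  | right _ => cst y0
  end.

Lemma coord_simplex_of n y0 (f : std_simplex R n -> Gam -> R) :
  (forall v, continuous (f^~ v)) -> (forall t, Y (f t)) ->
  forall t v, coord (simplex_of y0 f t) v = f t v.
Proof.
move=> cf Yf t v; rewrite /simplex_of; by case: pselect => [h//|[]].
Qed.

Lemma simplex_ext n (s s' : simplex n) :
  (forall t v, coord (s t) v = coord (s' t) v) -> s = s'.
Proof. by move=> ss'; apply/continuousEP => t; exact: coord_inj. Qed.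

Lemma sum_coord_face n (g : 'I_n.+2 -> R) i (t : std_simplex R n) :
  \sum_j coord (face R n i t) j * g j = \sum_k coord t k * g (lift i k).
Proof.
rewrite [RHS](partition_big (lift i) predT)//=; apply: eq_bigr => j _.
by rewrite coord_face mulr_suml; apply: eq_bigr => k /eqP ->.
Qed.

Lemma bot_val (a : nb) : (\bot%O == val a) = false.
Proof. by rewrite eq_sym; exact: negPf (valP a). Qed.

Definition order_coord n (p : 'I_n.+1 -> nb) (t : std_simplex R n) (v : Gam) : R :=
  \sum_i coord t i * (v == val (p i))%:R.

Definition order_simplex n (p : 'I_n.+1 -> nb) : simplex n :=
  simplex_of (vertex_point (p ord0)) (order_coord p).

Lemma sum_delta (a : Gam) : \sum_v (v == a)%:R = 1 :> R.
Proof. by rewrite (bigD1 a)//= eqxx big1 ?addr0// => v /negPf ->. Qed.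

Lemma order_coord_pos n (p : 'I_n.+1 -> nb) t v : 0 < order_coord p t v ->
  exists i, v = val (p i).
Proof.
move=> tv; apply: contrapT => h; move: tv; rewrite /order_coord big1 ?ltxx// => i _.
by case: eqP => [e|]; rewrite ?mulr0//; case: h; exists i.
Qed.

Lemma coord_order_simplex n (p : 'I_n.+1 -> nb) t v : valid predT p ->
  coord (order_simplex p t) v = order_coord p t v.
Proof.
move=> [_ pc]; apply: coord_simplex_of => [u|x].
  apply: continuous_sum => i y.
  exact: (continuousM (@coord_continuous _ _ i y) (@cst_continuous _ _ _ y)).
apply: order_complexP => [u|||a b].
- by apply: sumr_ge0 => i _; rewrite mulr_ge0 ?coord_ge0.
- rewrite exchange_big -[RHS](coord_sum x); apply: eq_bigr => i _.
  by rewrite -mulr_sumr sum_delta mulr1.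
- by rewrite /order_coord big1// => i _; rewrite bot_val mulr0.
- by move=> /order_coord_pos[i ->] /order_coord_pos[j ->]; exact: pc.
Qed.

Lemma order_simplex_face n (p : 'I_n.+2 -> nb) i : valid predT p ->
  (order_simplex p \o face R n i : continuousType _ _) = order_simplex (p \o lift i).
Proof.
move=> vp; apply: simplex_ext => t v /=; rewrite !coord_order_simplex//.
  by rewrite /order_coord sum_coord_face.
exact: valid_sub.
Qed.

Definition heavy_vertices n (s : simplex n) : 'I_n.+1 -> nb :=
  fun i => heavy (s (vertex i)).

Lemma heavy_vertices_face n (s : simplex n.+1) i :
  heavy_vertices (s \o face R n i : continuousType _ _) = heavy_vertices s \o lift i.
Proof. by apply/funext => k; rewrite /heavy_vertices /= face_vertex. Qed.

(** At a vertex of an affine simplex only one coordinate is positive, so the heavy vertex is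
    determined. *)
Lemma heavy_verticesK n (p : 'I_n.+1 -> nb) : valid predT p ->
  heavy_vertices (order_simplex p) = p.
Proof.
move=> vp; apply/funext => i; apply/val_inj; rewrite /heavy_vertices.
have := coord_heavy (order_simplex p (vertex i)).
rewrite coord_order_simplex// /order_coord.
under eq_bigr do rewrite coord_vertex.
by rewrite sum_delta_coord ltr0n lt0b => /eqP.
Qed.

Lemma valid_heavy_vertices n (s : simplex n) : good s -> valid predT (heavy_vertices s).
Proof. by move=> gs; split=> // i j; apply: gs; exact: coord_heavy. Qed.

Lemma good_order_simplex n (p : 'I_n.+1 -> nb) : valid predT p -> good (order_simplex p).
Proof.
move=> vp t t' a; have := coord_heavy (order_simplex p t').
rewrite !coord_order_simplex// => /order_coord_pos[i ->] /order_coord_pos[j ->].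
exact: (valid_cmp vp).
Qed.

(* [prism_simplex s q] is the restriction to the simplex of a prism with vertices
   [q] of the straight-line homotopy from a good simplex [s] to the affine simplex
   on its heavy vertices; (i, false) is vertex i of [s] and (i, true) is the
   corresponding heavy vertex. *)
Definition prism_weight n k (q : 'I_k.+1 -> 'I_n.+1 * bool) (t : std_simplex R k) : R :=
  \sum_i coord t i * ((q i).2 : nat)%:R.

Definition prism_coord n k (s : simplex n) (q : 'I_k.+1 -> 'I_n.+1 * bool)
    (t : std_simplex R k) (v : Gam) : R :=
  (1 - prism_weight q t) * coord (s (affine (fun i => vertex (q i).1) t)) v +
  \sum_i coord t i * (((q i).2 : nat)%:R * (v == val (heavy_vertices s (q i).1))%:R).

Definition prism_simplex n k (s : simplex n) (q : 'I_k.+1 -> 'I_n.+1 * bool) : simplex k :=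
  simplex_of (s (vertex (q ord0).1)) (prism_coord s q).

Lemma prism_weight_le1 n k (q : 'I_k.+1 -> 'I_n.+1 * bool) t : prism_weight q t <= 1.
Proof.
rewrite -(coord_sum t); apply: ler_sum => i _; rewrite ler_piMr ?coord_ge0//.
by case: (q i).2.
Qed.

Lemma prism_coord_pos n k (s : simplex n) (q : 'I_k.+1 -> 'I_n.+1 * bool) t v :
  0 < prism_coord s q t v ->
  0 < coord (s (affine (fun i => vertex (q i).1) t)) v \/ exists i, v = val (heavy_vertices s i).
Proof.
move=> tv; apply: contrapT => /not_orP[h1 h2]; move: tv; rewrite /prism_coord.
rewrite (_ : coord _ _ = 0); last first.
  by apply/eqP/contraT => e; case: h1; rewrite lt_neqAle eq_sym e coord_ge0.
rewrite mulr0 add0r big1 ?ltxx// => i _.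
by case: eqP => [e|]; rewrite ?mulr0//; case: h2; exists (q i).1.
Qed.

Lemma coord_prism_simplex n k (s : simplex n) (q : 'I_k.+1 -> 'I_n.+1 * bool) t v :
  good s -> coord (prism_simplex s q t) v = prism_coord s q t v.
Proof.
move=> gs; apply: coord_simplex_of => [u|x].
  have cw : continuous (prism_weight q).
    apply: continuous_sum => i y.
    exact: (continuousM (@coord_continuous _ _ i y) (@cst_continuous _ _ _ y)).
  have cs : continuous (fun x => coord (s (affine (fun i => vertex (q i).1) x)) u).
    move=> y; apply: (@continuous_comp _ _ _ (affine _) (fun z => coord (s z) u)).
      exact: affine_continuous.
    apply: (@continuous_comp _ _ _ s (coord^~ u)); first exact: cts_fun.
    exact: coord_continuous.
  have c1 : continuous (fun x => 1 - prism_weight q x).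
    by move=> y; exact: (continuousB (@cst_continuous _ R (1 : R) y) (cw y)).
  have c2 : continuous (fun x : std_simplex R k =>
      \sum_i coord x i * (((q i).2 : nat)%:R * (u == val (heavy_vertices s (q i).1))%:R)).
    apply: continuous_sum => i z.
    exact: (continuousM (@coord_continuous _ _ i z) (@cst_continuous _ _ _ z)).
  by move=> y; exact: (continuousD (continuousM (c1 y) (cs y)) (c2 y)).
apply: order_complexP => [u|||a b].
- apply: addr_ge0; first by rewrite mulr_ge0 ?coord_ge0// subr_ge0 prism_weight_le1.
  by apply: sumr_ge0 => i _; rewrite mulr_ge0 ?coord_ge0// mulr_ge0.
- rewrite big_split -mulr_sumr coord_sum mulr1 exchange_big /=.
  rewrite [X in _ + X](_ : _ = prism_weight q x) ?subrK//.
  by apply: eq_bigr => i _; rewrite -mulr_sumr -mulr_sumr sum_delta mulr1.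
- rewrite /prism_coord coord_bot mulr0 add0r big1// => i _.
  by rewrite bot_val !mulr0.
- move=> /prism_coord_pos[ya|[i ->]] /prism_coord_pos[zb|[j ->]].
  + exact: coord_comparable ya zb.
  + exact: gs ya.
  + by rewrite comparable_sym; exact: gs zb.
  + exact: (valid_cmp (valid_heavy_vertices gs)).
Qed.
Lemma prism_simplex_face n k (s : simplex n) (q : 'I_k.+2 -> 'I_n.+1 * bool) i :
  good s -> (prism_simplex s q \o face R k i : continuousType _ _) =
            prism_simplex s (q \o lift i).
Proof.
move=> gs; apply: simplex_ext => t v /=; rewrite !coord_prism_simplex//.
by rewrite /prism_coord /prism_weight !sum_coord_face affine_face.
Qed.

Definition lift_fst n (i : 'I_n.+1) (x : 'I_n * bool) : 'I_n.+1 * bool := (lift i x.1, x.2).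

Lemma good_face n (s : simplex n.+1) i : good s -> good (s \o face R n i : continuousType _ _).
Proof. by move=> gs t t' a; exact: gs. Qed.

Lemma face_prism_simplex n k (s : simplex n.+1) (q : 'I_k.+1 -> 'I_n.+1 * bool) i :
  good s -> prism_simplex (s \o face R n i : continuousType _ _) q =
            prism_simplex s (lift_fst i \o q).
Proof.
move=> gs; apply: simplex_ext => t v; rewrite !coord_prism_simplex//; last exact: good_face.
rewrite /prism_coord heavy_vertices_face /= face_affine affine_comp.
congr (_ * coord (s (affine _ t)) v + _).
by apply/funext => j /=; rewrite affine_vertex.
Qed.

Lemma prism_simplex_bottom n (s : simplex n) : good s ->
  prism_simplex s (fun i => (i, false)) = s.
Proof.
move=> gs; apply: simplex_ext => t v; rewrite coord_prism_simplex// /prism_coord.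
rewrite /prism_weight !big1 => [|i _|i _]; rewrite ?mul0r ?mulr0//.
by rewrite subr0 mul1r addr0 affine_id.
Qed.

Lemma prism_simplex_top n (s : simplex n) : good s ->
  prism_simplex s (fun i => (i, true)) = order_simplex (heavy_vertices s).
Proof.
move=> gs; apply: simplex_ext => t v; rewrite coord_prism_simplex//.
rewrite coord_order_simplex; last exact: valid_heavy_vertices.
rewrite /prism_coord /prism_weight /=; under eq_bigr do rewrite mulr1.
rewrite coord_sum subrr mul0r add0r.
by apply: eq_bigr => i _; rewrite mul1r.
Qed.

(** * Comparison of singular cochains with cochains of tuples *)

Variable F : fieldType.
Local Notation cochain n := (simplex n -> F).

Lemma singular_dd n (u : cochain n) : singular_d (singular_d u) = (fun=> 0 : F).
Proof.
apply/funext => s; rewrite -(subsimplex_id s) -delta_subsimplex.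
rewrite -(delta_delta (fun q => u (subsimplex s q)) (@vertex _)).
by apply: eq_delta => i; rewrite delta_subsimplex.
Qed.

Definition prism_cochain n (u : cochain n.+1) : cochain n := fun s =>
  prism (fun q => u (prism_simplex s q)) (fun i => (i, false)) (fun i => (i, true)).

Lemma delta_order_simplex n (u : cochain n) (p : 'I_n.+2 -> nb) : valid predT p ->
  delta (fun q => u (order_simplex q)) p = singular_d u (order_simplex p).
Proof. by move=> vp; apply: eq_bigr => i _; rewrite order_simplex_face. Qed.

Lemma prism_closed n (u : cochain n) (s : simplex n) : good s ->
  singular_d u = (fun=> 0 : F) ->
  prism (delta (fun q => u (prism_simplex s q)))
    (fun i : 'I_n.+1 => (i, false)) (fun i => (i, true)) = 0.
Proof.
move=> gs du.
have -> : delta (fun q => u (prism_simplex s q)) = (fun q => 0 : F).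
  apply/funext => q; rewrite -[RHS](congr1 (fun f => f (prism_simplex s q)) du).
  by apply: eq_bigr => i _; rewrite prism_simplex_face.
have := prismB (fun=> 0 : F) (fun=> 0) (fun i : 'I_n.+1 => (i, false)) (fun i => (i, true)).
by rewrite !subrr.
Qed.

Lemma prism_lift n i (W : ('I_n.+2 -> 'I_n.+2 * bool) -> F)
    (W' : ('I_n.+2 -> 'I_n.+1 * bool) -> F) : (forall q, W' q = W (lift_fst i \o q)) ->
  prism W' (fun j => (j, false)) (fun j => (j, true)) =
  prism W ((fun j => (j, false)) \o lift i) ((fun j => (j, true)) \o lift i).
Proof.
move=> /funext ->; rewrite -[LHS](prism_nat (lift_fst i) W).
by congr (prism W _ _).
Qed.

(** The prism formula: its interior term vanishes as u is closed, and the prisms on the faces of s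
    make up the coboundary. *)
Lemma prism_cochainP n (u : cochain n.+1) (s : simplex n.+1) : good s ->
  singular_d u = (fun=> 0 : F) ->
  singular_d (prism_cochain u) s = u (order_simplex (heavy_vertices s)) - u s.
Proof.
move=> gs du; have := prism_htpy (fun q => u (prism_simplex s q))
  (fun i : 'I_n.+2 => (i, false)) (fun i => (i, true)).
rewrite prism_closed// add0r prism_simplex_bottom// prism_simplex_top// => <-.
apply: eq_bigr => i _; congr (_ * _).
apply: (@prism_lift n i (fun q => u (prism_simplex s q))) => q.
by rewrite face_prism_simplex.
Qed.

(** The prism on a point is a path without side faces, and a closed u agrees at its two ends. *)
Lemma order_simplex_heavy0 (u : cochain 0) (s : simplex 0) :
  singular_d u = (fun=> 0 : F) -> u (order_simplex (heavy_vertices s)) = u s.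
Proof.
move=> du; have gs := @good0 s; have := prism_htpy (fun q => u (prism_simplex s q))
  (fun i : 'I_1 => (i, false)) (fun i => (i, true)).
rewrite prism_closed// add0r prism_simplex_bottom// prism_simplex_top//.
by rewrite big_ord1 /= mulr0 => /esym/eqP; rewrite subr_eq0 => /eqP.
Qed.

(** Reading g on heavy vertices and correcting by the prism cobounds u on good simplices. The error
    is a cocycle that vanishes on good simplices, hence a coboundary. *)
Lemma eq_order_cochains_cobound n (u : cochain n) (g : ('I_n -> nb) -> F) :
  singular_d u = (fun=> 0 : F) -> (n = 0%N -> forall p, g p = 0) ->
  (forall p, valid predT p -> u (order_simplex p) = delta g p) ->
  @coboundary F (singular_cochain R F Y) (fun n => @singular_d R F Y n) n u.
Proof.
case: n u g => [|n] u g du g0 ug.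
  apply/funext => s; rewrite -(order_simplex_heavy0 s du) ug.
    by rewrite delta_nil g0.
  exact/valid_heavy_vertices/good0.
pose v : cochain n := fun s => g (heavy_vertices s) - prism_cochain u s.
have dv s : good s -> singular_d v s = u s.
  move=> gs; transitivity (delta g (heavy_vertices s) - singular_d (prism_cochain u) s).
    rewrite /singular_d /delta -sumrB; apply: eq_bigr => i _.
    by rewrite -mulrBr /v heavy_vertices_face.
  rewrite -(ug _ (valid_heavy_vertices gs)) (prism_cochainP gs du).
  by rewrite opprB addrC subrK.
have dB m (u1 u2 : cochain m) :
    singular_d (fun s => u1 s - u2 s) = (fun s => singular_d u1 s - singular_d u2 s).
  by apply/funext => s; rewrite /singular_d -sumrB; apply: eq_bigr => i _; rewrite mulrBr.
have [||h [_ dh]] := small_cochain_exact good_subsimplex small_good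
    (w := fun s => u s - singular_d v s).
- by rewrite dB du singular_dd; apply/funext => s; rewrite subrr.
- by move=> s gs; rewrite dv// subrr.
exists (fun s => h s + v s); apply/funext => s.
transitivity (singular_d h s + singular_d v s).
  by rewrite /= /singular_d -big_split; apply: eq_bigr => i _; rewrite mulrDr.
by rewrite dh subrK.
Qed.

(** Reading c on heavy vertices gives a cochain closed on good simplices. A correction that vanishes
    on good simplices closes it everywhere and keeps its values on affine simplices, which are
    good. *)
Lemma order_cocycle_extends n (c : ('I_n.+1 -> nb) -> F) : cocycle_on predT c ->
  exists u : cochain n, singular_d u = (fun=> 0 : F) /\
    forall p, valid predT p -> u (order_simplex p) = c p.
Proof.
move=> cc; pose u0 : cochain n := fun s => c (heavy_vertices s).
have du0 s : good s -> singular_d u0 s = 0.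
  move=> gs; rewrite -(cc _ (valid_heavy_vertices gs)).
  by apply: eq_bigr => i _; rewrite /u0 heavy_vertices_face.
have [h [gh dh]] := small_cochain_exact good_subsimplex small_good (singular_dd u0) du0.
exists (fun s => u0 s - h s); split=> [|p vp].
  apply/funext => s; transitivity (singular_d u0 s - singular_d h s).
    by rewrite /singular_d -sumrB; apply: eq_bigr => i _; rewrite mulrBr.
  by rewrite dh subrr.
rewrite gh; last exact: good_order_simplex.
by rewrite subr0 /u0 heavy_verticesK.
Qed.
End OrderComplex.

End Realization.

(** * The isomorphism *)

Section CohomologyMap.
Variables (F : fieldType) (C D : nat -> lmodType F).
Variables (dC : forall n, {linear C n -> C n.+1}) (dD : forall n, {linear D n -> D n.+1}).
Variables (n : nat) (f : {linear C n -> D n}).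
Hypothesis f_cocycle : forall u, dC n u = 0 -> dD n (f u) = 0.
Hypothesis f_coboundary : forall u, coboundary dC u -> coboundary dD (f u).
Hypothesis f_inj : forall u, dC n u = 0 -> coboundary dD (f u) -> coboundary dC u.
Hypothesis f_surj : forall v, dD n v = 0 -> exists u, dC n u = 0 /\ f u = v.

Lemma cocycleP (E : nat -> lmodType F) (dE : forall n, {linear E n -> E n.+1}) u :
  reflect (dE n u = 0) (u \in @cocycles F E dE n).
Proof. by rewrite unfold_in; exact: eqP. Qed.

Lemma cocycle_map_proof (z : subspace_of (@cocycles F C dC n)) :
  f (val z) \in @cocycles F D dD n.
Proof. by apply/cocycleP/f_cocycle/cocycleP; exact: valP. Qed.

Definition cocycle_map (z : subspace_of (@cocycles F C dC n)) :
  subspace_of (@cocycles F D dD n) := Subspace (cocycle_map_proof z).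

Lemma cobounding_cocycleP (E : nat -> lmodType F)
    (dE : forall n, {linear E n -> E n.+1}) (y z : subspace_of (@cocycles F E dE n)) :
  reflect (coboundary dE (val y - val z)) (y - z \in @cobounding_cocycles F E dE n).
Proof. by rewrite unfold_in -raddfB; exact: asboolP. Qed.

Definition cohomology_map (x : cohomology dC n) : cohomology dD n :=
  quotient_proj _ (cocycle_map (quotient_repr x)).

Lemma cohomology_mapE z :
  cohomology_map (quotient_proj _ z) = quotient_proj _ (cocycle_map z).
Proof.
apply/quotient_projP/cobounding_cocycleP; rewrite /= -linearB; apply: f_coboundary.
by apply/cobounding_cocycleP/quotient_projP; rewrite quotient_reprK.
Qed.

Lemma cohomology_map_linear : linear cohomology_map.
Proof.
move=> c x y; rewrite -[x]quotient_reprK -[y]quotient_reprK -linearP !cohomology_mapE.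
rewrite -linearP; congr quotient_proj; apply/val_inj.
by rewrite [RHS]linearP /= linearP.
Qed.

HB.instance Definition _ :=
  GRing.isLinear.Build F _ _ *:%R cohomology_map cohomology_map_linear.

Lemma cohomology_map_bijective : bijective cohomology_map.
Proof.
have inj : injective cohomology_map.
  move=> x y; rewrite -[x]quotient_reprK -[y]quotient_reprK !cohomology_mapE.
  set z := quotient_repr x; set z' := quotient_repr y.
  move=> /quotient_projP/cobounding_cocycleP; rewrite /= -linearB => h.
  apply/quotient_projP/cobounding_cocycleP; apply: f_inj => //.
  by rewrite linearB (cocycleP _ _ (valP z)) (cocycleP _ _ (valP z')) subrr.
have surj y : exists x, cohomology_map x = y.
  rewrite -[y]quotient_reprK; set z := quotient_repr y.
  have [u [/cocycleP du fu]] := f_surj (cocycleP _ _ (valP z)).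
  exists (quotient_proj _ (Subspace du)); rewrite cohomology_mapE.
  by congr quotient_proj; exact: val_inj.
have [g hg] := choice surj.
by exists g => // x; apply: inj.
Qed.

Lemma cohomology_iso : exists g : {linear cohomology dC n -> cohomology dD n}, bijective g.
Proof. by exists cohomology_map; exact: cohomology_map_bijective. Qed.

End CohomologyMap.

(** * From singular cochains of Y to the internal complex *)

Section InternalCohomology.
Variables (R : realType) (F : fieldType) (d : Order.disp_t) (Gam : finBPOrderType d).
Hypothesis Gam_ranked : ranked Gam.
Hypothesis Gam_uniform : uniform Gam.
Hypothesis Gam_koszul : koszul (@poset_alg_deg F d Gam).
Local Notation nb := (nonbot Gam).
Local Notation Y := (realization (R := R) (order_complex [set~ (\bot%O : Gam)]%SET)).
Local Notation r := (@gen F d Gam).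
Local Notation lp := (@letter_part F d Gam).
Local Notation hp := (@hpart F d Gam).
Local Notation cochain n := (singular_cochain R F Y n).
Local Notation internal n := (subspace_of (@internal_mod F d Gam n 0)).

Let cg := poset_alg_connected F Gam.
Let sd := poset_strand_data F Gam_ranked Gam_uniform.

Lemma internal_modP n u : u \in @internal_mod F d Gam n 0 <->
  exists2 a : nb -> poset_alg F Gam, forall y, hp n (a y) = a y
    & u = \sum_(y | rk (val y) == n.+1) r y * a y.
Proof.
rewrite unfold_in /= subn0; split=> [/asboolP|h]; last apply/asboolP.
  by case=> a ha ->; exists a => // y; exact/deg_comp.
by case: h => a ha ->; exists a => // y; exact/deg_comp.
Qed.

Lemma internal_mod_layer n u : u \in @internal_mod F d Gam n 0 ->
  in_layer hp lp predT n.+1 u.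
Proof. by move=> /internal_modP[a ha ->]; exact: (sum_in_layer cg sd predT ha). Qed.

Lemma poset_d_layer n u : u \in @internal_mod F d Gam n 0 ->
  poset_d F Gam * u = dsum r predT n.+2 * u.
Proof. by move=> /internal_modP[a ha uE]; exact: (sum_r_layer sd uE). Qed.

Lemma predT_lower : lower (predT : pred nb). Proof. by []. Qed.

Definition order_cochain n (u : cochain n) : ('I_n.+1 -> nb) -> F :=
  fun p => u (order_simplex R p).

Lemma order_cochain_internal n (u : cochain n) :
  Psi r predT (order_cochain u) \in @internal_mod F d Gam n 0.
Proof.
apply/internal_modP; exists (fun y => Psi r predT (fun q => order_cochain u (tcons y q))).
  by move=> y; exact: (Psi_deg cg sd).
exact: PsiS.
Qed.

Definition internal_class n (u : cochain n) : internal n :=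
  Subspace (order_cochain_internal u).

Lemma internal_class_linear n : linear (@internal_class n).
Proof.
by move=> c u v; apply/val_inj; rewrite linearP; exact: (PsiP r predT c).
Qed.

HB.instance Definition _ n :=
  GRing.isLinear.Build F _ _ *:%R (@internal_class n) (@internal_class_linear n).

Lemma internal_class_d n (u : cochain n) :
  internal_d_fun (internal_class u) = internal_class (singular_d u).
Proof.
apply/val_inj => /=; rewrite (poset_d_layer (order_cochain_internal u)).
rewrite -(Psi_delta sd _ predT_lower); apply: (eq_Psi sd predT_lower) => p vp _.
exact: delta_order_simplex.
Qed.
Let exact_layers := poset_layer_exact Gam_ranked Gam_uniform Gam_koszul.

Lemma internal_dP n (v : internal n) :
  internal_d_fun v = 0 -> dsum r predT n.+2 * val v = 0.
Proof. by move/(congr1 val) => /= <-; rewrite (poset_d_layer (valP v)). Qed.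

Lemma internal_class_inj n (u : cochain n) : singular_d u = 0 ->
  @coboundary F (fun n => internal n) (fun n => @internal_d_fun F d Gam n 0) n
    (internal_class u) ->
  @coboundary F (singular_cochain R F Y) (fun n => @singular_d R F Y n) n u.
Proof.
move=> du cu.
have cocycle_u : cocycle_on predT (order_cochain u).
  move=> p vp; rewrite (delta_order_simplex u vp).
  by rewrite -[RHS](congr1 (fun f => f (order_simplex R p)) du).
(* In degree 0 only 0 is a coboundary, which is the case w = 0. *)
have [w hw Pw] : exists2 w, (if n is 0 then w = 0 else in_layer hp lp predT n w) &
    Psi r predT (order_cochain u) = dsum r predT n.+1 * w.
  case: n u {du cocycle_u} cu => [|n] u /=.
    by move/(congr1 val) => /= ->; exists 0; rewrite // mulr0.
  case=> v /(congr1 val) /= <-; exists (val v).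
    exact: internal_mod_layer (valP v).
  exact: poset_d_layer (valP v).
have [g [g0 ug]] := cocycle_class_inj Gam_ranked cg sd (@gen_scaler_eq0 F d Gam)
  exact_layers cocycle_u hw Pw.
exact: (eq_order_cochains_cobound du g0 ug).
Qed.

Lemma internal_class_surj n (v : internal n) : internal_d_fun v = 0 ->
  exists u : cochain n, singular_d u = 0 /\ internal_class u = v.
Proof.
move=> dv; have [f [coc fv]] := cocycle_class_surj Gam_ranked cg sd
  (@gen_scaler_eq0 F d Gam) exact_layers (internal_mod_layer (valP v)) (internal_dP dv).
have [u [du uf]] := order_cocycle_extends R coc.
have uv : Psi r predT (order_cochain u) = val v.
  by rewrite -fv; apply: (eq_Psi sd predT_lower) => p vp _; exact: uf.
by exists u; split=> //; exact: val_inj.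
Qed.

Lemma internal_class_coboundary n (u : cochain n) :
  @coboundary F (singular_cochain R F Y) (fun n => @singular_d R F Y n) n u ->
  @coboundary F (fun n => internal n) (fun n => @internal_d_fun F d Gam n 0) n
    (internal_class u).
Proof.
case: n u => [|n] u /=; first by move=> ->; rewrite linear0.
by case=> v <-; exists (internal_class v); exact: internal_class_d.
Qed.

Lemma singular_internal_iso n :
  exists f : {linear singular_cohomology R F Y n -> internal_cohomology F Gam n 0},
    bijective f.
Proof.
apply: (@cohomology_iso F (singular_cochain R F Y) (fun n => internal n)
  (fun n => @singular_d R F Y n) (fun n => @internal_d_fun F d Gam n 0) n
  (@internal_class n)).
- move=> u du; transitivity (internal_class (singular_d u : cochain n.+1)).
    exact: internal_class_d.
  by rewrite (du : singular_d u = 0 :> cochain n.+1) linear0.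
- exact: internal_class_coboundary.
- exact: internal_class_inj.
- exact: internal_class_surj.
Qed.

End InternalCohomology.

Theorem theorem1p1 (R : realType) (F : fieldType) (d : Order.disp_t)
    (Gam : finBPOrderType d) (Gam_ranked : ranked Gam)
    (Gam_uniform : uniform Gam)
    (Gam_koszul : koszul (@poset_alg_deg F d Gam)) :
  let Y : topologicalType :=
    realization (order_complex [set~ (\bot%O : Gam)]%SET) : set {ptws Gam -> R} in
  forall n : nat,
    exists f : {linear singular_cohomology R F Y n
                -> internal_cohomology F Gam n 0},
      bijective f.
Proof. exact: singular_internal_iso. Qed.
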